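(* Let $H,U,Y,Z$ be separable (complex) Hilbert spaces with $Z$ continuously and densely embedded in $H$, and let $T>0$. Let $A_m:Z\subset H\to H$ be a closed linear operator and $G:Z\to U$ a surjective linear operator such that $A:=(A_m)_{|D(A)}$ with $D(A):=\ker G$ generates a strongly continuous semigroup $\mathbb{T}$ on $H$. Let $\mathbb{D}_\lambda\in\mathcal{L}(U,H)$, $\lambda\in\rho(A)$, be the associated Dirichlet operators and $B=(\lambda-A_{-1})\mathbb{D}_\lambda\in\mathcal{L}(U,H_{-1})$ the associated control operator. Let $C\in\mathcal{L}(H_1,Y)$, and let $\omega>\omega_0(\mathbb{T})$, where $\omega_0(\mathbb{T})$ is the growth bound of $\mathbb{T}$. Then: (i) $C$ is an $\mathcal{S}$-admissible observation operator for $A$ if and only if $$\sum_{n\in\mathbb{Z}}\left\|CR\left(\omega+\tfrac{2\pi i n}{T},A\right)\right\|_2^2<\infty .$$ (ii) $B$ is an $\mathcal{S}$-admissible control operator for $A$ if and only if $$\sum_{n\in\mathbb{Z}}\left\|\mathbb{D}_{\omega+\frac{2\pi i n}{T}}\right\|_2^2<\infty .$$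
   Context: Spaces. $H_1$ is $D(A)$ with norm $\|(\beta-A)x\|$ ($\beta\in\rho(A)$ fixed), and $H_{-1}$ is the completion of $H$ for the norm $\|R(\beta,A)x\|$, where $R(\beta,A)=(\beta-A)^{-1}$. $\mathbb{T}$ extends to a strongly continuous semigroup $\mathbb{T}_{-1}$ on $H_{-1}$, whose generator $A_{-1}$ extends $A$ and has domain $H$. $\|\cdot\|_2$ is the Hilbert–Schmidt norm (of operators $H\to Y$ in (i), $U\to H$ in (ii)), equal to $+\infty$ if the operator is not Hilbert–Schmidt. Dirichlet operator. For $\lambda\in\rho(A)$ one has $Z=D(A)\oplus\ker(\lambda-A_m)$, the restriction $G_{|\ker(\lambda-A_m)}$ is invertible onto $U$, and $\mathbb{D}_\lambda:=(G_{|\ker(\lambda-A_m)})^{-1}:U\to\ker(\lambda-A_m)\subset H$; it is part of the standing setting that $\mathbb{D}_\lambda$ is bounded from $U$ to $H$. The operator $B:=(\lambda-A_{-1})\mathbb{D}_\lambda$ does not depend on $\lambda\in\rho(A)$. $\mathcal{S}$-admissibility. The output map of $(A,C)$ is $(\Psi_Tx)(t)=C\mathbb{T}(t)x$, $x\in D(A)$, $t\in[0,T]$; $C$ is an $\mathcal{S}$-admissible observation operator for $A$ if $\Psi_T$ has an extension to a Hilbert–Schmidt operator from $H$ into $L^2(0,T;Y)$. The input map of $(A,B)$ is $\Phi_Tu=\int_0^T\mathbb{T}_{-1}(T-s)Bu(s)\,ds$, $u\in L^2(0,T;U)$ (integral in $H_{-1}$); $B$ is an $\mathcal{S}$-admissible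 control operator for $A$ if $\Phi_T$ defines a Hilbert–Schmidt operator from $L^2(0,T;U)$ into $H$. *)

(* Defs.v *)
From HB Require Import structures.
From mathcomp Require Import all_boot all_order all_algebra.
From mathcomp Require Import all_classical all_reals all_analysis.
From mathcomp Require Export complex.

Set Implicit Arguments.
Unset Strict Implicit.
Unset Printing Implicit Defensive.
Import Order.TTheory GRing.Theory Num.Theory.
Import numFieldNormedType.Exports.

Local Open Scope classical_set_scope.
Local Open Scope complex_scope.
Local Open Scope ring_scope.

HB.mixin Record CompleteNormedModule_isHilbert (R : realType) V
    of CompleteNormedModule R[i] V := {
  dot : {dot V for (fun z : R[i] => z^*)} ;
  dotxx : forall x : V, dot x x = `|x| ^+ 2 }.

#[short(type="hilbertType")]
HB.structure Definition Hilbert (R : realType) :=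
  {V of CompleteNormedModule R[i] V & CompleteNormedModule_isHilbert R V}.

Definition separable (V : topologicalType) :=
  exists2 S : set V, countable S & dense S.

(* Norms of modules over R[i] take their values in R[i]. *)
Definition rnorm (R : realType) (V : normedModType R[i]) (x : V) : R :=
  complex.Re `|x|.

(* A Hilbert space presented by representatives: its vectors are the elements
   of [rep_dom] modulo those of zero seminorm.  This covers both a genuine
   Hilbert space and L^2(0, T; Y) as a space of functions modulo equality
   almost everywhere. *)
Record hilbertRep (R : realType) := HilbertRep {
  rep_sort :> lmodType R[i] ;
  rep_dom : set rep_sort ;
  rep_dot : rep_sort -> rep_sort -> R[i] }.
Arguments rep_dom {R} h _ : rename.

Section HilbertSchmidt.
Context {R : realType}.
Implicit Types E F : hilbertRep R.

Definition sqnorm E (x : E) : R := complex.Re (rep_dot x x).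

Definition orthonormal_basis E (S : set E) :=
  [/\ S `<=` rep_dom E,
      forall e, S e -> rep_dot e e = 1,
      forall e f, S e -> S f -> e != f -> rep_dot e f = 0 &
      forall x, rep_dom E x -> (forall e, S e -> rep_dot x e = 0) ->
        sqnorm x = 0].

(* For a bounded linear [K] the inner sum does not depend on the basis [S];
   the infimum only serves to select its common value. *)
Definition HS_norm2 E F (K : E -> F) : \bar R :=
  ereal_inf [set \esum_(e in S) (sqnorm (K e))%:E
            | S in @orthonormal_basis E].

Definition hilbert_schmidt E F (K : E -> F) :=
  [/\ forall x, rep_dom E x -> rep_dom F (K x),
      forall (a : R[i]) x y, rep_dom E x -> rep_dom E y ->
        sqnorm (K (a *: x + y) - (a *: K x + K y)) = 0,
      exists M : R, forall x, rep_dom E x -> sqnorm (K x) <= M * sqnorm x &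
      (HS_norm2 K < +oo)%E].

Definition hil (H : hilbertType R) : hilbertRep R :=
  HilbertRep [set: H] (fun x y => dot x y).

End HilbertSchmidt.

Section VectorValued.
Context {R : realType} {V : normedModType R[i]}.
Local Notation mu := (@lebesgue_measure R).
Implicit Types (T : R) (f : R -> V) (s : seq (set R * V)).

(* The list [:: (A1, v1); ...; (An, vn)] stands for the simple function
   \1_A1 v1 + ... + \1_An vn. *)
Definition simple_eval s (t : R) : V :=
  \sum_(p <- s) (\1_(p.1) t)%:C *: p.2.

Definition simple_integral T s : V :=
  \sum_(p <- s) (fine (mu (p.1 `&` `[0, T])))%:C *: p.2.

Definition simple_measurable s :=
  forall p, p \in s -> measurable p.1.

Definition simple_approximation T f (s : nat -> seq (set R * V)) :=
  (forall n, simple_measurable (s n)) /\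
  forall t, t \in `[0, T] -> simple_eval (s n) t @[n --> \oo] --> f t.

(* Convergence is required at every point of [0, T]: each class modulo equality
   almost everywhere has such a Borel representative. *)
Definition strongly_measurable T f :=
  exists s : nat -> seq (set R * V), simple_approximation T f s.

Definition is_bochner_integral T f (v : V) :=
  exists s : nat -> seq (set R * V),
  [/\ simple_approximation T f s,
      (\int[mu]_(t in `[0%R, T]) (rnorm (f t - simple_eval (s n) t))%:E)%E
        @[n --> \oo] --> 0%:E &
      simple_integral T (s n) @[n --> \oo] --> v].

End VectorValued.

Section L2.
Context {R : realType}.
Local Notation mu := (@lebesgue_measure R).

Definition L2_dom (T : R) (Y : hilbertType R) : set (R -> Y) :=
  [set f | strongly_measurable T f /\
    (\int[mu]_(t in `[0%R, T]) (rnorm (f t) ^+ 2)%:E < +oo)%E].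

Definition L2_dot (T : R) (Y : hilbertType R) (f g : R -> Y) : R[i] :=
  (\int[mu]_(t in `[0%R, T]) complex.Re (dot (f t) (g t)))
  +i* (\int[mu]_(t in `[0%R, T]) complex.Im (dot (f t) (g t))).

Definition L2 (T : R) (Y : hilbertType R) : hilbertRep R :=
  @HilbertRep R (R -> Y) (@L2_dom T Y) (@L2_dot T Y).

End L2.

Section Semigroup.
Context {R : realType} {V : normedModType R[i]}.
Implicit Types (A : set (V * V)) (S : R -> V -> V).

(* Unbounded operators are given by their graphs. *)
Definition op_dom A : set V := [set x | exists y, A (x, y)].

Definition resolvent_set A : set R[i] :=
  [set l | (forall y, exists! x, exists2 w, A (x, w) & l *: x - w = y) /\
           exists M : R, forall x w, A (x, w) ->
             rnorm x <= M * rnorm (l *: x - w)].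

(* (l - A)^-1; meaningful for [l] in [resolvent_set A]. *)
Definition resolvent A (l : R[i]) (y : V) : V :=
  xget 0 [set x | exists2 w, A (x, w) & l *: x - w = y].

Definition C0_semigroup S :=
  [/\ forall t, 0 <= t -> linear (S t) /\ continuous (S t),
      forall x, S 0 x = x,
      forall s t x, 0 <= s -> 0 <= t -> S (s + t) x = S s (S t x) &
      forall x, S t x @[t --> 0^'+] --> x].

Definition generator S : set (V * V) :=
  [set p | (h^-1)%:C *: (S h p.1 - p.1) @[h --> 0^'+] --> p.2].

Definition growth_bound S : \bar R :=
  ereal_inf [set w%:E | w in [set w : R | exists M : R, forall t x,
    0 <= t -> rnorm (S t x) <= M * expR (w * t) * rnorm x]].

End Semigroup.

Section BoundarySystem.
Context {R : realType} {H U Y Z : hilbertType R}.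

(* [iota] is the embedding of Z into H. *)
Definition boundary_op (iota Am : Z -> H) (G : Z -> U) : set (H * H) :=
  [set (iota z, Am z) | z in [set z | G z = 0]].

(* Meaningful for [l] in the resolvent set of [boundary_op iota Am G]: then the
   set below is a singleton. *)
Definition dirichlet (iota Am : Z -> H) (G : Z -> U) (l : R[i]) (u : U) : H :=
  xget 0 [set iota z | z in [set z | Am z = l *: iota z /\ G z = u]].

(* [C] in L(H_1, Y); only the values of [C] on the domain of [A] matter. *)
Definition bounded_on_H1 (A : set (H * H)) (beta : R[i]) (C : H -> Y) :=
  (forall (a : R[i]) x y, op_dom A x -> op_dom A y ->
     C (a *: x + y) = a *: C x + C y) /\
  exists M : R, forall x w, A (x, w) ->
    rnorm (C x) <= M * rnorm (beta *: x - w).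

(* [j : H -> Hm1] is a completion of H for the norm |R(beta, A) x|. *)
Definition extrapolation_space (A : set (H * H)) (beta : R[i])
    (Hm1 : completeNormedModType R[i]) (j : {linear H -> Hm1}) :=
  (forall x, rnorm (j x) = rnorm (resolvent A beta x)) /\ dense (range j).

Definition S_admissible_observation (T : R) (A : set (H * H))
    (S : R -> H -> H) (C : H -> Y) :=
  exists2 Psi : hil H -> L2 T Y, hilbert_schmidt Psi &
    forall x, op_dom A x ->
      {ae @lebesgue_measure R, forall t, t \in `[0, T] ->
        Psi x t = C (S t x)}.

Definition S_admissible_control (T : R) (Hm1 : completeNormedModType R[i])
    (j : H -> Hm1) (Sm1 : R -> Hm1 -> Hm1) (B : U -> Hm1) :=
  exists2 Phi : L2 T U -> hil H, hilbert_schmidt Phi &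
    forall u, L2_dom T u ->
      is_bochner_integral T (fun s => Sm1 (T - s) (B (u s))) (j (Phi u)).

End BoundarySystem.

(* Main.v *)
Require Import Defs.
From mathcomp Require Import all_boot all_order all_algebra.
From mathcomp Require Import all_classical all_reals all_analysis complex.
From mathcomp Require Import measurable_realfun ring lra.
Import Order.TTheory GRing.Theory Num.Theory.
Import numFieldNormedType.Exports.

Set Implicit Arguments.
Unset Strict Implicit.
Unset Printing Implicit Defensive.

Import complex.ComplexField.Normc.
Local Open Scope classical_set_scope.
Local Open Scope complex_scope.
Local Open Scope ring_scope.

(* Put l_n = omega + 2 pi i n / T and Q = exp(- omega T) S(T).  Since
   exp(- l_n T) = exp(- omega T) for every n, integrating the orbit of x yields
   int_0^T exp(- l_n t) S(t) x dt = R(l_n, A)(x - Q x): up to the factor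
   T^(-1/2), the n-th Fourier coefficient of t |-> exp(- omega t) C S(t) x is
   C R(l_n, A)(x - Q x).  As omega exceeds the growth bound, Q^k -> 0
   geometrically, so 1 - Q has a bounded inverse, and composing with either of
   them changes a Hilbert-Schmidt norm by a bounded factor only.  Parseval's
   identity in L^2(0, T; Y) and an exchange of the sums over n and over an
   orthonormal basis of H then give (i).
   For (ii) the same computation in the extrapolation space shows that the input
   map sends exp(omega t) exp(2 pi i n t / T) v to
   exp(omega T)(D_(l_n) v - Q D_(l_n) v); these inputs are the images of an
   orthogonal basis of L^2(0, T; U) under an invertible multiplication operator.
   Fourier series in L^2 of a Hilbert space are summed without Fejer kernels:
   powers of trigonometric polynomials approximate indicators of intervals. *)

(** * Norms and inner products *)

(** Both equivalences concern finiteness, so constant factors may be lost. This matters because the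
    Hilbert-Schmidt norm is an infimum over orthonormal bases: in place of its independence of the
    basis stands a comparison up to a constant, valid for every family that obeys a Bessel
    inequality. Images of orthonormal families under bounded operators are such families, which
    handles 1 - Q, its inverse and the exponential weights without adjoints. Two obstacles shape the
    rest. [C] is unbounded on H, so an integral passes through it only in the form C R(beta, A),
    applied to the orbit of (beta - A) x with x in D(A); other x are reached by density. On the
    control side every input has an integral, but in the extrapolation space; that it lies in H is
    shown by approximation with finite sums of modes, whose integrals are explicit vectors of H.
    Elements of L^2 are functions, not classes, so the Hilbert space facts are proved for a
    semidefinite inner product, with vanishing of the seminorm in place of equality. *)

Lemma le_mul_eps (R : realFieldType) (x y c : R) :
  0 <= c -> (forall e, 0 < e -> x <= y + c * e) -> x <= y.
Proof.
move=> c0 h; rewrite leNgt; apply/negP => yx.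
have e0 : 0 < (x - y) / (2 * (c + 1)).
  by rewrite divr_gt0 ?subr_gt0// mulr_gt0// ltr_wpDl.
have := h _ e0.
have -> : c * ((x - y) / (2 * (c + 1))) = (x - y) * (c / (2 * (c + 1))).
  by rewrite mulrCA.
have : c / (2 * (c + 1)) < 1 by rewrite ltr_pdivrMr ?mulr_gt0 ?ltr_wpDl//; lra.
by move=> h1 h2; nra.
Qed.

Section ComplexModulus.
Variable R : realType.
Implicit Types a b : R[i].

Lemma normc_ge0 a : 0 <= normc a.
Proof. by case: a => x y; exact: sqrtr_ge0. Qed.

Lemma normc_real (x : R) : normc x%:C = `|x|.
Proof. by rewrite /normc/= expr0n/= addr0 sqrtr_sqr. Qed.

Lemma normcE' a : `|a| = (normc a)%:C.
Proof. by rewrite normc_def; case: a. Qed.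

Lemma normc_sqr a : normc a ^+ 2 = complex.Re a ^+ 2 + complex.Im a ^+ 2.
Proof. by case: a => x y; rewrite sqr_sqrtr// addr_ge0 ?sqr_ge0. Qed.

Lemma normc_conj a : normc (conjc a) = normc a.
Proof. by case: a => x y /=; rewrite sqrrN. Qed.

Lemma normc_Re a : `|complex.Re a| <= normc a.
Proof.
rewrite -(@ler_pXn2r _ 2)// ?nnegrE ?normc_ge0// normc_sqr real_normK ?num_real//.
by rewrite lerDl sqr_ge0.
Qed.

Lemma sqr_normc_conj a : `|a| ^+ 2 = a * conjc a.
Proof.
rewrite normcE' -rmorphXn/= normc_sqr; case: a => x y /=; simpc.
by congr Complex; ring.
Qed.

Lemma conjc_divr a (r : R) : conjc (a / r%:C) = conjc a / r%:C.
Proof.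
by rewrite -(fmorphV (real_complex R))/=; case: a => x y; simpc.
Qed.

Lemma normc_gt0 a : (0 < normc a) = (a != 0).
Proof.
rewrite lt_def normc_ge0 andbT; congr (~~ _); apply/eqP/eqP => [|->].
  exact: eq0_normc.
by rewrite normc0.
Qed.

Lemma gtc0P a : 0 < a -> exists2 r : R, 0 < r & a = r%:C.
Proof.
by case: a => x y; rewrite ltcE/= => /andP[/eqP-> x0]; exists x.
Qed.

End ComplexModulus.

Section RealNorm.
Context {R : realType} {V : normedModType R[i]}.
Implicit Types x y z : V.

Lemma rnormE x : (rnorm x)%:C = `|x|.
Proof.
by have := normr_ge0 x; rewrite /rnorm; case: `|x| => a b; rewrite lecE/= => /andP[/eqP->].
Qed.

Lemma rnorm_ge0 x : 0 <= rnorm x.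
Proof. by rewrite -lecR rnormE normr_ge0. Qed.
Hint Resolve rnorm_ge0 : core.

Lemma rnorm0 : rnorm (0 : V) = 0.
Proof. by rewrite /rnorm normr0. Qed.

Lemma rnormN x : rnorm (- x) = rnorm x.
Proof. by rewrite /rnorm normrN. Qed.

Lemma rnormD x y : rnorm (x + y) <= rnorm x + rnorm y.
Proof. by rewrite -lecR rmorphD/= !rnormE ler_normD. Qed.

Lemma rnormB x y : rnorm (x - y) <= rnorm x + rnorm y.
Proof. by rewrite -(rnormN y) rnormD. Qed.

Lemma rdistC x y : rnorm (x - y) = rnorm (y - x).
Proof. by rewrite -rnormN opprB. Qed.

Lemma rdistD z x y : rnorm (x - y) <= rnorm (x - z) + rnorm (z - y).
Proof. by rewrite (_ : x - y = (x - z) + (z - y)) ?rnormD// addrA subrK. Qed.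

Lemma rnormZ (a : R[i]) x : rnorm (a *: x) = normc a * rnorm x.
Proof. by apply: complexI; rewrite rmorphM/= !rnormE normrZ normcE'. Qed.

Lemma rnorm_eq0 x : rnorm x = 0 -> x = 0.
Proof. by move=> h; apply/eqP; rewrite -normr_eq0 -rnormE h. Qed.

Lemma rnorm_eq0E x : (rnorm x == 0) = (x == 0).
Proof. by apply/eqP/eqP => [/rnorm_eq0//|->]; rewrite rnorm0. Qed.

Lemma rdist_dist x y : `|rnorm x - rnorm y| <= rnorm (x - y).
Proof.
rewrite ler_norml; apply/andP; split.
  by rewrite lerNl opprB lerBlDr rdistC -{1}(subrK x y) rnormD.
by rewrite lerBlDr -{1}(subrK y x) rnormD.
Qed.

Lemma rnorm_sum (I : Type) (r : seq I) (P : pred I) (F : I -> V) :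
  rnorm (\sum_(i <- r | P i) F i) <= \sum_(i <- r | P i) rnorm (F i).
Proof.
elim/big_rec2: _ => [|i a b _ h]; first by rewrite rnorm0.
by rewrite (le_trans (rnormD _ _))// lerD2l.
Qed.

(** Norms take values in R[i]; this moves convergence to the real [rnorm], where order arguments
    apply. *)
Lemma rcvgP (I : Type) (F : set_system I) (FF : Filter F) (f : I -> V) (l : V) :
  f x @[x --> F] --> l <-> rnorm (f x - l) @[x --> F] --> (0 : R).
Proof.
split=> [/cvgrPdist_lt h|/cvgrPdist_lt h]; apply/cvgrPdist_lt => e e0.
  have e0' : 0 < e%:C by rewrite ltcR.
  have := h _ e0'; apply: filterS => x; rewrite sub0r normrN.
  by rewrite ger0_norm// -rnormE ltcR rdistC.
have [r e1 e2] := gtc0P e0.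
have := h _ e1; apply: filterS => x; rewrite sub0r normrN.
by rewrite ger0_norm// rdistC e2 -rnormE ltcR.
Qed.

Lemma rcvg_norm (I : Type) (F : set_system I) (FF : Filter F) (f : I -> V) (l : V) :
  f x @[x --> F] --> l -> rnorm (f x) @[x --> F] --> rnorm l.
Proof.
move=> /rcvgP/cvgrPdist_lt h; apply/cvgrPdist_lt => e e0.
have := h _ e0; apply: filterS => x; rewrite sub0r normrN ger0_norm// => h'.
by apply: le_lt_trans h'; rewrite (le_trans (rdist_dist _ _))// rdistC.
Qed.

Lemma rcvg_seqP (f : nat -> V) (l : V) :
  f @ \oo --> l <->
  forall e, 0 < e -> exists N, forall n, (N <= n)%N -> rnorm (f n - l) <= e.
Proof.
split.
  move=> /rcvgP/cvgrPdist_le h e /h[N _ hN]; exists N => n /hN/=.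
  by rewrite sub0r normrN ger0_norm.
move=> h; apply/rcvgP/cvgrPdist_le => e /h[N hN]; exists N => // n /hN/=.
by rewrite sub0r normrN ger0_norm.
Qed.

Lemma rdenseP (D : set V) : dense D ->
  forall x e, 0 < e -> exists2 y, D y & rnorm (x - y) < e.
Proof.
move=> Dd x e e0; have e0' : 0 < e%:C by rewrite ltcR.
have o : open (ball x e%:C) by exact: ball_open.
have [|y [xy Dy]] := Dd _ _ o.
  by exists x; exact: ballxx.
by exists y => //; move: xy; rewrite -ball_normE/= -rnormE ltcR.
Qed.

Lemma separable_seq : separable V ->
  exists d : nat -> V, forall x e, 0 < e -> exists n, rnorm (x - d n) < e.
Proof.
case=> D /countable_injP[f finj] dD.
pose g n := xget 0 [set x | D x /\ f x = n].
have hf x : D x -> exists n, g n = x.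
  move=> Dx; exists (f x); rewrite /g; case: xgetP => [y _ [Dy fyx]|/(_ x)[]//].
  by apply: finj; rewrite ?inE.
exists g => x e e0.
by have [y /hf[n <-] h] := rdenseP dD x e0; exists n.
Qed.

End RealNorm.
#[global] Hint Resolve rnorm_ge0 : core.

Lemma rcomplete (R : realType) (V : completeNormedModType R[i]) (u : nat -> V) :
  (forall e, 0 < e -> exists N, forall m n, (N <= m)%N -> (N <= n)%N ->
     rnorm (u m - u n) <= e) ->
  exists l : V, u @ \oo --> l.
Proof.
move=> h; suff : cvg (u @ \oo) by move=> /cvg_ex.
apply/cauchy_cvgP/cauchy_ballP => e e0.
have [r e1 e2] := gtc0P e0.
have [|N hN] := h (r / 2); first by rewrite divr_gt0.
exists (u @` [set n | (N <= n)%N], u @` [set n | (N <= n)%N]) => /=.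
  by split; exists N => // n /= hn; exists n.
move=> [x y]/= [[m hm <-] [n hn <-]].
rewrite -ball_normE/= e2 -rnormE ltcR (le_lt_trans (hN _ _ hm hn))//.
by rewrite ltr_pdivrMr// ltr_pMr// ltr1n.
Qed.

Section BoundedLinear.
Context {R : realType} {V W : normedModType R[i]}.

Definition bounded_by (M : R) (f : V -> W) := forall x, rnorm (f x) <= M * rnorm x.

Lemma linear_continuous_bounded (f : V -> W) : linear f -> continuous f ->
  exists2 M : R, 0 <= M & bounded_by M f.
Proof.
move=> fl fc; have f0 : f 0 = 0.
  by have /eqP := fl 1 0 0; rewrite !scale1r addr0 -{1}(addr0 (f 0)) (inj_eq (addrI _)) => /eqP <-.
have fZ a x : f (a *: x) = a *: f x by have := fl a x 0; rewrite f0 !addr0.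
have : f x @[x --> (0 : V)] --> f 0 by exact: fc.
move=> /rcvgP/cvgrPdist_le/(_ 1 ltr01)/nbhs_ballP[e e0 he].
have [d e1 e2] := gtc0P e0.
exists (2 / d) => [|x]; first by rewrite divr_ge0// ltW.
have [->|x0] := eqVneq x 0; first by rewrite f0 !rnorm0 mulr0.
have nx0 : 0 < rnorm x by rewrite lt_def rnorm_ge0 rnorm_eq0E x0.
pose c := d / 2 / rnorm x.
have c0 : 0 < c by rewrite !divr_gt0.
have /he/= : ball (0 : V) e (c%:C *: x).
  rewrite -ball_normE/= sub0r normrN -rnormE e2 ltcR rnormZ normc_real gtr0_norm//.
  by rewrite /c divfK ?gt_eqF// ltr_pdivrMr// ltr_pMr// ltr1n.
rewrite f0 !subr0 sub0r normrN ger0_norm ?rnorm_ge0// fZ rnormZ normc_real gtr0_norm// /c.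
rewrite -ler_pdivlMl ?divr_gt0// mulr1 !invfM !invrK => h.
by rewrite [2 / d]mulrC.
Qed.

Lemma bounded_linear_continuous (M : R) (f : V -> W) :
  linear f -> bounded_by M f -> continuous f.
Proof.
move=> fl fM x.
have fB y z : f (y - z) = f y - f z.
  by rewrite addrC -scaleN1r fl scaleN1r addrC.
have h : rnorm (y - x) @[y --> x] --> (0 : R) by apply/rcvgP; exact: cvg_id.
have h2 : M * rnorm (y - x) @[y --> x] --> (0 : R).
  by rewrite -(mulr0 M); apply: cvgM => //; exact: cvg_cst.
apply/rcvgP; apply: (squeeze_cvgr _ (cvg_cst _) h2).
by apply: nearW => y; rewrite rnorm_ge0/= -fB fM.
Qed.

Lemma rcvg_linear (M : R) (f : V -> W) (I : Type) (F : set_system I)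
    (FF : Filter F) (g : I -> V) (l : V) :
  linear f -> bounded_by M f -> g x @[x --> F] --> l -> f (g x) @[x --> F] --> f l.
Proof.
move=> fl fM gl; have /continuous_cvg := @bounded_linear_continuous _ _ fl fM l.
by apply.
Qed.

End BoundedLinear.

Section Dot.
Context {R : realType} {H : hilbertType R}.
Implicit Types x y z : H.

Lemma dotDl x y z : dot (x + y) z = dot x z + dot y z.
Proof. exact: linearDl. Qed.

Lemma dotZl a x y : dot (a *: x) y = a * dot x y.
Proof. exact: linearZl_LR. Qed.

Lemma dotC x y : dot x y = conjc (dot y x).
Proof. by rewrite hermC/= expr0 mul1r. Qed.

Lemma dotDr x y z : dot x (y + z) = dot x y + dot x z.
Proof. by rewrite dotC dotDl rmorphD/= -!dotC. Qed.

Lemma dotZr a x y : dot x (a *: y) = conjc a * dot x y.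
Proof. by rewrite dotC dotZl rmorphM/= -dotC. Qed.

Lemma dot_rnorm x : dot x x = (rnorm x ^+ 2)%:C.
Proof. by rewrite dotxx rmorphXn/= rnormE. Qed.

Lemma dot_CS x y : normc (dot x y) <= rnorm x * rnorm y.
Proof.
have [->|y0] := eqVneq y 0.
  by rewrite dotC -(scale0r 0) dotZl mul0r conjc0 normc0 mulr_ge0// rnorm_ge0.
have ny0 : 0 < rnorm y by rewrite lt_def rnorm_ge0 rnorm_eq0E y0.
pose n2 := rnorm y ^+ 2; have n20 : 0 < n2 by rewrite exprn_gt0.
pose c := dot x y / n2%:C.
have := sqr_ge0 (rnorm (x - c *: y)).
have -> : rnorm (x - c *: y) ^+ 2 = rnorm x ^+ 2 - normc (dot x y) ^+ 2 / n2.
  apply: complexI; rewrite -dot_rnorm dotDl -scaleNr dotZl !dotDr !dotZr !dot_rnorm -/n2.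
  rewrite (dotC y x) (rmorphB (real_complex R))/= fmorph_div/=.
  have -> : (normc (dot x y) ^+ 2)%:C = `|dot x y| ^+ 2 by rewrite normcE' rmorphXn.
  rewrite sqr_normc_conj /c !rmorphN/=.
  rewrite conjc_divr.
  by field; rewrite (inj_eq (@complexI R)) gt_eqF.
rewrite subr_ge0 ler_pdivrMr// /n2 -exprMn.
by rewrite ler_pXn2r// nnegrE ?normc_ge0// mulr_ge0 ?rnorm_ge0.
Qed.

Definition rdot x y : R := complex.Re (dot x y).

Lemma rdot_CS x y : `|rdot x y| <= rnorm x * rnorm y.
Proof. by rewrite (le_trans _ (dot_CS x y))// normc_Re. Qed.

(** Reduces imaginary parts to real parts, so that measurability and integrability are proved for
    [rdot] and then transported. *)
Lemma Im_dot x y : complex.Im (dot x y) = rdot x ('i *: y).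
Proof. by rewrite /rdot dotZr; case: (dot x y) => a b /=; simpc; ring. Qed.

Lemma rdotDl x y z : rdot (x + y) z = rdot x z + rdot y z.
Proof. by rewrite /rdot dotDl; case: (dot x z) (dot y z) => ? ? []. Qed.

Lemma rdotDr x y z : rdot x (y + z) = rdot x y + rdot x z.
Proof. by rewrite /rdot dotDr; case: (dot x y) (dot x z) => ? ? []. Qed.

Lemma rdotZl (a : R) x y : rdot (a%:C *: x) y = a * rdot x y.
Proof. by rewrite /rdot dotZl; case: (dot x y) => b c /=; rewrite mul0r subr0. Qed.

Lemma rdotZr (a : R) x y : rdot x (a%:C *: y) = a * rdot x y.
Proof. by rewrite /rdot dotZr; case: (dot x y) => b c /=; ring. Qed.

Lemma rdotNl x y : rdot (- x) y = - rdot x y.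
Proof. by rewrite -scaleN1r -(rmorphN1 (real_complex R)) rdotZl mulN1r. Qed.

Lemma rdotNr x y : rdot x (- y) = - rdot x y.
Proof. by rewrite -scaleN1r -(rmorphN1 (real_complex R)) rdotZr mulN1r. Qed.

Lemma rdotC x y : rdot x y = rdot y x.
Proof. by rewrite /rdot dotC; case: (dot y x). Qed.

Lemma rdotxx x : rdot x x = rnorm x ^+ 2.
Proof. by rewrite /rdot dot_rnorm. Qed.

Lemma rnorm_sqrD x y :
  rnorm (x + y) ^+ 2 = rnorm x ^+ 2 + rnorm y ^+ 2 + 2 * rdot x y.
Proof. by rewrite -!rdotxx rdotDl !rdotDr (rdotC y x); ring. Qed.

(** Serves to read off the measurability of an inner product from that of two norms. *)
Lemma rdot_polar x y : rdot x y = (rnorm (x + y) ^+ 2 - rnorm (x - y) ^+ 2) / 4.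
Proof. by rewrite !rnorm_sqrD rnormN rdotNr; field. Qed.

Lemma rnorm_sqr_le x y : rnorm (x + y) ^+ 2 <= 2 * rnorm x ^+ 2 + 2 * rnorm y ^+ 2.
Proof.
have := sqr_ge0 (rnorm (x - y)); rewrite !rnorm_sqrD rnormN rdotNr.
by move=> h; nra.
Qed.

End Dot.

(** * Strong measurability *)

Section Simple.
Context {R : realType} {V : normedModType R[i]}.
Implicit Types (T : R) (f : R -> V) (s : seq (set R * V)) (A : set R) (v : V).

Lemma simple_eval_nil t : simple_eval ([::] : seq (set R * V)) t = 0.
Proof. by rewrite /simple_eval big_nil. Qed.

Lemma simple_eval_cons A v s t :
  simple_eval ((A, v) :: s) t = if t \in A then v + simple_eval s t else simple_eval s t.
Proof.
rewrite /simple_eval big_cons/= indicE; case: (t \in A) => /=.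
  by rewrite scale1r.
by rewrite scale0r add0r.
Qed.

Lemma simple_eval_cat s s' t :
  simple_eval (s ++ s') t = simple_eval s t + simple_eval s' t.
Proof. by rewrite /simple_eval big_cat. Qed.

Lemma simple_measurable_cons A v s :
  simple_measurable ((A, v) :: s) <-> measurable A /\ simple_measurable s.
Proof.
split=> [h|[mA ms] p]; last by rewrite inE => /predU1P[->//|/ms].
by split=> [|p ps]; [exact: (h (A, v) (mem_head _ _))|apply: h; rewrite inE ps orbT].
Qed.

Lemma simple_measurable_cat s s' :
  simple_measurable s -> simple_measurable s' -> simple_measurable (s ++ s').
Proof. by move=> ms ms' p; rewrite mem_cat => /orP[/ms|/ms']. Qed.

Lemma simple_integral_cat T s s' :
  simple_integral T (s ++ s') = simple_integral T s + simple_integral T s'.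
Proof. by rewrite /simple_integral big_cat. Qed.

End Simple.

Section SimpleMap.
Context {R : realType} {V W : normedModType R[i]}.
Implicit Types (T : R) (s : seq (set R * V)).

Lemma linear_at0 (K : V -> W) : linear K -> K 0 = 0.
Proof.
by move=> Kl; have /eqP := Kl 1 0 0;
  rewrite !scale1r addr0 -{1}(addr0 (K 0)) (inj_eq (addrI _)) => /eqP <-.
Qed.

Lemma simple_eval_map (K : V -> W) s t : linear K ->
  simple_eval [seq (p.1, K p.2) | p <- s] t = K (simple_eval s t).
Proof.
move=> Kl; have K0 := linear_at0 Kl.
elim: s => [|[A v] s ih]; first by rewrite /= !simple_eval_nil K0.
rewrite /= !simple_eval_cons ih; case: ifP => // _.
by have := Kl 1 v (simple_eval s t); rewrite !scale1r.
Qed.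

Lemma simple_measurable_map (K : V -> W) s :
  simple_measurable s -> simple_measurable [seq (p.1, K p.2) | p <- s].
Proof. by move=> ms p /mapP[q qs ->]; exact: ms. Qed.

Lemma simple_integral_map (K : V -> W) T s : linear K ->
  simple_integral T [seq (p.1, K p.2) | p <- s] = K (simple_integral T s).
Proof.
move=> Kl; have K0 := linear_at0 Kl.
rewrite /simple_integral; elim: s => [|p s ih]; first by rewrite !big_nil.
by rewrite /= !big_cons ih Kl.
Qed.

End SimpleMap.

Section Measurability.
Context {R : realType}.
Implicit Types T : R.

(** Continuity relative to [0, T], since semigroup orbits are controlled for non-negative times
    only. *)
Definition continuous_on {V : normedModType R[i]} T (f : R -> V) :=
  forall t, 0 <= t <= T -> forall e, 0 < e -> exists2 d : R, 0 < d &
    forall s, 0 <= s <= T -> `|s - t| < d -> rnorm (f s - f t) <= e.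

Lemma continuous_onD {V : normedModType R[i]} T (f g : R -> V) :
  continuous_on T f -> continuous_on T g -> continuous_on T (fun t => f t + g t).
Proof.
move=> cf cg t tT e e0; have e20 : 0 < e / 2 by rewrite divr_gt0.
have [d d0 hd] := cf _ tT _ e20; have [d' d'0 hd'] := cg _ tT _ e20.
exists (Num.min d d') => [|s sT]; first by rewrite lt_min d0.
rewrite lt_min => /andP[h1 h2]; rewrite opprD addrACA (splitr e).
by rewrite (le_trans (rnormD _ _))// lerD ?hd ?hd'.
Qed.

Lemma continuous_on_measurable {V : normedModType R[i]} T (f : R -> V) :
  continuous_on T f -> measurable_fun `[0, T] (fun t => rnorm (f t)).
Proof.
move=> cf; apply: subspace_continuous_measurable_fun => //.
apply/subspace_continuousP => t tT; apply/cvgrPdist_le => e e0.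
have tT' : 0 <= t <= T by move: tT; rewrite /= in_itv.
have [d d0 hd] := cf _ tT' _ e0.
exists d => //= s; rewrite /ball/= => st sT; rewrite distrC.
rewrite (le_trans (rdist_dist _ _))// hd//; last by rewrite distrC.
Qed.

Lemma continuous_on_cst {V : normedModType R[i]} T (v : V) : continuous_on T (fun=> v).
Proof. by move=> t _ e e0; exists 1 => // s _ _; rewrite subrr rnorm0 ltW. Qed.

(** Common form of the two pointwise actions used later: scalar weights, and the kernel
    [Sm1 (T - t)] after [B] of the input map. *)
Definition op_family {U V : normedModType R[i]} T (F : R -> U -> V) :=
  (forall t, 0 <= t <= T -> linear (F t) /\ exists M, bounded_by M (F t)) /\
  forall v, continuous_on T (F ^~ v).

(** The offset [f] makes the induction work: on the first set of the list the value [F t v] is moved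
    into it, and off that set nothing changes. *)
Lemma measurable_family_simple {U V : normedModType R[i]} T (F : R -> U -> V) s f :
  op_family T F -> simple_measurable s -> continuous_on T f ->
  measurable_fun `[0, T] (fun t => rnorm (f t + F t (simple_eval s t))).
Proof.
move=> [Fl Fc]; elim: s f => [|[A v] s ih] f.
  move=> _ cf; under [X in measurable_fun _ X]eq_fun do rewrite simple_eval_nil.
  by apply: continuous_on_measurable; apply: continuous_onD.
move=> /simple_measurable_cons[mA ms] cf.
apply: (eq_measurable_fun (fun t => if t \in A
    then rnorm ((f t + F t v) + F t (simple_eval s t))
    else rnorm (f t + F t (simple_eval s t)))).
  move=> t /[!inE]/= tT; rewrite simple_eval_cons; case: ifP => // _.
  have [|Ftl _] := Fl t; first by move: tT; rewrite in_itv.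
  by have := Ftl 1 v (simple_eval s t); rewrite !scale1r => ->; rewrite addrA.
apply: measurable_fun_if => //.
- by apply: (measurable_fun_bool true); rewrite preimage_mem_true; exact: measurableI.
- apply: (measurable_funS (E := `[0, T])) => //; last by apply: ih => //; exact: continuous_onD.
- by apply: (measurable_funS (E := `[0, T])) => //; exact: ih.
Qed.

Lemma simple_measurable_norm {V : normedModType R[i]} T (s : seq (set R * V)) :
  simple_measurable s -> measurable_fun `[0, T] (fun t => rnorm (simple_eval s t)).
Proof.
move=> ms; under [X in measurable_fun _ X]eq_fun do rewrite -[simple_eval _ _]add0r.
apply: (@measurable_family_simple V V T (fun=> id)) => //.
  split=> [t _|v]; last exact: continuous_on_cst.
  by split=> //; exists 1 => x; rewrite mul1r.
exact: continuous_on_cst.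
Qed.

Lemma strongly_measurable_family {U V : normedModType R[i]} T (F : R -> U -> V) f v :
  op_family T F -> strongly_measurable T f ->
  measurable_fun `[0, T] (fun t => rnorm (F t (f t) - v)).
Proof.
move=> FT [s [ms sf]].
apply: (@measurable_fun_cvg _ _ _ _ (fun n t => rnorm (- v + F t (simple_eval (s n) t)))).
  by move=> n; apply: measurable_family_simple => //; exact: continuous_on_cst.
move=> t tT; apply: rcvg_norm; rewrite addrC; apply: cvgD; first exact: cvg_cst.
have [|Fl [M FM]] := FT.1 t; first by move: tT; rewrite /= in_itv.
apply: (@rcvg_linear _ _ _ M (F t) nat \oo _ (fun n => simple_eval (s n) t) (f t)) => //.
exact: sf.
Qed.

(** * Nearest-point approximation by simple functions *)

Section NearestPoint.
Context {V : normedModType R[i]}.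
Variables (T : R) (f : R -> V) (d : nat -> V).

Let closer n s := [set t | t \in `[0, T] /\
  rnorm (f t - d n) < rnorm (f t - simple_eval s t)].

(** Each step switches to the value [d n] exactly where it is strictly closer to [f t] than the
    present value. The distance is thus a running minimum, and the start with the empty list, that
    is the value 0, keeps it below [rnorm (f t)]. *)
Fixpoint nearest n : seq (set R * V) :=
  if n is n.+1 then let A := closer n (nearest n) in
    (A, d n) :: [seq (p.1 `\` A, p.2) | p <- nearest n]
  else [::].

Lemma nearestS n t : t \in `[0, T] -> rnorm (f t - simple_eval (nearest n.+1) t) =
  Num.min (rnorm (f t - d n)) (rnorm (f t - simple_eval (nearest n) t)).
Proof.
move=> tT; rewrite /=; set A := closer _ _; set s := nearest n.
have -> : simple_eval ((A, d n) :: [seq (p.1 `\` A, p.2) | p <- s]) t =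
    if t \in A then d n else simple_eval s t.
  rewrite simple_eval_cons.
  have -> : simple_eval [seq (p.1 `\` A, p.2) | p <- s] t =
      if t \in A then 0 else simple_eval s t.
    elim: s => [|[B v] s ih]; first by rewrite simple_eval_nil if_same.
    rewrite /= !simple_eval_cons ih in_setD.
    by case: (t \in A); rewrite ?andbF ?andbT.
  by case: (t \in A); rewrite ?addr0.
rewrite minEle; case: ifPn => [/set_mem[_ h]|tA]; first by rewrite ltW.
case: ifPn => // h; apply/eqP; rewrite eq_le h andbT leNgt; apply/negP => h'.
by move/negP: tA; apply; rewrite inE.
Qed.

Hypothesis mf : forall v, measurable_fun `[0, T] (fun t => rnorm (f t - v)).

Lemma measurable_nearest_dist n :
  measurable_fun `[0, T] (fun t => rnorm (f t - simple_eval (nearest n) t)).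
Proof.
elim: n => [|n ih]; first by under [X in measurable_fun _ X]eq_fun do rewrite simple_eval_nil; exact: mf.
apply: (eq_measurable_fun (fun t => Num.min (rnorm (f t - d n))
    (rnorm (f t - simple_eval (nearest n) t)))).
  by move=> t /[!inE] tT; rewrite nearestS.
exact: measurable_minr.
Qed.

Lemma measurable_nearest n : simple_measurable (nearest n).
Proof.
elim: n => [//|n ih].
have mA : measurable (closer n (nearest n)).
  have := measurable_fun_ltr (mf (d n)) (measurable_nearest_dist n).
  move=> /(_ (measurable_itv _) [set true]); rewrite /closer.
  set X := _ `&` _ ; have -> : X = [set t | t \in `[0, T] /\ rnorm (f t - d n) <
    rnorm (f t - simple_eval (nearest n) t)] by [].
  exact.
apply/simple_measurable_cons; split => // p /mapP[q qs ->] /=.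
by apply: measurableD => //; exact: ih.
Qed.

Lemma nearest_le n t : t \in `[0, T] -> rnorm (f t - simple_eval (nearest n) t) <= rnorm (f t).
Proof.
move=> tT; elim: n => [|n ih]; first by rewrite simple_eval_nil subr0.
by rewrite nearestS// ge_min ih orbT.
Qed.

Hypothesis dd : forall x e, 0 < e -> exists n, rnorm (x - d n) < e.

Lemma nearest_cvg t : t \in `[0, T] -> simple_eval (nearest n) t @[n --> \oo] --> f t.
Proof.
move=> tT; apply/rcvg_seqP => e e0.
have [n hn] := dd (f t) e0; exists n.+1 => m; rewrite rdistC.
elim: m => // m ih; rewrite ltnS nearestS// => nm.
rewrite ge_min; apply/orP; have [->|mn] := eqVneq m n; first by left; exact: ltW.
by right; apply: ih; rewrite ltn_neqAle eq_sym mn.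
Qed.

End NearestPoint.

(** The bound by [rnorm (f t)] is what later allows dominated convergence, hence the existence of
    Bochner integrals. *)
Lemma dominated_simple_approximation {V : normedModType R[i]} T (f : R -> V) : separable V ->
  (forall v, measurable_fun `[0, T] (fun t => rnorm (f t - v))) ->
  exists2 s, simple_approximation T f s &
    forall n t, t \in `[0, T] -> rnorm (f t - simple_eval (s n) t) <= rnorm (f t).
Proof.
move=> /separable_seq[d dd] mf; exists (nearest T f d); last by move=> n t; exact: nearest_le.
by split=> [n|t tT]; [exact: measurable_nearest|exact: nearest_cvg].
Qed.

Lemma strongly_measurable_dist {V : normedModType R[i]} T (f : R -> V) v :
  strongly_measurable T f -> measurable_fun `[0, T] (fun t => rnorm (f t - v)).
Proof.
move=> mf; apply: (@strongly_measurable_family V V T (fun=> id)) => //.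
split=> [t _|w]; last exact: continuous_on_cst.
by split=> //; exists 1 => x; rewrite mul1r.
Qed.

(** A criterion in the spirit of Pettis: strong measurability becomes a family of real conditions,
    stable under pointwise limits and under operator families. *)
Lemma strongly_measurableP {V : normedModType R[i]} T (f : R -> V) : separable V ->
  strongly_measurable T f <->
  forall v, measurable_fun `[0, T] (fun t => rnorm (f t - v)).
Proof.
move=> sV; split=> [mf v|mf]; first exact: strongly_measurable_dist.
by have [s sa _] := dominated_simple_approximation sV mf; exists s.
Qed.

Lemma strongly_measurable_norm {V : normedModType R[i]} T (f : R -> V) :
  strongly_measurable T f -> measurable_fun `[0, T] (fun t => rnorm (f t)).
Proof.
by move=> /strongly_measurable_dist-/(_ 0); under [X in measurable_fun _ X]eq_fun do rewrite subr0.
Qed.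

Lemma strongly_measurable_op {U V : normedModType R[i]} T (F : R -> U -> V) f :
  separable V -> op_family T F -> strongly_measurable T f ->
  strongly_measurable T (fun t => F t (f t)).
Proof.
by move=> sV FT mf; apply/strongly_measurableP => // v; exact: strongly_measurable_family.
Qed.

Lemma strongly_measurable_lim {V : normedModType R[i]} T (g : nat -> R -> V) f :
  separable V -> (forall n, strongly_measurable T (g n)) ->
  (forall t, t \in `[0, T] -> g n t @[n --> \oo] --> f t) ->
  strongly_measurable T f.
Proof.
move=> sV mg gf; apply/strongly_measurableP => // v.
apply: (@measurable_fun_cvg _ _ _ _ (fun n t => rnorm (g n t - v))).
  by move=> n; exact: strongly_measurable_dist.
move=> t tT; apply: rcvg_norm; apply: cvgD; last exact: cvg_cst.
exact: gf.
Qed.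

Lemma strongly_measurable_lin {V : normedModType R[i]} T (a : R[i]) (f g : R -> V) :
  strongly_measurable T f -> strongly_measurable T g ->
  strongly_measurable T (fun t => a *: f t + g t).
Proof.
move=> [s [ms sf]] [s' [ms' sg]].
have al : linear (fun v : V => a *: v).
  by move=> b x y; rewrite scalerDr !scalerA mulrC.
exists (fun n => [seq (p.1, a *: p.2) | p <- s n] ++ s' n); split=> [n|t tT].
  by apply: simple_measurable_cat => //; exact: simple_measurable_map.
under eq_fun do rewrite simple_eval_cat (simple_eval_map _ _ al).
by apply: cvgD; [apply: cvgZr; exact: sf|exact: sg].
Qed.

Lemma strongly_measurable_cst {V : normedModType R[i]} T (v : V) :
  strongly_measurable T (fun=> v).
Proof.
exists (fun=> [:: (setT, v)]); split=> [_ p|t _].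
  by rewrite inE => /eqP->; exact: measurableT.
under eq_fun do rewrite simple_eval_cons simple_eval_nil in_setT addr0.
exact: cvg_cst.
Qed.

Lemma continuous_on_strongly_measurable {V : normedModType R[i]} T (f : R -> V) :
  separable V -> continuous_on T f -> strongly_measurable T f.
Proof.
move=> sV cf; apply/strongly_measurableP => // v.
by apply: continuous_on_measurable; apply: continuous_onD => //; exact: continuous_on_cst.
Qed.

End Measurability.

(** * The Bochner integral *)

Section NonnegIntegral.
Context {R : realType}.
Variable T : R.
Local Notation mu := (@lebesgue_measure R).
Local Notation nint g := (\int[mu]_(t in `[0%R, T]) (g t)%:E)%E.
Implicit Types g h : R -> R.

Lemma nint_ge0 g : (forall t, t \in `[0, T] -> 0 <= g t) -> (0 <= nint g)%E.
Proof. by move=> g0; apply: integral_ge0 => t tT; rewrite lee_fin g0. Qed.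

Lemma nint_le g h : measurable_fun `[0, T] g -> measurable_fun `[0, T] h ->
  (forall t, t \in `[0, T] -> 0 <= g t <= h t) -> (nint g <= nint h)%E.
Proof.
move=> mg mh gh; apply: ge0_le_integral => //.
- by move=> t /gh/andP[? _]; rewrite lee_fin.
- exact/measurable_EFinP.
- exact/measurable_EFinP.
- by move=> t /gh/andP[? ?]; rewrite lee_fin.
Qed.

Lemma nintD g h : measurable_fun `[0, T] g -> measurable_fun `[0, T] h ->
  (forall t, t \in `[0, T] -> 0 <= g t) -> (forall t, t \in `[0, T] -> 0 <= h t) ->
  (nint (fun t => g t + h t)%R = nint g + nint h)%E.
Proof.
move=> mg mh g0 h0; under eq_integral do rewrite EFinD.
by rewrite ge0_integralD//; [exact/measurable_EFinP|exact/measurable_EFinP].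
Qed.

Lemma nintZ (c : R) g : measurable_fun `[0, T] g ->
  (forall t, t \in `[0, T] -> 0 <= g t) -> 0 <= c ->
  (nint (fun t => c * g t)%R = c%:E * nint g)%E.
Proof.
move=> mg g0 c0; under eq_integral do rewrite EFinM.
by rewrite ge0_integralZl//; exact/measurable_EFinP.
Qed.

Lemma nint_cst (c : R) : 0 <= T -> nint (fun=> c) = (c * T)%:E.
Proof.
move=> T0; have e : mu `[0%R, T] = T%:E.
  rewrite lebesgue_measure_itv/= lte_fin; move: T0; rewrite le_eqVlt.
  by move=> /predU1P[<-|->]; rewrite ?ltxx// oppr0 adde0.
transitivity (c%:E * mu `[0%R, T])%E; first exact: integral_cst.
by rewrite e.
Qed.

End NonnegIntegral.

Section Bochner.
Context {R : realType} {V : normedModType R[i]}.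
Local Notation mu := (@lebesgue_measure R).
Local Notation nint T g := (\int[mu]_(t in `[0%R, T]) (g t)%:E)%E.
Implicit Types (T : R) (f g : R -> V) (s : seq (set R * V)).

Lemma finite_on_itv T (E : set R) : measurable E -> E `<=` `[0, T] -> mu E \is a fin_num.
Proof.
move=> mE ET; rewrite ge0_fin_numE//.
have /le_lt_trans : (mu E <= mu `[0%R, T])%E by apply: le_measure; rewrite ?inE.
apply; rewrite lebesgue_measure_itv/=; case: ifP => // _.
by rewrite -EFinB ltry.
Qed.

(* The set E is split along the first set of the list. *)
Lemma simple_integral_bound_on T s (E : set R) v :
  simple_measurable s -> measurable E -> E `<=` `[0, T] ->
  ((rnorm ((fine (mu E))%:C *: v + \sum_(p <- s) (fine (mu (p.1 `&` E)))%:C *: p.2))%:E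
    <= \int[mu]_(t in E) (rnorm (v + simple_eval s t))%:E)%E.
Proof.
elim: s E v => [|[A w] s ih] E v.
  move=> _ mE ET; rewrite big_nil addr0.
  under eq_integral do rewrite simple_eval_nil addr0.
  rewrite (integral_cst mu mE (rnorm v)%:E) rnormZ normc_real ger0_norm ?fine_ge0//.
  by rewrite mulrC EFinM fineK// (finite_on_itv (T := T)).
move=> /simple_measurable_cons[mA ms] mE ET; rewrite big_cons/=.
have muET (B : set R) : B `<=` E -> measurable B -> mu B \is a fin_num.
  by move=> BE mB; apply: (finite_on_itv (T := T)) => //; exact: subset_trans BE ET.
have mEA : measurable (A `&` E) by exact: measurableI.
have mED : measurable (E `\` A) by exact: measurableD.
have EU : E = (A `&` E) `|` (E `\` A).
  by rewrite setDE setIC -setIUr setUv setIT.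
have EI : [disjoint A `&` E & E `\` A].
  by apply/disj_setPS => x /= [[Ax _] [_]].
have fineU (B : set R) : measurable B ->
    fine (mu (B `&` E)) = fine (mu (B `&` (A `&` E))) + fine (mu (B `&` (E `\` A))).
  move=> mB; rewrite -fineD; last 2 first.
  - by apply: muET; [move=> x [_ []]|exact: measurableI].
  - by apply: muET; [move=> x [_ []]|exact: measurableI].
  rewrite -measureU; last 3 first.
  - exact: measurableI.
  - exact: measurableI.
  - by apply/seteqP; split=> // x [[_ [Ax _]] [_ [_]]].
  by rewrite -setIUr -EU.
have -> : (fine (mu E))%:C *: v + ((fine (mu (A `&` E)))%:C *: w +
     \sum_(p <- s) (fine (mu (p.1 `&` E)))%:C *: p.2) =
   ((fine (mu (A `&` E)))%:C *: (v + w) +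
     \sum_(p <- s) (fine (mu (p.1 `&` (A `&` E))))%:C *: p.2) +
   ((fine (mu (E `\` A)))%:C *: v +
     \sum_(p <- s) (fine (mu (p.1 `&` (E `\` A))))%:C *: p.2).
  have -> : \sum_(p <- s) (fine (mu (p.1 `&` E)))%:C *: p.2 =
     \sum_(p <- s) (fine (mu (p.1 `&` (A `&` E))))%:C *: p.2 +
     \sum_(p <- s) (fine (mu (p.1 `&` (E `\` A))))%:C *: p.2.
    rewrite -big_split/= big_seq_cond [RHS]big_seq_cond; apply: eq_bigr => p.
    by rewrite andbT => /ms mp; rewrite fineU// rmorphD/= scalerDl.
  have := fineU setT measurableT; rewrite !setTI => ->.
  by rewrite rmorphD/= scalerDl scalerDr [LHS](AC (2*(1*2)) ((1*3*4)*(2*5))).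
have mf : measurable_fun E (fun t => (rnorm (v + simple_eval ((A, w) :: s) t))%:E).
  apply/measurable_EFinP; apply: (measurable_funS _ ET) => //.
  apply: (@measurable_family_simple _ V V T (fun=> id)) => //; last exact: continuous_on_cst.
    split=> [t _|u]; last exact: continuous_on_cst.
    by split=> //; exists 1 => x; rewrite mul1r.
  exact/simple_measurable_cons.
rewrite [in leRHS]EU ge0_integral_setU//; last 2 first.
- by rewrite -EU.
- by move=> x _; rewrite lee_fin rnorm_ge0.
apply: (@le_trans _ _ (_%:E + _%:E)%E); first by rewrite -EFinD lee_fin; exact: rnormD.
apply: leeD.
- apply: (le_trans (ih _ (v + w) _ _ _)) => //; first by move=> x [_ /ET].
  rewrite le_eqVlt; apply/orP; left; apply/eqP; apply: eq_integral => t.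
  by rewrite inE => -[At _]; rewrite simple_eval_cons mem_set// addrA.
- apply: (le_trans (ih _ v _ _ _)) => //; first by move=> x [/ET].
  rewrite le_eqVlt; apply/orP; left; apply/eqP; apply: eq_integral => t.
  by rewrite inE => -[_ At]; rewrite simple_eval_cons memNset.
Qed.

Lemma simple_integral_bound T s : simple_measurable s ->
  ((rnorm (simple_integral T s))%:E <= nint T (fun t => rnorm (simple_eval s t)))%E.
Proof.
move=> ms; have := @simple_integral_bound_on T s `[0, T] 0 ms (measurable_itv _).
rewrite scaler0 add0r; under [X in (_ <= X)%E]eq_integral do rewrite add0r.
exact.
Qed.

Lemma simple_measurable_dist T f s : strongly_measurable T f -> simple_measurable s ->
  measurable_fun `[0, T] (fun t => rnorm (f t - simple_eval s t)).
Proof.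
move=> mf ms.
have m1 : strongly_measurable T (simple_eval s).
  by exists (fun=> s); split=> // t tT; exact: cvg_cst.
have := strongly_measurable_norm (strongly_measurable_lin (-1) m1 mf).
under [X in measurable_fun _ X]eq_fun do rewrite scaleN1r addrC.
exact.
Qed.

Lemma bochner_measurable T f v : is_bochner_integral T f v -> strongly_measurable T f.
Proof. by move=> [s [sa _ _]]; exists s. Qed.

Lemma bochner_approx T f v : is_bochner_integral T f v -> forall e, 0 < e ->
  exists s, [/\ simple_measurable s,
    (nint T (fun t => rnorm (f t - simple_eval s t)) <= e%:E)%E &
    rnorm (simple_integral T s - v) <= e].
Proof.
move=> [s [[ms sf] int0 sv]] e e0.
have /(_ _ e0)[N hN] := (rcvg_seqP _ _).1 sv.
move/fine_cvgP : int0 => [[N1 _ hN1] /cvgrPdist_le/(_ _ e0)[N2 _ hN2]].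
pose n := maxn N (maxn N1 N2); exists (s n); split=> //.
- have f1 := hN1 n (leq_trans (leq_maxl _ _) (leq_maxr _ _)).
  have := hN2 n (leq_trans (leq_maxr _ _) (leq_maxr _ _)).
  rewrite /= sub0r normrN ger0_norm; last by rewrite fine_ge0// nint_ge0// => t _; exact: rnorm_ge0.
  by rewrite -lee_fin fineK.
- exact/hN/leq_maxl.
Qed.

Lemma bochner_norm T f v : is_bochner_integral T f v ->
  ((rnorm v)%:E <= nint T (fun t => rnorm (f t)))%E.
Proof.
move=> fv; have mf := bochner_measurable fv.
apply/lee_addgt0Pr => e e0; have e20 : 0 < e / 2 by rewrite divr_gt0.
have [s [ms h1 h2]] := bochner_approx fv e20.
have h3 := simple_integral_bound T ms.
have h4 : (nint T (fun t => rnorm (simple_eval s t)) <=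
    nint T (fun t => rnorm (f t)) + nint T (fun t => rnorm (f t - simple_eval s t)))%E.
  rewrite -nintD//; last 2 first.
  - exact: strongly_measurable_norm.
  - exact: simple_measurable_dist.
  apply: nint_le.
  - exact: simple_measurable_norm.
  - apply: measurable_funD; first exact: strongly_measurable_norm.
    exact: simple_measurable_dist.
  - move=> t _; rewrite rnorm_ge0/=.
    by rewrite -{1}(subKr (f t) (simple_eval s t)) rnormB.
rewrite (@le_trans _ _ ((rnorm (simple_integral T s))%:E + (e / 2)%:E)%E)//.
  by rewrite -EFinD lee_fin -{1}(subKr (simple_integral T s) v) (le_trans (rnormB _ _))// lerD2l.
rewrite [in leRHS](splitr e) EFinD addeA leeD2r// (le_trans h3)// (le_trans h4)//.
by rewrite leeD2l.
Qed.

Lemma bochner_lin T (a : R[i]) f g v w :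
  is_bochner_integral T f v -> is_bochner_integral T g w ->
  is_bochner_integral T (fun t => a *: f t + g t) (a *: v + w).
Proof.
move=> fv gw; have mf := bochner_measurable fv; have mg := bochner_measurable gw.
move: fv gw => [s [[ms sf] int0 sv]] [s' [[ms' sf'] int0' sv']].
have al (W : normedModType R[i]) : linear (fun v : W => a *: v).
  by move=> b x y; rewrite scalerDr !scalerA mulrC.
have msn n : simple_measurable ([seq (p.1, a *: p.2) | p <- s n] ++ s' n).
  by apply: simple_measurable_cat => //; exact: simple_measurable_map.
exists (fun n => [seq (p.1, a *: p.2) | p <- s n] ++ s' n); split.
- split=> // t tT.
  under eq_fun do rewrite simple_eval_cat (simple_eval_map _ _ (al V)).
  by apply: cvgD; [apply: cvgZr; exact: sf|exact: sf'].
- apply: (@squeeze_cvge _ _ _ _ (fun=> 0%E) _ (fun n => (normc a)%:E *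
      nint T (fun t => rnorm (f t - simple_eval (s n) t)) +
      nint T (fun t => rnorm (g t - simple_eval (s' n) t)))%E).
  + apply: nearW => n; rewrite nint_ge0/=; last by move=> t _; exact: rnorm_ge0.
    rewrite -nintZ ?normc_ge0//; last exact: simple_measurable_dist.
    have m1 : measurable_fun `[0, T] (fun t => normc a * rnorm (f t - simple_eval (s n) t)).
      by apply: measurable_funM => //; exact: simple_measurable_dist.
    have m2 := simple_measurable_dist mg (ms' n).
    rewrite -nintD//; last by move=> t _; rewrite mulr_ge0 ?normc_ge0 ?rnorm_ge0.
    apply: nint_le => //.
    * by apply: simple_measurable_dist => //; exact: strongly_measurable_lin.
    * exact: measurable_funD.
    * move=> t _; rewrite rnorm_ge0/= simple_eval_cat (simple_eval_map _ _ (al V)).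
      by rewrite opprD addrACA -scalerBr (le_trans (rnormD _ _))// rnormZ.
  + exact: cvg_cst.
  + rewrite -[X in _ --> X](@adde0 _ 0%E); apply: cvgeD => //.
    by rewrite -[X in _ --> X](@mule0 _ (normc a)%:E); apply: cvgeMl.
- under eq_fun do rewrite simple_integral_cat (simple_integral_map _ _ (al V)).
  by apply: cvgD => //; exact: cvgZr.
Qed.

Lemma bochner_zero T : is_bochner_integral T (fun=> 0 : V) 0.
Proof.
exists (fun=> [::]); split; first split=> [_ p|t tT]; rewrite ?inE//.
- by under eq_fun do rewrite simple_eval_nil; exact: cvg_cst.
- under eq_fun do under eq_integral do rewrite simple_eval_nil subr0 rnorm0.
  by under eq_fun do rewrite integral0; exact: cvg_cst.
- by rewrite /simple_integral; under eq_fun do rewrite big_nil; exact: cvg_cst.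
Qed.

Lemma bochnerZ T (a : R[i]) f v :
  is_bochner_integral T f v -> is_bochner_integral T (fun t => a *: f t) (a *: v).
Proof.
move=> fv; have := bochner_lin a fv (bochner_zero T); rewrite addr0.
by under eq_fun do rewrite addr0.
Qed.

Lemma bochnerB T f g v w :
  is_bochner_integral T f v -> is_bochner_integral T g w ->
  is_bochner_integral T (fun t => f t - g t) (v - w).
Proof.
move=> fv gw; have := bochner_lin (-1) gw fv; rewrite scaleN1r addrC.
by under eq_fun do rewrite scaleN1r addrC.
Qed.

Lemma bochner_sum T (I : Type) (r : seq I) (f : I -> R -> V) (v : I -> V) :
  (forall i, is_bochner_integral T (f i) (v i)) ->
  is_bochner_integral T (fun t => \sum_(i <- r) f i t) (\sum_(i <- r) v i).
Proof.
move=> fv; elim: r => [|i r ih].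
  by rewrite big_nil; under eq_fun do rewrite big_nil; exact: bochner_zero.
rewrite big_cons; under eq_fun do rewrite big_cons.
have := bochner_lin 1 (fv i) ih; rewrite scale1r.
by under eq_fun do rewrite scale1r.
Qed.

Lemma bochner_ext T f g v : {in `[0, T], f =1 g} ->
  is_bochner_integral T f v -> is_bochner_integral T g v.
Proof.
move=> fg [s [[ms sf] int0 sv]]; exists s; split=> //.
  by split=> // t tT; rewrite -fg//; exact: sf.
rewrite (_ : (fun n => _) = fun n => nint T (fun t => rnorm (f t - simple_eval (s n) t)))//.
apply/funext => n; apply: eq_integral => t; rewrite inE/= => tT.
by rewrite fg.
Qed.

Lemma bochner_unique T f v w :
  is_bochner_integral T f v -> is_bochner_integral T f w -> v = w.
Proof.
move=> fv fw; have := bochner_norm (bochnerB fv fw).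
under [X in (_ <= X)%E]eq_integral do rewrite subrr rnorm0.
rewrite integral0 lee_fin => h; apply/eqP; rewrite -subr_eq0 -rnorm_eq0E.
by rewrite eq_le h rnorm_ge0.
Qed.

End Bochner.

Lemma bochner_map {R : realType} {V W : normedModType R[i]} (T : R) (f : R -> V) v
    (K : V -> W) (M : R) : linear K -> 0 <= M -> bounded_by M K ->
  is_bochner_integral T f v -> is_bochner_integral T (fun t => K (f t)) (K v).
Proof.
move=> Kl M0 KM fv; have mf := bochner_measurable fv.
move: fv => [s [[ms sf] int0 sv]].
have msn n : simple_measurable [seq (p.1, K p.2) | p <- s n].
  exact: simple_measurable_map.
have KB x y : K x - K y = K (x - y).
  by rewrite addrC -scaleN1r -Kl scaleN1r addrC.
have sa : simple_approximation T (fun t => K (f t)) (fun n => [seq (p.1, K p.2) | p <- s n]).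
  split=> // t tT; under eq_fun do rewrite (simple_eval_map _ _ Kl).
  by apply: (@rcvg_linear _ _ _ M K nat \oo _ (fun n => simple_eval (s n) t) (f t)) => //; exact: sf.
exists (fun n => [seq (p.1, K p.2) | p <- s n]); split => //.
- apply: (@squeeze_cvge _ _ _ _ (fun=> 0%E) _ (fun n => M%:E *
      \int[@lebesgue_measure R]_(t in `[0%R, T]) (rnorm (f t - simple_eval (s n) t))%:E)%E).
  + apply: nearW => n; rewrite nint_ge0/=; last by move=> t _; exact: rnorm_ge0.
    have m1 := simple_measurable_dist mf (ms n).
    rewrite -nintZ//.
    apply: nint_le => //.
    * by apply: simple_measurable_dist => //; exists (fun n => [seq (p.1, K p.2) | p <- s n]).
    * exact: measurable_funM.
    * by move=> t _; rewrite rnorm_ge0/= (simple_eval_map _ _ Kl) KB KM.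
  + exact: cvg_cst.
  + by rewrite -[X in _ --> X](@mule0 _ M%:E); apply: cvgeMl.
- under eq_fun do rewrite (simple_integral_map _ _ Kl).
  exact: (@rcvg_linear _ _ _ M K nat \oo _ (fun n => simple_integral T (s n)) v).
Qed.

(** * Existence of the Bochner integral *)

Section BochnerExistence.
Context {R : realType}.
Local Notation mu := (@lebesgue_measure R).
Local Notation nint T g := (\int[mu]_(t in `[0%R, T]) (g t)%:E)%E.

Lemma integrable_dominated (T : R) (g h : R -> R) :
  measurable_fun `[0, T] g -> measurable_fun `[0, T] h ->
  (forall t, t \in `[0, T] -> `|g t| <= h t) -> (nint T h < +oo)%E ->
  mu.-integrable `[0, T] (EFin \o g).
Proof.
move=> mg mh gh ih; apply/integrableP; split; first exact/measurable_EFinP.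
apply: le_lt_trans ih; apply: nint_le => //.
- exact: measurableT_comp.
- by move=> t tT; rewrite normr_ge0 gh.
Qed.

(** Simple approximations dominated by [rnorm (f t)] converge in L^1, and the bound on integrals of
    simple functions then makes their integrals a Cauchy sequence. *)
Lemma bochner_exists (V : completeNormedModType R[i]) (T : R) (f : R -> V) :
  separable V -> strongly_measurable T f -> (nint T (fun t => rnorm (f t)) < +oo)%E ->
  exists v, is_bochner_integral T f v.
Proof.
move=> sV mf intf.
have [s [ms sf] sle] := dominated_simple_approximation sV (fun v => strongly_measurable_dist v mf).
have mnf := strongly_measurable_norm mf.
have mdf n := simple_measurable_dist mf (ms n).
have int0 : nint T (fun t => rnorm (f t - simple_eval (s n) t)) @[n --> \oo] --> 0%:E.
  have [|||||_ h _] := @dominated_convergence _ _ R mu `[0, T] (measurable_itv _)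
    (fun n t => (rnorm (f t - simple_eval (s n) t))%:E) (cst 0%E)
    (fun t => (rnorm (f t))%:E).
  - by move=> n; apply/measurable_EFinP; exact: mdf.
  - exact: measurable_cst.
  - apply/aeW => t tT; apply/fine_cvgP; split; first exact: nearW.
    have /rcvgP := sf t tT; apply: cvg_trans; apply: near_eq_cvg; apply: nearW => n.
    by rewrite /= rdistC.
  - apply: (integrable_dominated mnf mnf) => // t _.
    by rewrite ger0_norm ?rnorm_ge0.
  - by apply/aeW => t n tT; rewrite abse_EFin lee_fin ger0_norm ?rnorm_ge0// sle.
  move: h; apply: cvg_trans; apply: near_eq_cvg; apply: nearW => n /=.
  by apply: eq_integral => t _; rewrite /= subr0 ger0_norm ?rnorm_ge0.
have [v sv] : exists v : V, simple_integral T (s n) @[n --> \oo] --> v.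
  apply: rcomplete => e e0; have e20 : 0 < e / 2 by rewrite divr_gt0.
  move/fine_cvgP : int0 => [[N1 _ hN1] /cvgrPdist_le/(_ _ e20)[N2 _ hN2]].
  have hN n : (maxn N1 N2 <= n)%N ->
      (nint T (fun t => rnorm (f t - simple_eval (s n) t)) <= (e / 2)%:E)%E.
    rewrite geq_max => /andP[n1 n2]; have := hN2 n n2.
    rewrite /= sub0r normrN ger0_norm; last by rewrite fine_ge0// nint_ge0.
    by rewrite -lee_fin fineK//; exact: hN1.
  exists (maxn N1 N2) => m n hm hn.
  have nl : linear (fun v : V => - v) by move=> a x y; rewrite opprD scalerN.
  pose s' := s m ++ [seq (p.1, - p.2) | p <- s n].
  have ms' : simple_measurable s'.
    by apply: simple_measurable_cat => //; exact: (simple_measurable_map (K := fun v => - v)).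
  have -> : simple_integral T (s m) - simple_integral T (s n) = simple_integral T s'.
    by rewrite simple_integral_cat (simple_integral_map _ _ nl).
  rewrite -lee_fin (le_trans (simple_integral_bound T ms'))//.
  rewrite (@le_trans _ _ (nint T (fun t => rnorm (f t - simple_eval (s m) t) +
     rnorm (f t - simple_eval (s n) t))))//.
    apply: nint_le; first exact: simple_measurable_norm.
      exact: measurable_funD.
    move=> t _; rewrite rnorm_ge0/= simple_eval_cat (simple_eval_map _ _ nl) addrC.
    by rewrite (rdistC (f t)) addrC (le_trans (rdistD (f t) _ _)).
  by rewrite nintD// [in leRHS](splitr e) EFinD leeD ?hN.
by exists v, s; split.
Qed.

End BochnerExistence.

(** * Bochner integrals tested against vectors *)

Section WeakIntegral.
Context {R : realType} {H : hilbertType R}.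
Local Notation mu := (@lebesgue_measure R).
Local Notation nint T g := (\int[mu]_(t in `[0%R, T]) (g t)%:E)%E.
Implicit Types (T : R) (f g : R -> H).

Lemma measurable_rdot T f g : strongly_measurable T f -> strongly_measurable T g ->
  measurable_fun `[0, T] (fun t => rdot (f t) (g t)).
Proof.
move=> mf mg; under [X in measurable_fun _ X]eq_fun do rewrite rdot_polar.
apply: measurable_funM => //; apply: measurable_funB; apply: measurable_funX.
  have := strongly_measurable_norm (strongly_measurable_lin 1 mf mg).
  by under [X in measurable_fun _ X]eq_fun do rewrite scale1r.
have := strongly_measurable_norm (strongly_measurable_lin (-1) mg mf).
by under [X in measurable_fun _ X]eq_fun do rewrite scaleN1r addrC.
Qed.

Lemma integrable_rdot_cst T f w : strongly_measurable T f ->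
  (nint T (fun t => rnorm (f t)) < +oo)%E ->
  mu.-integrable `[0, T] (EFin \o (fun t => rdot (f t) w)).
Proof.
move=> mf intf; have mn := strongly_measurable_norm mf.
apply: (@integrable_dominated _ _ _ (fun t => rnorm w * rnorm (f t))).
- by apply: measurable_rdot => //; exact: strongly_measurable_cst.
- exact: measurable_funM.
- by move=> t _; rewrite mulrC rdot_CS.
- by rewrite nintZ// lte_mul_pinfty// lee_fin rnorm_ge0.
Qed.

Lemma simple_norm_finite T (s : seq (set R * H)) : 0 <= T -> simple_measurable s ->
  (nint T (fun t => rnorm (simple_eval s t)) < +oo)%E.
Proof.
move=> T0; elim: s => [|[A v] s ih].
  by under eq_integral do rewrite simple_eval_nil rnorm0; rewrite integral0.
move=> /simple_measurable_cons[mA ms].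
have m1 : measurable_fun `[0, T] (fun t => rnorm (simple_eval s t)).
  exact: simple_measurable_norm.
apply: (@le_lt_trans _ _ (nint T (fun t => rnorm v + rnorm (simple_eval s t)))).
  apply: nint_le.
  - by apply: simple_measurable_norm; exact/simple_measurable_cons.
  - exact: measurable_funD.
  - move=> t _; rewrite rnorm_ge0/= simple_eval_cons; case: ifP => _.
      exact: rnormD.
    by rewrite lerDr rnorm_ge0.
by rewrite nintD// nint_cst// lte_add_pinfty ?ltry ?ih.
Qed.

Lemma simple_Rintegral_rdot T (s : seq (set R * H)) w : 0 <= T -> simple_measurable s ->
  \int[mu]_(t in `[0, T]) rdot (simple_eval s t) w = rdot (simple_integral T s) w.
Proof.
move=> T0; elim: s => [_|[A v] s ih].
  rewrite /simple_integral big_nil.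
  have rd0 : rdot (0 : H) w = 0 by rewrite -(scale0r 0) (rdotZl 0) mul0r.
  by under eq_Rintegral do rewrite simple_eval_nil rd0; rewrite /Rintegral integral0 rd0.
move=> /simple_measurable_cons[mA ms].
rewrite /simple_integral big_cons/= -/(simple_integral T s) rdotDl rdotZl -ih//.
have m1 : strongly_measurable T (simple_eval s).
  by exists (fun=> s); split=> // t tT; exact: cvg_cst.
have -> : \int[mu]_(t in `[0, T]) rdot (simple_eval ((A, v) :: s) t) w =
    \int[mu]_(t in `[0, T]) (rdot v w * \1_A t + rdot (simple_eval s t) w).
  apply: eq_Rintegral => t _; rewrite simple_eval_cons indicE; case: ifP => _.
    by rewrite mulr1 rdotDl.
  by rewrite mulr0 add0r.
have iA : mu.-integrable `[0, T] (EFin \o \1_A).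
  apply: (@integrable_dominated _ _ _ (fun=> 1)) => //.
  - by move=> t _; rewrite indicE ger0_norm// lern1 leq_b1.
  - by rewrite nint_cst// ltry.
rewrite RintegralD//; last 2 first.
- by apply: (@eq_integrable _ _ _ mu _ (measurable_itv _) (fun t => (rdot v w)%:E * (EFin \o \1_A) t)%E) => //; exact: integrableZl.
- by apply: integrable_rdot_cst => //; exact: simple_norm_finite.
congr (_ + _); rewrite RintegralZl// mulrC; congr (_ * _).
by rewrite /Rintegral integral_indic.
Qed.

(** Exact for simple functions. Passing to a simple approximation costs at most [e * rnorm w] twice:
    once for the integrand, once for the integral. *)
Lemma bochner_rdot T f v w : 0 <= T -> is_bochner_integral T f v ->
  (nint T (fun t => rnorm (f t)) < +oo)%E ->
  \int[mu]_(t in `[0, T]) rdot (f t) w = rdot v w.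
Proof.
move=> T0 fv intf; have mf := bochner_measurable fv.
apply/eqP; rewrite -subr_eq0 -normr_le0; apply: (@le_mul_eps _ _ _ (2 * rnorm w)).
  by rewrite mulr_ge0 ?rnorm_ge0.
move=> e e0; rewrite add0r; have [s [ms h1 h2]] := bochner_approx fv e0.
have m1 : strongly_measurable T (simple_eval s).
  by exists (fun=> s); split=> // t tT; exact: cvg_cst.
have md := simple_measurable_dist mf ms.
have mdf : strongly_measurable T (fun t => f t - simple_eval s t).
  have := strongly_measurable_lin (-1) m1 mf.
  by under eq_fun do rewrite scaleN1r addrC.
have i1 := integrable_rdot_cst w mf intf.
have i2 := integrable_rdot_cst w m1 (simple_norm_finite T0 ms).
rewrite (_ : _ - _ = \int[mu]_(t in `[0, T]) rdot (f t - simple_eval s t) w +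
    rdot (simple_integral T s - v) w); last first.
  rewrite rdotDl rdotNl -simple_Rintegral_rdot//.
  rewrite addrA; congr (_ - _); rewrite -RintegralD//; last first.
    exact: (@integrable_rdot_cst _ _ w mdf (le_lt_trans h1 (ltry _))).
  by apply: eq_Rintegral => t _; rewrite rdotDl rdotNl subrK.
rewrite (le_trans (ler_normD _ _))// -mulrA mulr2n mulrDl mul1r.
have i3 := @integrable_rdot_cst _ _ w mdf (le_lt_trans h1 (ltry _)).
apply: lerD; last by rewrite (le_trans (rdot_CS _ _))// mulrC ler_wpM2l ?rnorm_ge0.
rewrite (le_trans (le_normr_Rintegral _ i3))// -lee_fin fineK; last first.
  by apply: integrable_fin_num => //; exact: integrable_abse i3.
rewrite (@le_trans _ _ (nint T (fun t => rnorm w * rnorm (f t - simple_eval s t))))//.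
  apply: nint_le; last by move=> t _; rewrite normr_ge0/= mulrC rdot_CS.
    apply: measurableT_comp => //; apply: measurable_rdot => //.
    exact: strongly_measurable_cst.
  exact: measurable_funM.
by rewrite nintZ// EFinM lee_wpmul2l// lee_fin rnorm_ge0.
Qed.

End WeakIntegral.

(** * The fundamental theorem of calculus by Riemann sums *)

Section RiemannSums.
Context {R : realType} {V : normedModType R[i]}.
Local Notation mu := (@lebesgue_measure R).
Local Notation nint T g := (\int[mu]_(t in `[0%R, T]) (g t)%:E)%E.
Variables (T : R) (T0 : 0 < T) (f F : R -> V).

Let h N : R := T / N.+1%:R.
Let h0 N : 0 < h N. Proof. by rewrite divr_gt0. Qed.

(** Left-endpoint values on N + 1 intervals of length [h N], and one interval more: [T, T + h N)
    covers the endpoint T, where convergence is also required. It meets [0, T] in one point and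
    drops out of the integral. *)
Let step N : seq (set R * V) :=
  [seq ([set t | h N * k%:R <= t < h N * k.+1%:R], f (h N * k%:R)) | k <- iota 0 N.+2].

Let step_measurable N : simple_measurable (step N).
Proof.
move=> p /mapP[k _ ->]/=; have := measurable_itv `[h N * k%:R, h N * k.+1%:R[.
rewrite (_ : [set` _] = [set t | h N * k%:R <= t < h N * k.+1%:R]).
  exact.
by apply/seteqP; split=> t /=; rewrite in_itv.
Qed.

Let step_eval N t : 0 <= t <= T ->
  exists k : nat, [/\ h N * k%:R <= t, t - h N * k%:R <= h N, h N * k%:R <= T &
    simple_eval (step N) t = f (h N * k%:R)].
Proof.
move=> /andP[t0 tT]; pose k := Num.truncn (t / h N).
have th0 : 0 <= t / h N by rewrite divr_ge0// ltW.
have /andP[k1 k2] := truncn_itv th0; rewrite -/k in k1 k2.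
have kt : h N * k%:R <= t by rewrite mulrC -ler_pdivlMr.
have tk : t < h N * k.+1%:R by rewrite mulrC -ltr_pdivrMr.
have kN : (k <= N.+1)%N.
  rewrite -(ler_nat R); apply: le_trans k1 _; rewrite ler_pdivrMr// mulrC divfK//.
exists k; split => //; last first.
  rewrite /simple_eval /step big_map (bigD1_seq k) ?iota_uniq ?mem_iota//=.
  rewrite big1 => [|i ik]; last first.
    rewrite indicE memNset ?scale0r//= => /andP[i1 i2]; move/eqP: ik; apply.
    have a1 : h N * i%:R < h N * k.+1%:R by exact: le_lt_trans i1 _.
    have a2 : h N * k%:R < h N * i.+1%:R by exact: le_lt_trans kt _.
    rewrite ltr_pM2l// ltr_nat ltnS in a1; rewrite ltr_pM2l// ltr_nat ltnS in a2.
    by apply/eqP; rewrite eqn_leq a1 a2.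
  by rewrite addr0 indicE mem_set ?scale1r//= kt tk.
- exact: le_trans kt tT.
- by rewrite lerBlDl -{2}(mulr1 (h N)) -mulrDr -(natrD _ k 1) addn1 ltW.
Qed.

Let step_integral N : simple_integral T (step N) =
  \sum_(k < N.+1) (h N)%:C *: f (h N * k%:R).
Proof.
have hT : h N * N.+1%:R = T by rewrite divfK.
rewrite /simple_integral /step big_map -[iota 0 N.+2]/(index_iota 0 N.+2) big_mkord.
rewrite big_ord_recr/= hT.
rewrite (_ : _ `&` _ = [set T]); last first.
  apply/seteqP; split=> [t /= [/andP[t1 _]]|t ->/=].
    by rewrite in_itv/= => /andP[_ t2]; apply/eqP; rewrite eq_le t1 t2.
  by rewrite in_itv/= (ltW T0) !lexx -{1}hT ltr_pM2l// ltr_nat ltnSn.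
rewrite lebesgue_measure_set1/= scale0r addr0.
apply: eq_bigr => k _; congr (_%:C *: _).
have kN : h N * k.+1%:R <= T by rewrite -[leRHS]hT ler_pM2l// ler_nat.
rewrite (_ : _ `&` _ = `[h N * k%:R, h N * k.+1%:R[%classic); last first.
  apply/seteqP; split=> t /=; rewrite !in_itv/=; first by case.
  move=> /andP[t1 t2]; rewrite t1 t2; split=> //.
  have hk : 0 <= h N * k%:R by apply: mulr_ge0 => //; exact: ltW.
  by rewrite (le_trans hk t1)/= ltW// (lt_le_trans t2).
have -> // : mu `[h N * k%:R, h N * k.+1%:R[ = (h N)%:E.
rewrite lebesgue_measure_itv/= lte_fin ltr_pM2l// ltr_nat ltnS leqnn -EFinB.
by rewrite -mulrBr -natr1 addrAC subrr add0r mulr1.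
Qed.

(** The hypothesis controls increments of [F] uniformly in their left endpoint, which is what a
    semigroup orbit provides. Left-endpoint step functions then converge uniformly to [f], and their
    integrals differ from the telescoping sum of increments by at most [e / T] times the total
    length T. *)
Lemma bochner_FTC :
  (forall e, 0 < e -> exists2 d : R, 0 < d & forall s t, 0 <= s -> s <= t -> t <= T -> t - s < d ->
     rnorm (F t - F s - (t - s)%:C *: f s) <= e * (t - s) /\ rnorm (f t - f s) <= e) ->
  is_bochner_integral T f (F T - F 0).
Proof.
move=> FT.
have hd d : 0 < d -> exists N0, forall N, (N0 <= N)%N -> h N < d.
  move=> d0; exists (Num.truncn (T / d)) => N N0; rewrite /h ltr_pdivrMr// mulrC -ltr_pdivrMr//.
  by apply: lt_le_trans (truncnS_gt _) _; rewrite ler_nat ltnS.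
have close e : 0 < e -> exists N0, forall N, (N0 <= N)%N -> forall t, t \in `[0, T] ->
    rnorm (f t - simple_eval (step N) t) <= e.
  move=> e0; have [d d0 hF] := FT _ e0; have [N0 hN0] := hd _ d0; exists N0 => N hN t.
  rewrite in_itv/= => tT; have [k [k1 k2 k3 ->]] := step_eval N tT.
  have [||||_ ->//] := hF (h N * k%:R) t => //.
  - by rewrite mulr_ge0// ltW.
  - by case/andP: tT.
  - by rewrite (le_lt_trans k2)// hN0.
have sa : simple_approximation T f step.
  split=> [N|t tT]; first exact: step_measurable.
  apply/rcvg_seqP => e /close[N0 hN0]; exists N0 => n n0.
  by rewrite rdistC hN0.
have mf : strongly_measurable T f by exists step.
exists step; split => //.
- apply/fine_cvgP; split; last first.
    apply/cvgrPdist_le => e e0.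
    have /close[N0 hN0] : 0 < e / T by rewrite divr_gt0.
    exists N0 => // n n0 /=; rewrite sub0r normrN ger0_norm; last by rewrite fine_ge0// nint_ge0.
    have h1 : (nint T (fun t => rnorm (f t - simple_eval (step n) t)) <= e%:E)%E.
      have -> : e = e / T * T by rewrite divfK// gt_eqF.
      rewrite -(nint_cst _ (ltW T0)); apply: nint_le => //.
        exact: simple_measurable_dist.
      by move=> t tT; rewrite rnorm_ge0 hN0.
    rewrite -lee_fin fineK// ge0_fin_numE ?nint_ge0//.
    exact: le_lt_trans h1 (ltry _).
  have [N0 hN0] := close _ ltr01; exists N0 => // n n0 /=.
  rewrite ge0_fin_numE ?nint_ge0//.
  apply: (@le_lt_trans _ _ (nint T (fun=> 1))); last by rewrite nint_cst ?ltry// ltW.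
  apply: nint_le => //; first exact: simple_measurable_dist.
  by move=> t tT; rewrite rnorm_ge0 hN0.
- apply/rcvg_seqP => e e0; have eT0 : 0 < e / T by rewrite divr_gt0.
  have [d d0 hF] := FT _ eT0; have [N0 hN0] := hd _ d0; exists N0 => N hN.
  have hT : h N * N.+1%:R = T by rewrite divfK.
  rewrite step_integral.
  have -> : F T - F 0 = \sum_(k < N.+1) (F (h N * k.+1%:R) - F (h N * k%:R)).
    rewrite -(big_mkord xpredT (fun k => F (h N * k.+1%:R) - F (h N * k%:R))).
    by rewrite telescope_sumr// hT mulr0.
  rewrite -sumrB (le_trans (rnorm_sum _ _ _))//.
  rewrite (@le_trans _ _ (\sum_(k < N.+1) (e / T * h N)))//.
    apply: ler_sum => k _; rewrite rdistC.
    have e1 : h N * k.+1%:R - h N * k%:R = h N by rewrite -mulrBr -natr1 addrAC subrr add0r mulr1.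
    have [||||] := hF (h N * k%:R) (h N * k.+1%:R); rewrite ?e1 ?hN0//.
    - by rewrite mulr_ge0// ltW.
    - by rewrite ler_pM2l// ler_nat.
    - by rewrite -[leRHS]hT ler_pM2l// ler_nat.
  by rewrite sumr_const card_ord -mulr_natr -mulrA hT divfK// gt_eqF.
Qed.

End RiemannSums.

(** * Orthonormal families and Hilbert-Schmidt sums *)

Section Esum.
Context {R : realType} {I : choiceType}.
Implicit Types (S : set I) (a : I -> \bar R).

Lemma esum_ge_seq S a (X : seq I) : uniq X -> (forall i, i \in X -> S i) ->
  (\sum_(i <- X) a i <= \esum_(i in S) a i)%E.
Proof.
move=> uX XS; apply: esum_ge; exists [set` X]; first by split=> // i /XS.
by rewrite -fsbig_seq.
Qed.

Lemma esum_le_seq S a M :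
  (forall X : seq I, uniq X -> (forall i, i \in X -> S i) -> (\sum_(i <- X) a i <= M)%E) ->
  (\esum_(i in S) a i <= M)%E.
Proof.
move=> h; apply: ge_ereal_sup => _ [A [fA AS] <-].
rewrite fsbig_finite//; apply: h => [|i]; first exact: finmap.fset_uniq.
by rewrite in_fset_set// inE => /AS.
Qed.

Lemma esum_approx S (a : I -> R) M : (\esum_(i in S) (a i)%:E = M%:E)%E ->
  forall e, 0 < e -> exists X : seq I, [/\ uniq X, forall i, i \in X -> S i &
    M - e <= \sum_(i <- X) a i].
Proof.
move=> aM e e0; apply: contrapT => h.
have : (\esum_(i in S) (a i)%:E <= (M - e)%:E)%E.
  apply: esum_le_seq => X uX XS; rewrite sumEFin lee_fin leNgt; apply/negP => hX.
  by apply: h; exists X; split => //; exact: ltW.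
by rewrite aM lee_fin lerBrDr gerDl leNgt e0.
Qed.

(** One inequality is stated, as it follows from finite partial sums; the opposite one is the same
    lemma with the index sets exchanged. *)
Lemma esum_swap (J : choiceType) S (S' : set J) (a : I -> J -> \bar R) :
  (forall i j, S i -> S' j -> (0 <= a i j)%E) ->
  (\esum_(i in S) \esum_(j in S') a i j <= \esum_(j in S') \esum_(i in S) a i j)%E.
Proof.
move=> a0; apply: esum_le_seq => X uX XS.
rewrite big_seq -esum_sum; last by move=> j i Sj /XS Si; exact: a0.
by apply: le_esum => j Sj; rewrite -big_seq; exact: esum_ge_seq.
Qed.

Lemma esum_scale S a (c : R) : 0 <= c -> (forall i, S i -> (0 <= a i)%E) ->
  (\esum_(i in S) (c%:E * a i) <= c%:E * \esum_(i in S) a i)%E.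
Proof.
move=> c0 a0; apply: esum_le_seq => X uX XS.
rewrite big_seq -ge0_sume_distrr; last by move=> i /XS /a0.
by rewrite lee_wpmul2l ?lee_fin// -big_seq esum_ge_seq.
Qed.

End Esum.

(** What the abstract arguments use of a Hilbert space given by representatives. The inner product
    may be degenerate, so limits are determined up to zero seminorm; [hil H] and [L2 T Y] are the
    two instances. *)
Record hilbert_axioms {R : realType} (E : hilbertRep R) : Prop := {
  dom0 : rep_dom E 0 ;
  dom_lin : forall (a : R[i]) x y, rep_dom E x -> rep_dom E y -> rep_dom E (a *: x + y) ;
  rdot_lin : forall (a : R[i]) x y z, rep_dom E x -> rep_dom E y -> rep_dom E z ->
    rep_dot (a *: x + y) z = a * rep_dot x z + rep_dot y z ;
  rdot_conj : forall x y, rep_dom E x -> rep_dom E y -> rep_dot x y = conjc (rep_dot y x) ;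
  rdot_ge0 : forall x, rep_dom E x -> 0 <= sqnorm x ;
  rep_complete : forall u : nat -> E, (forall n, rep_dom E (u n)) ->
    (forall e, 0 < e -> exists N, forall m n, (N <= m)%N -> (N <= n)%N ->
       sqnorm (u m - u n) <= e) ->
    exists2 x, rep_dom E x &
      forall e, 0 < e -> exists N, forall n, (N <= n)%N -> sqnorm (u n - x) <= e }.

Section AbstractHilbert.
Context {R : realType} {E : hilbertRep R} (hE : hilbert_axioms E).
Implicit Types (x y z : E) (a : R[i]).
Local Notation dom := (@rep_dom R E).
Local Notation "<| x , y |>" := (rep_dot x y) (at level 0).

Lemma domD x y : dom x -> dom y -> dom (x + y).
Proof. by move=> dx dy; rewrite -[x]scale1r; exact: dom_lin. Qed.

Lemma domZ a x : dom x -> dom (a *: x).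
Proof. by move=> dx; rewrite -[a *: x]addr0; apply: dom_lin => //; exact: dom0. Qed.

Lemma domB x y : dom x -> dom y -> dom (x - y).
Proof. by move=> dx dy; rewrite addrC -scaleN1r; exact: dom_lin. Qed.

Lemma dom_sum (I : eqType) (X : seq I) (a : I -> R[i]) (g : I -> E) :
  (forall i, i \in X -> dom (g i)) -> dom (\sum_(i <- X) a i *: g i).
Proof.
elim: X => [|i X ih] h; first by rewrite big_nil; exact: dom0.
rewrite big_cons; apply: dom_lin => //; first by apply: h; rewrite mem_head.
by apply: ih => k kX; apply: h; rewrite inE kX orbT.
Qed.

Lemma rep_dotDl x y z : dom x -> dom y -> dom z -> <|x + y, z|> = <|x, z|> + <|y, z|>.
Proof. by move=> dx dy dz; rewrite -[x]scale1r rdot_lin// mul1r scale1r. Qed.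

Lemma rep_dot0l z : dom z -> <|0, z|> = 0.
Proof.
move=> dz; apply: (addrI <|0, z|>); rewrite addr0 -rep_dotDl ?addr0//; exact: dom0.
Qed.

Lemma rep_dotZl a x z : dom x -> dom z -> <|a *: x, z|> = a * <|x, z|>.
Proof.
move=> dx dz; rewrite -[a *: x]addr0 rdot_lin//; last exact: dom0.
by rewrite rep_dot0l// addr0.
Qed.

Lemma rep_dotBl x y z : dom x -> dom y -> dom z -> <|x - y, z|> = <|x, z|> - <|y, z|>.
Proof. by move=> dx dy dz; rewrite addrC -scaleN1r rdot_lin// mulN1r addrC. Qed.

Lemma rep_dotZr a x z : dom x -> dom z -> <|x, a *: z|> = conjc a * <|x, z|>.
Proof.
move=> dx dz; rewrite rdot_conj ?rep_dotZl ?rmorphM/= -?rdot_conj//; exact: domZ.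
Qed.

Lemma rep_dot_suml (I : eqType) (X : seq I) (a : I -> R[i]) (g : I -> E) z :
  (forall i, i \in X -> dom (g i)) -> dom z ->
  <|\sum_(i <- X) a i *: g i, z|> = \sum_(i <- X) a i * <|g i, z|>.
Proof.
move=> + dz; elim: X => [|i X ih] h; first by rewrite !big_nil rep_dot0l.
have h' k : k \in X -> dom (g k) by move=> kX; apply: h; rewrite inE kX orbT.
rewrite !big_cons rdot_lin ?ih//; first by apply: h; rewrite mem_head.
exact: dom_sum.
Qed.

Lemma rep_dot_sumr (I : eqType) (X : seq I) (a : I -> R[i]) (g : I -> E) z :
  (forall i, i \in X -> dom (g i)) -> dom z ->
  <|z, \sum_(i <- X) a i *: g i|> = \sum_(i <- X) conjc (a i) * <|z, g i|>.
Proof.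
move=> h dz; rewrite rdot_conj//; last exact: dom_sum.
rewrite rep_dot_suml// rmorph_sum/= big_seq [RHS]big_seq; apply: eq_bigr => i /h dg.
by rewrite rmorphM/= -rdot_conj.
Qed.

Lemma sqnormB x y : dom x -> dom y ->
  sqnorm (x - y) = sqnorm x + sqnorm y - 2 * complex.Re <|x, y|>.
Proof.
move=> dx dy; have dxy := domB dx dy.
rewrite /sqnorm rep_dotBl// rdot_conj// [<|y, x - y|>]rdot_conj// !rep_dotBl//.
rewrite [<|y, x|>]rdot_conj//.
by case: <|x, x|> <|y, y|> <|x, y|> => [? ?] [? ?] [? ?] /=; ring.
Qed.

Lemma sqnormZ a x : dom x -> sqnorm (a *: x) = normc a ^+ 2 * sqnorm x.
Proof.
move=> dx; rewrite /sqnorm rep_dotZl ?rep_dotZr//; last exact: domZ.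
rewrite mulrA -sqr_normc_conj normcE' -rmorphXn/=.
by case: <|x, x|> => u v /=; rewrite mul0r subr0.
Qed.

Lemma sqnormC x y : dom x -> dom y -> sqnorm (x - y) = sqnorm (y - x).
Proof.
move=> dx dy; have -> : y - x = (-1) *: (x - y) by rewrite scaleN1r opprB.
rewrite sqnormZ; last exact: domB.
by rewrite normc_sqr/= sqrrN expr1n oppr0 expr0n/= addr0 mul1r.
Qed.

Lemma sqnorm_real x : dom x -> <|x, x|> = (sqnorm x)%:C.
Proof.
move=> dx; have := rdot_conj hE dx dx; rewrite /sqnorm; case: <|x, x|> => u v /= [h].
by congr Complex; lra.
Qed.

Lemma sqnormB_le x y : dom x -> dom y -> sqnorm (x - y) <= 2 * sqnorm x + 2 * sqnorm y.
Proof.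
move=> dx dy; have := rdot_ge0 hE (domD dx dy).
have -> : x + y = x - (-1) *: y by rewrite scaleN1r opprK.
rewrite !sqnormB//; last exact: domZ.
rewrite sqnormZ// rep_dotZr// normc_sqr/= sqrrN expr1n oppr0 expr0n/= addr0 mul1r.
by case: <|x, y|> => u v /=; lra.
Qed.

(** A triangle inequality for squares: the factor 2 is harmless and no square root is taken. *)
Lemma sqnorm_dist z x y : dom x -> dom y -> dom z ->
  sqnorm (x - y) <= 2 * sqnorm (x - z) + 2 * sqnorm (z - y).
Proof.
move=> dx dy dz; rewrite (sqnormC dz dy).
have -> : x - y = (x - z) - (y - z) by rewrite opprB addrA subrK.
by apply: sqnormB_le; exact: domB.
Qed.

Lemma rep_CS x y : dom x -> dom y -> normc <|x, y|> ^+ 2 <= sqnorm x * sqnorm y.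
Proof.
move=> dx dy; have x0 := rdot_ge0 hE dx; have y0 := rdot_ge0 hE dy.
apply: (@le_mul_eps _ _ _ (sqnorm x)) => // e e0.
set X := sqnorm x in x0 *; set Y := sqnorm y in y0 *; set n := normc _ ^+ 2.
have Ye : 0 < Y + e by rewrite ltr_wpDl.
(* The usual projection coefficient with denominator [Y + e] instead of [Y], because the seminorm of
   [y] may vanish. *)
pose c := ((Y + e)^-1)%:C * <|x, y|>.
have n0 : 0 <= n by exact: sqr_ge0.
have := rdot_ge0 hE (domB dx (domZ c dy)).
rewrite sqnormB//; last exact: domZ.
rewrite sqnormZ// rep_dotZr//.
have -> : complex.Re (conjc c * <|x, y|>) = n / (Y + e).
  rewrite /c rmorphM/= mulrAC -mulrA -sqr_normc_conj normcE' -rmorphXn/= -/n.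
  by rewrite mulr0 subr0 mulrC.
have -> : normc c ^+ 2 = n / (Y + e) ^+ 2.
  rewrite /c normcM exprMn normc_real ger0_norm ?invr_ge0 ?ltW//.
  by rewrite exprVn mulrC.
rewrite -/X -/Y => h.
have h1 : n * Y / (Y + e) ^+ 2 <= n / (Y + e).
  rewrite expr2 invfM mulrA ler_pM2r ?invr_gt0// ler_pdivrMr//.
  by apply: ler_wpM2l => //; rewrite lerDl ltW.
have h2 : n / (Y + e) <= X.
  move: h; rewrite mulrAC => h; lra.
by move: h2; rewrite ler_pdivrMr// mulrDr.
Qed.

Section OrthonormalFamily.
Context {I : choiceType}.
Variables (J : set I) (b : I -> E).

Definition orthonormal_family := (forall i, J i -> dom (b i)) /\
  forall i j, J i -> J j -> <|b i, b j|> = (i == j)%:R.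

Hypothesis hb : orthonormal_family.
Implicit Types X : seq I.

Let domb X : (forall i, i \in X -> J i) -> forall i, i \in X -> dom (b i).
Proof. by move=> XJ i /XJ; exact: hb.1. Qed.

Lemma orthonormal_coef X (a : I -> R[i]) j : uniq X -> (forall i, i \in X -> J i) -> J j ->
  <|\sum_(i <- X) a i *: b i, b j|> = if j \in X then a j else 0.
Proof.
move=> uX XJ Jj; rewrite rep_dot_suml//; last 2 first.
- exact: domb.
- exact: hb.1.
have -> : \sum_(i <- X) a i * <|b i, b j|> = \sum_(i <- X) (if i == j then a i else 0).
  rewrite big_seq [RHS]big_seq; apply: eq_bigr => i /XJ Ji; rewrite hb.2//.
  by case: eqP => _; rewrite ?mulr1 ?mulr0.
case: ifPn => jX.
  rewrite (bigD1_seq j)//= eqxx big1 ?addr0// => i /negPf->//.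
by rewrite big_seq big1// => i iX; case: eqP => // ij; rewrite -ij iX in jX.
Qed.

Lemma orthonormal_sqnorm X (a : I -> R[i]) : uniq X -> (forall i, i \in X -> J i) ->
  sqnorm (\sum_(i <- X) a i *: b i) = \sum_(i <- X) normc (a i) ^+ 2.
Proof.
move=> uX XJ; apply: complexI; rewrite -sqnorm_real; last exact/dom_sum/domb.
rewrite rep_dot_sumr; last 2 first.
- exact: domb.
- exact/dom_sum/domb.
rewrite rmorph_sum/= big_seq [RHS]big_seq; apply: eq_bigr => i iX.
rewrite orthonormal_coef// ?iX; last exact: XJ.
by rewrite mulrC -sqr_normc_conj normcE' rmorphXn.
Qed.

Definition ortho_proj X x := \sum_(i <- X) <|x, b i|> *: b i.

Lemma dom_proj X x : (forall i, i \in X -> J i) -> dom (ortho_proj X x).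
Proof. by move=> XJ; apply: dom_sum; exact: domb. Qed.

Lemma sqnorm_proj X x : uniq X -> (forall i, i \in X -> J i) -> dom x ->
  sqnorm (x - ortho_proj X x) = sqnorm x - \sum_(i <- X) normc <|x, b i|> ^+ 2.
Proof.
move=> uX XJ dx; rewrite sqnormB//; last exact: dom_proj.
rewrite orthonormal_sqnorm// /ortho_proj rep_dot_sumr//; last exact: domb.
have -> : \sum_(i <- X) conjc <|x, b i|> * <|x, b i|> = (\sum_(i <- X) normc <|x, b i|> ^+ 2)%:C.
  by rewrite rmorph_sum/=; apply: eq_bigr => i _; rewrite mulrC -sqr_normc_conj normcE' rmorphXn.
by rewrite /=; ring.
Qed.

Lemma bessel x : dom x ->
  (\esum_(i in J) (normc <|x, b i|> ^+ 2)%:E <= (sqnorm x)%:E)%E.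
Proof.
move=> dx; apply: esum_le_seq => X uX XJ; rewrite sumEFin lee_fin -subr_ge0.
by rewrite -sqnorm_proj//; apply: rdot_ge0 => //; apply: domB => //; exact: dom_proj.
Qed.

Hypothesis complete_b : forall x, dom x -> (forall i, J i -> <|x, b i|> = 0) -> sqnorm x = 0.

Let cut X x i : R[i] := if i \in X then <|x, b i|> else 0.

(* W is arbitrary so that the estimate carries over to images of the b_i. *)
Lemma cut_bound X X' x (M d d' : R) : uniq X -> uniq X' ->
  (forall i, i \in X -> J i) -> (forall i, i \in X' -> J i) ->
  (\esum_(i in J) (normc <|x, b i|> ^+ 2)%:E = M%:E)%E ->
  M - d <= \sum_(i <- X) normc <|x, b i|> ^+ 2 ->
  M - d' <= \sum_(i <- X') normc <|x, b i|> ^+ 2 ->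
  exists Z (c : I -> R[i]), [/\ uniq Z, forall i, i \in Z -> J i,
    \sum_(i <- Z) normc (c i) ^+ 2 <= d + d' &
    forall (W : lmodType R[i]) (w : I -> W),
      \sum_(i <- X) <|x, b i|> *: w i - \sum_(i <- X') <|x, b i|> *: w i =
      \sum_(i <- Z) c i *: w i].
Proof.
move=> uX uX' XJ X'J aM h h'.
pose Z := undup (X ++ X').
have uZ : uniq Z by exact: undup_uniq.
have ZJ i : i \in Z -> J i by rewrite mem_undup mem_cat => /orP[/XJ|/X'J].
have XZ : {subset X <= Z} by move=> i iX; rewrite mem_undup mem_cat iX.
have X'Z : {subset X' <= Z} by move=> i iX; rewrite mem_undup mem_cat iX orbT.
have hcut (W : lmodType R[i]) (w : I -> W) Y : uniq Y -> {subset Y <= Z} ->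
    \sum_(i <- Y) <|x, b i|> *: w i = \sum_(i <- Z) cut Y x i *: w i.
  move=> uY YZ; rewrite [RHS](bigID (mem Y))/= [X in _ + X]big1 ?addr0; last first.
    by move=> i /negPf hi; rewrite /cut hi scale0r.
  rewrite -[RHS]big_filter [RHS](perm_big Y).
    by rewrite [LHS]big_seq [RHS]big_seq; apply: eq_bigr => i iX; rewrite /cut iX.
  apply: uniq_perm => //; first exact: filter_uniq.
  by move=> i; rewrite mem_filter; case: (boolP (i \in Y)) => //= /YZ ->.
have hsum Y : uniq Y -> {subset Y <= Z} ->
    \sum_(i <- Y) normc <|x, b i|> ^+ 2 = \sum_(i <- Z) (i \in Y)%:R * normc <|x, b i|> ^+ 2.
  move=> uY YZ; rewrite [RHS](bigID (mem Y))/= [X in _ + X]big1 ?addr0; last first.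
    by move=> i /negPf hi; rewrite hi mul0r.
  rewrite -[RHS]big_filter [RHS](perm_big Y).
    by rewrite [LHS]big_seq [RHS]big_seq; apply: eq_bigr => i iX; rewrite iX mul1r.
  apply: uniq_perm => //; first exact: filter_uniq.
  by move=> i; rewrite mem_filter; case: (boolP (i \in Y)) => //= /YZ ->.
have hZ : \sum_(i <- Z) normc <|x, b i|> ^+ 2 <= M.
  by rewrite -lee_fin -aM -sumEFin; exact: esum_ge_seq.
exists Z, (fun i => cut X x i - cut X' x i); split => //.
  rewrite (@le_trans _ _ (\sum_(i <- Z) ((normc <|x, b i|> ^+ 2 - (i \in X)%:R * normc <|x, b i|> ^+ 2) +
     (normc <|x, b i|> ^+ 2 - (i \in X')%:R * normc <|x, b i|> ^+ 2))))//.
    apply: ler_sum => i _; rewrite /cut.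
    have := sqr_ge0 (normc <|x, b i|>).
    case: (i \in X) (i \in X') => [] []; rewrite ?subrr ?subr0 ?sub0r ?mul1r ?mul0r
      ?normc0 ?normcN ?expr0n/=; lra.
  rewrite big_split/= !sumrB -!hsum//; lra.
by move=> W w; rewrite !hcut// -sumrB; apply: eq_bigr => i _; rewrite scalerBl.
Qed.

(** Projections on finite sets [X n] whose coefficient sums nearly reach the supremum [M] form a
    Cauchy sequence, by [cut_bound]. Their limit [p] has the coefficients of [x], so completeness of
    the family annihilates [x - p]. *)
Lemma proj_approx x (e : R) : dom x -> 0 < e ->
  exists X, [/\ uniq X, forall i, i \in X -> J i & sqnorm (x - ortho_proj X x) <= e].
Proof.
move=> dx e0.
have [M aM] : exists M : R, (\esum_(i in J) (normc <|x, b i|> ^+ 2)%:E = M%:E)%E.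
  exists (fine (\esum_(i in J) (normc <|x, b i|> ^+ 2)%:E)%E).
  rewrite fineK// ge0_fin_numE; first exact: le_lt_trans (bessel dx) (ltry _).
  by apply: esum_ge0 => i _; rewrite lee_fin sqr_ge0.
have h n : exists X : seq I, [/\ uniq X, forall i, i \in X -> J i &
    M - n.+1%:R^-1 <= \sum_(i <- X) normc <|x, b i|> ^+ 2].
  by apply: esum_approx; rewrite ?invr_gt0.
have [X hX] := choice h.
have dp n : dom (ortho_proj (X n) x) by case: (hX n) => _ XJ _; exact: dom_proj.
have hN d : 0 < d -> exists N, forall n, (N <= n)%N -> n.+1%:R^-1 <= d :> R.
  move=> d0; exists (Num.truncn d^-1) => n Nn.
  rewrite invf_ple ?posrE// (le_trans (ltW (truncnS_gt _)))// ler_nat ltnS//.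
have cau d : 0 < d -> exists N, forall m n, (N <= m)%N -> (N <= n)%N ->
    sqnorm (ortho_proj (X m) x - ortho_proj (X n) x) <= d.
  move=> d0; have [|N hn] := hN (d / 2); first by rewrite divr_gt0.
  exists N => m n Nm Nn; have [u1 j1 s1] := hX m; have [u2 j2 s2] := hX n.
  have [Z [c [uZ ZJ Zc Zw]]] := cut_bound u1 u2 j1 j2 aM s1 s2.
  rewrite /ortho_proj Zw orthonormal_sqnorm// (le_trans Zc)// [leRHS]splitr.
  by rewrite lerD ?hn.
have [p dp' hp] := rep_complete hE dp cau.
have xp : sqnorm (x - p) = 0.
  apply: complete_b; first exact: domB.
  move=> i Ji; have db := hb.1 _ Ji.
  suff h0 : normc <|x - p, b i|> ^+ 2 <= 0.
    by apply: eq0_normc; apply/eqP; rewrite -sqrf_eq0 eq_le h0 sqr_ge0.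
  apply: (@le_mul_eps _ _ _ 4) => // d d0; rewrite add0r.
  have [N1 h1] := hN _ d0; have [N2 h2] := hp _ d0.
  pose n := maxn N1 N2; have [u1 j1 s1] := hX n.
  have a1 : normc <|x - ortho_proj (X n) x, b i|> ^+ 2 <= d.
    rewrite rep_dotBl// orthonormal_coef//; case: ifPn => iX.
      by rewrite subrr normc0 expr0n/= ltW.
    rewrite subr0 (le_trans _ (h1 n (leq_maxl _ _)))//.
    (* An index outside [X n] can be added to it without exceeding [M], so its coefficient is at
       most the missing mass. *)
    have : normc <|x, b i|> ^+ 2 + \sum_(i <- X n) normc <|x, b i|> ^+ 2 <= M.
      have := @esum_ge_seq _ _ J (fun i => (normc <|x, b i|> ^+ 2)%:E) (i :: X n).
      rewrite aM sumEFin lee_fin big_cons; apply; first by rewrite /= iX u1.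
      by move=> k; rewrite inE => /predU1P[->//|/j1].
    move: s1; set q := n.+1%:R^-1; set s := \sum_(_ <- _) _ => hs1 hs2.
    by rewrite -(lerD2r s) (le_trans hs2)// -lerBlDl.
  have a2 : normc <|ortho_proj (X n) x - p, b i|> ^+ 2 <= d.
    rewrite (le_trans (rep_CS (domB (dp n) dp') db))//.
    by rewrite /sqnorm hb.2// eqxx mulr1 h2 ?leq_maxr.
  have -> : <|x - p, b i|> = <|x - ortho_proj (X n) x, b i|> + <|ortho_proj (X n) x - p, b i|>.
    by rewrite !rep_dotBl// addrA subrK.
  have := le_normcD <|x - ortho_proj (X n) x, b i|> <|ortho_proj (X n) x - p, b i|>.
  have := sqr_ge0 (normc <|x - ortho_proj (X n) x, b i|> - normc <|ortho_proj (X n) x - p, b i|>).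
  have := normc_ge0 (<|x - ortho_proj (X n) x, b i|> + <|ortho_proj (X n) x - p, b i|>).
  by move: a1 a2; set u := normc _; set v := normc _; set w := normc _; nra.
have [|N h1] := hp (e / 2); first by rewrite divr_gt0.
have [u1 j1 s1] := hX N; exists (X N); split=> //.
rewrite (le_trans (sqnorm_dist dx (dp N) dp'))// xp mulr0 add0r.
by rewrite sqnormC// mulrC -ler_pdivlMr// h1.
Qed.

Lemma parseval x : dom x ->
  (\esum_(i in J) (normc <|x, b i|> ^+ 2)%:E = (sqnorm x)%:E)%E.
Proof.
move=> dx; apply/eqP; rewrite eq_le bessel//=.
apply/lee_addgt0Pr => e e0; have [X [uX XJ]] := proj_approx dx e0.
rewrite sqnorm_proj// lerBlDr => h.
rewrite (@le_trans _ _ ((\sum_(i <- X) normc <|x, b i|> ^+ 2)%:E + e%:E)%E)//.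
  by rewrite -EFinD lee_fin addrC.
by rewrite leeD2r// -sumEFin; exact: esum_ge_seq.
Qed.

End OrthonormalFamily.

End AbstractHilbert.

(** * Hilbert-Schmidt sums over different families *)

Section HilbertSchmidtBound.
Context {R : realType}.

Lemma sum_CS (I : Type) (X : seq I) (u v : I -> R) :
  (\sum_(i <- X) u i * v i) ^+ 2 <= (\sum_(i <- X) u i ^+ 2) * (\sum_(i <- X) v i ^+ 2).
Proof.
elim: X => [|i X ih]; first by rewrite !big_nil mulr0 expr0n.
rewrite !big_cons; move: ih.
set A := \sum_(_ <- X) u _ ^+ 2; set B := \sum_(_ <- X) v _ ^+ 2; set C := \sum_(_ <- X) _.
have A0 : 0 <= A by apply: sumr_ge0 => k _; exact: sqr_ge0.
have B0 : 0 <= B by apply: sumr_ge0 => k _; exact: sqr_ge0.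
move: (u i) (v i) => p q h.
suff h2 : 2 * (C * (p * q)) <= A * q ^+ 2 + B * p ^+ 2 by nra.
rewrite (le_trans (ler_norm _))// -(@ler_pXn2r _ 2)// ?nnegrE ?normr_ge0//; last first.
  by rewrite addr_ge0// mulr_ge0// sqr_ge0.
rewrite real_normK ?num_real//.
have h1 : C ^+ 2 * (p * q) ^+ 2 <= A * B * (p * q) ^+ 2 by rewrite ler_wpM2r// sqr_ge0.
have := sqr_ge0 (A * q ^+ 2 - B * p ^+ 2); nra.
Qed.

Lemma hil_axioms (H : hilbertType R) : hilbert_axioms (hil H).
Proof.
split=> //=.
- by move=> a x y z _ _ _; rewrite dotDl dotZl.
- by move=> x y _ _; exact: dotC.
- by move=> x _; rewrite /sqnorm/= dot_rnorm sqr_ge0.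
- move=> u _ hu; have [|x hx] := @rcomplete _ H u.
    move=> e e0; have [|N hN] := hu (e ^+ 2); first by rewrite exprn_gt0.
    exists N => m n hm hn; have := hN _ _ hm hn; rewrite /sqnorm/= dot_rnorm/=.
    by rewrite ler_pXn2r// nnegrE ?rnorm_ge0// ltW.
  exists x => // e e0; have se : 0 < Num.sqrt e by rewrite sqrtr_gt0.
  have [N hN] := (rcvg_seqP _ _).1 hx _ se; exists N => n hn.
  rewrite /sqnorm/= dot_rnorm/= -[leRHS](sqr_sqrtr (ltW e0)).
  by rewrite ler_pXn2r ?nnegrE ?rnorm_ge0 ?hN// ltW.
Qed.

Lemma sqnorm_hil (H : hilbertType R) (x : H) : @sqnorm R (hil H) x = rnorm x ^+ 2.
Proof. by rewrite /sqnorm/= dot_rnorm. Qed.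

Lemma orthonormal_basis_family (E : hilbertRep R) (S : set E) : orthonormal_basis S ->
  orthonormal_family S id /\
  (forall x, rep_dom E x -> (forall e, S e -> rep_dot x e = 0) -> sqnorm x = 0).
Proof.
move=> [SE S1 S2 S3]; split=> //; split=> // e f Se Sf.
by case: eqVneq => [<-|]; [exact: S1|exact: S2].
Qed.

(** A maximal orthonormal set, from Zorn's lemma, is complete: a non-zero vector orthogonal to it
    could be normalised and added. *)
Lemma orthonormal_basis_exists (H : hilbertType R) :
  exists S : set (hil H), orthonormal_basis S.
Proof.
pose P : set (set (hil H)) := [set S | forall e f, S e -> S f -> dot (e : H) f = (e == f)%:R].
have [F FP Ftot|S [PS Smax]] := @Zorn_bigcup _ P.
  move=> e f [A FA Ae] [B FB Bf]; have [AB|BA] := Ftot _ _ FA FB.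
    by apply: (FP _ FB) => //; exact: AB.
  by apply: (FP _ FA) => //; exact: BA.
exists S; split => //= [e Se|e f Se Sf /negPf ef|x _ hx].
- by rewrite PS// eqxx.
- by rewrite PS// ef.
rewrite sqnorm_hil; apply/eqP; rewrite sqrf_eq0; apply/eqP; apply: contrapT => /eqP x0.
have nx0 : 0 < rnorm x by rewrite lt_def x0 rnorm_ge0.
pose y : H := ((rnorm x)^-1)%:C *: (x : H).
have yy : dot y y = 1.
  rewrite dot_rnorm rnormZ normc_real ger0_norm ?invr_ge0 ?rnorm_ge0//.
  by rewrite mulVf// expr1n.
have ye e : S e -> dot y e = 0 by move=> Se; rewrite dotZl hx// mulr0.
have ey e : S e -> dot (e : H) y = 0 by move=> Se; rewrite dotC ye// conjc0.
have yS : ~ S y.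
  by move=> Sy; have /eqP := ye _ Sy; rewrite yy oner_eq0.
apply: (Smax (S `|` [set y])).
  split; first by move=> e; left.
  by move=> h; apply: yS; apply: h; right.
move=> e f [Se|->] [Sf|->]; first exact: PS.
- by rewrite ey//; case: eqP => // ef; rewrite ef in Se.
- by rewrite ye//; case: eqP => // ef; rewrite -ef in Sf.
- by rewrite yy eqxx.
Qed.

Section Transfer.
Context {E : hilbertRep R} (hE : hilbert_axioms E) {F : hilbertType R}.
Variables (K : E -> F) (M : R).
Hypothesis K_lin : forall (a : R[i]) x y, rep_dom E x -> rep_dom E y ->
  K (a *: x + y) = a *: K x + K y.
Hypothesis M_ge0 : 0 <= M.
Hypothesis K_bounded : forall x, rep_dom E x -> rnorm (K x) ^+ 2 <= M * sqnorm x.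
Context {I J : choiceType} (S : set I) (b : I -> E) (D : set J) (g : J -> E) (c : R).
Hypothesis Sb : orthonormal_family S b.
Hypothesis b_complete : forall x, rep_dom E x ->
  (forall i, S i -> rep_dot x (b i) = 0) -> sqnorm x = 0.
Hypothesis g_dom : forall j, D j -> rep_dom E (g j).
Hypothesis c_gt0 : 0 < c.
Hypothesis g_bessel : forall (X : seq J) (a : J -> R[i]), uniq X -> (forall j, j \in X -> D j) ->
  sqnorm (\sum_(j <- X) a j *: g j) <= c * \sum_(j <- X) normc (a j) ^+ 2.

Let K0 : K 0 = 0.
Proof.
have /eqP := K_lin 1 (dom0 hE) (dom0 hE).
by rewrite !scale1r addr0 -{1}(addr0 (K 0)) (inj_eq (addrI _)) => /eqP <-.
Qed.

Let K_sum (L : eqType) (X : seq L) (a : L -> R[i]) (h : L -> E) :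
  (forall i, i \in X -> rep_dom E (h i)) ->
  K (\sum_(i <- X) a i *: h i) = \sum_(i <- X) a i *: K (h i).
Proof.
elim: X => [|i X ih] hX; first by rewrite !big_nil K0.
have hX' k : k \in X -> rep_dom E (h k) by move=> kX; apply: hX; rewrite inE kX orbT.
rewrite !big_cons K_lin ?ih//; first by apply: hX; rewrite mem_head.
exact: dom_sum.
Qed.

Let dot_sum (L : eqType) (X : seq L) (a : L -> R[i]) (h : L -> F) (w : F) :
  dot (\sum_(i <- X) a i *: h i) w = \sum_(i <- X) a i * dot (h i) w.
Proof.
elim: X => [|i X ih]; last by rewrite !big_cons dotDl dotZl ih.
by rewrite !big_nil -(scale0r 0) dotZl mul0r.
Qed.

(** On finite projections of [x] this is the Cauchy-Schwarz inequality; the bound [M] on [K] makes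
    the remaining part of [x] negligible. *)
Let functional_bound (w : F) (m : R) x : rep_dom E x ->
  (\esum_(i in S) (normc (dot (K (b i)) w) ^+ 2)%:E <= m%:E)%E ->
  normc (dot (K x) w) ^+ 2 <= m * sqnorm x.
Proof.
move=> dx hm.
have m0 : 0 <= m.
  by rewrite -lee_fin (le_trans _ hm)//; apply: esum_ge0 => i _; rewrite lee_fin sqr_ge0.
have x0 := rdot_ge0 hE dx.
have fin X : uniq X -> (forall i, i \in X -> S i) ->
    normc (dot (K (ortho_proj b X x)) w) ^+ 2 <= m * sqnorm x.
  move=> uX XS; rewrite /ortho_proj K_sum; last by move=> i /XS; exact: Sb.1.
  rewrite dot_sum; pose A := \sum_(i <- X) normc (rep_dot x (b i)) ^+ 2.
  pose B := \sum_(i <- X) normc (dot (K (b i)) w) ^+ 2.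
  have hA : A <= sqnorm x.
    rewrite -lee_fin (le_trans _ (bessel hE Sb dx))// -sumEFin.
    exact: esum_ge_seq.
  have hB : B <= m by rewrite -lee_fin (le_trans _ hm)// -sumEFin; exact: esum_ge_seq.
  have A0 : 0 <= A by apply: sumr_ge0 => i _; exact: sqr_ge0.
  have B0 : 0 <= B by apply: sumr_ge0 => i _; exact: sqr_ge0.
  have h1 : normc (\sum_(i <- X) rep_dot x (b i) * dot (K (b i)) w) <=
      \sum_(i <- X) normc (rep_dot x (b i)) * normc (dot (K (b i)) w).
    elim/big_rec2: _ => [|i u v _ huv]; first by rewrite normc0.
    by rewrite (le_trans (le_normcD _ _))// normcM lerD2l.
  have h2 : (\sum_(i <- X) normc (rep_dot x (b i)) * normc (dot (K (b i)) w)) ^+ 2 <= A * B.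
    exact: sum_CS.
  rewrite (@le_trans _ _ (A * B))//; last by rewrite mulrC ler_pM.
  apply: le_trans h2; rewrite ler_pXn2r ?nnegrE ?normc_ge0//.
  exact: le_trans (normc_ge0 _) h1.
have mx0 : 0 <= m * sqnorm x by rewrite mulr_ge0.
suff h : normc (dot (K x) w) <= Num.sqrt (m * sqnorm x).
  by rewrite -(sqr_sqrtr mx0) ler_pXn2r ?nnegrE ?normc_ge0 ?sqrtr_ge0.
apply: (@le_mul_eps _ _ _ (Num.sqrt M * rnorm w)).
  by rewrite mulr_ge0 ?sqrtr_ge0 ?rnorm_ge0.
move=> e e0; have e20 : 0 < e ^+ 2 by rewrite exprn_gt0.
have [X [uX XS hX]] := proj_approx hE Sb b_complete dx e20.
have dp : rep_dom E (ortho_proj b X x) by apply: (dom_proj hE Sb).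
have dd : rep_dom E (x - ortho_proj b X x) by exact: domB.
have -> : dot (K x) w = dot (K (ortho_proj b X x)) w + dot (K (x - ortho_proj b X x)) w.
  by rewrite -dotDl -{1}(subrK (ortho_proj b X x) x) -{1}[x - _]scale1r K_lin// scale1r addrC.
rewrite (le_trans (le_normcD _ _))// lerD//.
  have := fin X uX XS; rewrite -{1}(sqr_sqrtr mx0).
  by rewrite ler_pXn2r ?nnegrE ?normc_ge0 ?sqrtr_ge0.
rewrite (le_trans (dot_CS _ _))// mulrAC ler_wpM2r ?rnorm_ge0//.
rewrite -(@ler_pXn2r _ 2)// ?nnegrE ?rnorm_ge0 ?mulr_ge0 ?sqrtr_ge0 ?(ltW e0)//.
by rewrite exprMn sqr_sqrtr// (le_trans (K_bounded dd))// ler_wpM2l.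
Qed.

Let functional_bessel (w : F) :
  (\esum_(j in D) (normc (dot (K (g j)) w) ^+ 2)%:E <=
   c%:E * \esum_(i in S) (normc (dot (K (b i)) w) ^+ 2)%:E)%E.
Proof.
set m := esum S _; have m0 : (0 <= m)%E.
  by apply: esum_ge0 => i _; rewrite lee_fin sqr_ge0.
have [mfin|] := boolP (m \is a fin_num); last first.
  rewrite ge0_fin_numE// -leNgt leye_eq => /eqP ->.
  by rewrite gt0_muley ?leey// lte_fin.
apply: esum_le_seq => X uX XD; rewrite sumEFin -(fineK mfin) -EFinM lee_fin.
set s := \sum_(j <- X) _; have s0 : 0 <= s by apply: sumr_ge0 => j _; exact: sqr_ge0.
(* Conjugate values as coefficients: at the combination of the [g j] that they form, the functional
   equals [s], whence [s ^ 2] is at most [fine m * c * s]. *)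
pose a j := conjc (dot (K (g j)) w).
have dg j : j \in X -> rep_dom E (g j) by move=> /XD; exact: g_dom.
have := @functional_bound w (fine m) (\sum_(j <- X) a j *: g j) (dom_sum hE a dg).
rewrite fineK// => /(_ (lexx _)).
rewrite K_sum// dot_sum.
have -> : \sum_(j <- X) a j * dot (K (g j)) w = s%:C.
  rewrite rmorph_sum/=; apply: eq_bigr => j _.
  by rewrite /a mulrC -sqr_normc_conj normcE' rmorphXn.
rewrite normc_real ger0_norm// => h1.
have := g_bessel a uX XD.
have -> : \sum_(j <- X) normc (a j) ^+ 2 = s by apply: eq_bigr => j _; rewrite normc_conj.
move=> h2; have fm0 : 0 <= fine m by exact: fine_ge0.
have [->|sN0] := eqVneq s 0; first by rewrite mulr_ge0// ltW.
have sgt : 0 < s by rewrite lt_def sN0.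
have : s ^+ 2 <= fine m * (c * s) by rewrite (le_trans h1)// ler_wpM2l.
by rewrite expr2 mulrA ler_pM2r// [fine m * c]mulrC.
Qed.

(* For w in F the functional x |-> <K x, w> is bounded by its values on the basis
   b, so g_bessel bounds its values on g; then sum over an orthonormal basis of
   w. *)
Lemma hilbert_schmidt_transfer :
  (\esum_(j in D) (rnorm (K (g j)) ^+ 2)%:E <=
   c%:E * \esum_(i in S) (rnorm (K (b i)) ^+ 2)%:E)%E.
Proof.
have [W /orthonormal_basis_family[Wb W_complete]] := orthonormal_basis_exists F.
have pars (x : F) : ((rnorm x ^+ 2)%:E = \esum_(w in W) (normc (dot x (w : F)) ^+ 2)%:E)%E.
  by rewrite (parseval (hil_axioms F) Wb W_complete) ?sqnorm_hil.
under eq_esum do rewrite pars.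
apply: (le_trans (esum_swap _)) => [j w _ _|]; first by rewrite lee_fin sqr_ge0.
apply: (le_trans (le_esum (fun w _ => functional_bessel w))).
apply: (le_trans (esum_scale (ltW c_gt0) _)).
  by move=> w _; apply: esum_ge0 => i _; rewrite lee_fin sqr_ge0.
apply: lee_wpmul2l; first by rewrite lee_fin ltW.
apply: (le_trans (esum_swap _)) => [w i _ _|]; first by rewrite lee_fin sqr_ge0.
by apply: le_esum => i _; rewrite -pars.
Qed.

End Transfer.

(** Supplies the hypothesis [g_bessel] of the transfer for the image of an orthonormal family under
    an operator with squared bound [c]. *)
Lemma orthonormal_bessel (E : hilbertRep R) (hE : hilbert_axioms E) (J : choiceType)
    (D : set J) (b : J -> E) (N : E -> E) (c : R) :
  orthonormal_family D b ->
  (forall (a : R[i]) x y, N (a *: x + y) = a *: N x + N y) ->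
  (forall x, rep_dom E x -> sqnorm (N x) <= c * sqnorm x) ->
  forall (X : seq J) (a : J -> R[i]), uniq X -> (forall j, j \in X -> D j) ->
    sqnorm (\sum_(j <- X) a j *: N (b j)) <= c * \sum_(j <- X) normc (a j) ^+ 2.
Proof.
move=> Db Nl Nc X a uX XD.
have N0 : N 0 = 0.
  have /eqP := Nl 1 0 0.
  by rewrite !scale1r addr0 -{1}(addr0 (N 0)) (inj_eq (addrI _)) => /eqP <-.
have -> : \sum_(j <- X) a j *: N (b j) = N (\sum_(j <- X) a j *: b j).
  elim: (X) => [|j Y ih]; first by rewrite !big_nil.
  by rewrite !big_cons Nl ih.
rewrite -(orthonormal_sqnorm hE Db)// Nc//.
by apply: dom_sum => // j /XD; exact: Db.1.
Qed.

End HilbertSchmidtBound.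

(** * The space L^2 *)

Lemma Rint_lin (R : realType) (T c : R) (k l : R -> R) :
  (@lebesgue_measure R).-integrable `[0, T] (EFin \o k) ->
  (@lebesgue_measure R).-integrable `[0, T] (EFin \o l) ->
  (@lebesgue_measure R).-integrable `[0, T] (EFin \o (fun t => c * k t + l t)) /\
  \int[@lebesgue_measure R]_(t in `[0, T]) (c * k t + l t) =
  c * (\int[@lebesgue_measure R]_(t in `[0, T]) k t) +
  \int[@lebesgue_measure R]_(t in `[0, T]) l t.
Proof.
move=> ik il.
have ick : (@lebesgue_measure R).-integrable `[0, T] (EFin \o (fun t => c * k t)).
  by apply: (@eq_integrable _ _ _ (@lebesgue_measure R) _ (measurable_itv _) (fun t => c%:E * (EFin \o k) t)%E) => //; exact: integrableZl.
split; last by rewrite RintegralD// RintegralZl.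
by apply: (@eq_integrable _ _ _ (@lebesgue_measure R) _ (measurable_itv _) (fun t => (c * k t)%R%:E + (EFin \o l) t)%E) => //; exact: integrableD.
Qed.

Section L2Space.
Context {R : realType} {Y : hilbertType R}.
Variable T : R.
Local Notation mu := (@lebesgue_measure R).
Local Notation nint g := (\int[mu]_(t in `[0%R, T]) (g t)%:E)%E.
Implicit Types f g h : R -> Y.

Lemma L2_sqnorm f : L2_dom T f -> ((@sqnorm R (L2 T Y) f)%:E = nint (fun t => rnorm (f t) ^+ 2))%E.
Proof.
move=> [mf intf]; rewrite /sqnorm/= /Rintegral.
have -> : (\int[mu]_(t in `[0%R, T]) (complex.Re (dot (f t) (f t)))%:E)%E =
    nint (fun t => rnorm (f t) ^+ 2).
  by apply: eq_integral => t _; rewrite dot_rnorm.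
by rewrite fineK// ge0_fin_numE// nint_ge0// => t _; exact: sqr_ge0.
Qed.

Lemma measurable_sqnorm f : strongly_measurable T f ->
  measurable_fun `[0, T] (fun t => rnorm (f t) ^+ 2).
Proof. by move=> mf; apply: measurable_funX; exact: strongly_measurable_norm. Qed.

Lemma L2_dominated f (h : R -> R) : strongly_measurable T f -> measurable_fun `[0, T] h ->
  (forall t, t \in `[0, T] -> rnorm (f t) ^+ 2 <= h t) -> (nint h < +oo)%E -> L2_dom T f.
Proof.
move=> mf mh fh inth; split=> //; apply: le_lt_trans inth.
apply: nint_le => //; first exact: measurable_sqnorm.
by move=> t tT; rewrite sqr_ge0 fh.
Qed.

Lemma L2_lin (a : R[i]) f g : L2_dom T f -> L2_dom T g -> L2_dom T (a *: f + g).
Proof.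
move=> [mf intf] [mg intg]; have m1 := measurable_sqnorm mf; have m2 := measurable_sqnorm mg.
apply: (@L2_dominated _ (fun t => (2 * normc a ^+ 2) * rnorm (f t) ^+ 2 + 2 * rnorm (g t) ^+ 2)).
- exact: (strongly_measurable_lin a mf mg).
- by apply: measurable_funD; exact: measurable_funM.
- move=> t _; rewrite (le_trans (rnorm_sqr_le _ _))// rnormZ exprMn.
  by rewrite mulrA.
- rewrite nintD; last 4 first.
  + exact: measurable_funM.
  + exact: measurable_funM.
  + by move=> t _; do ?[apply: mulr_ge0]; rewrite ?normc_ge0 ?rnorm_ge0.
  + by move=> t _; rewrite mulr_ge0// sqr_ge0.
  rewrite !nintZ//; last 3 first.
  + by move=> t _; rewrite sqr_ge0.
  + by move=> t _; rewrite sqr_ge0.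
  + by rewrite mulr_ge0// sqr_ge0.
  by rewrite lte_add_pinfty// lte_mul_pinfty// lee_fin// mulr_ge0// sqr_ge0.
Qed.

Lemma L2_cst0 : L2_dom T (0 : R -> Y).
Proof.
split; first exact: strongly_measurable_cst.
under eq_integral do rewrite rnorm0 expr0n/=.
by rewrite integral0.
Qed.

Lemma L2_integrable_rdot f g : L2_dom T f -> L2_dom T g ->
  mu.-integrable `[0, T] (EFin \o (fun t => rdot (f t) (g t))).
Proof.
move=> [mf intf] [mg intg]; have m1 := measurable_sqnorm mf; have m2 := measurable_sqnorm mg.
apply: (@integrable_dominated _ _ _ (fun t => rnorm (f t) ^+ 2 + rnorm (g t) ^+ 2)).
- exact: measurable_rdot.
- exact: measurable_funD.
- move=> t _; rewrite (le_trans (rdot_CS _ _))//.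
  have := sqr_ge0 (rnorm (f t) - rnorm (g t)).
  have := sqr_ge0 (rnorm (f t)); have := sqr_ge0 (rnorm (g t)); nra.
- rewrite nintD//; last 2 first.
  + by move=> t _; exact: sqr_ge0.
  + by move=> t _; exact: sqr_ge0.
  exact: lte_add_pinfty.
Qed.

Lemma L2_scale_i g : L2_dom T g -> L2_dom T (fun t => 'i *: g t).
Proof.
move=> dg; have := L2_lin 'i dg L2_cst0.
by rewrite (_ : _ + _ = fun t => 'i *: g t)//; apply/funext => t; rewrite /= addr0.
Qed.

Lemma L2_integrable_Im f g : L2_dom T f -> L2_dom T g ->
  mu.-integrable `[0, T] (EFin \o (fun t => complex.Im (dot (f t) (g t)))).
Proof.
move=> df dg; rewrite (_ : (fun t => _) = fun t => rdot (f t) ('i *: g t)).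
  exact: (L2_integrable_rdot df (L2_scale_i dg)).
by apply/funext => t; rewrite Im_dot.
Qed.

Lemma Re_L2_dot f g : complex.Re (L2_dot T f g) = \int[mu]_(t in `[0, T]) rdot (f t) (g t).
Proof. by []. Qed.

Lemma L2_dot_lin (a : R[i]) f g h : L2_dom T f -> L2_dom T g -> L2_dom T h ->
  L2_dot T (a *: f + g) h = a * L2_dot T f h + L2_dot T g h.
Proof.
move=> df dg dh; case: a => u v.
have i1 := L2_integrable_rdot df dh; have i2 := L2_integrable_rdot dg dh.
have j1 := L2_integrable_Im df dh; have j2 := L2_integrable_Im dg dh.
have k1 := Rint_lin (- v) j1 i2; have k2 := Rint_lin v i1 j2.
rewrite /L2_dot; apply/eqP; rewrite eq_complex /=; apply/andP; split; apply/eqP.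
- rewrite -addrA -mulNr -k1.2 -(Rint_lin u i1 k1.1).2.
  apply: eq_Rintegral => t _; rewrite /rdot dotDl dotZl.
  by case: (dot (f t) (h t)) (dot (g t) (h t)) => [? ?] [? ?] /=; ring.
- rewrite -addrA -k2.2 -(Rint_lin u j1 k2.1).2.
  apply: eq_Rintegral => t _; rewrite /rdot dotDl dotZl.
  by case: (dot (f t) (h t)) (dot (g t) (h t)) => [? ?] [? ?] /=; ring.
Qed.

Lemma L2_dotC f g : L2_dom T f -> L2_dom T g -> L2_dot T f g = conjc (L2_dot T g f).
Proof.
move=> df dg; rewrite /L2_dot /=; congr Complex.
  by apply: eq_Rintegral => t _; rewrite dotC; case: (dot (g t) (f t)).
have /RintegralZl-/(_ (-1) (measurable_itv _)) := L2_integrable_Im dg df.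
rewrite mulN1r => <-; apply: eq_Rintegral => t _.
by rewrite dotC mulN1r; case: (dot (g t) (f t)).
Qed.

Lemma L2_strongly_measurable_if (G : set R) f : separable Y -> measurable G ->
  strongly_measurable T f -> strongly_measurable T (fun t => if t \in G then f t else 0).
Proof.
move=> sY mG mf; apply/strongly_measurableP => // v.
rewrite (_ : (fun t => _) = fun t => if t \in G then rnorm (f t - v) else rnorm (0 - v)); last first.
  by apply/funext => t; case: ifP.
apply: measurable_fun_if => //.
- by apply: (measurable_fun_bool true); rewrite preimage_mem_true; exact: measurableI.
- by apply: (measurable_funS (E := `[0, T])) => //; exact: strongly_measurable_dist.
Qed.

End L2Space.

(** * Completeness of L^2 *)

Section L2Complete.
Context {R : realType} {Y : hilbertType R}.
Variables (T : R) (sY : separable Y).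
Local Notation mu := (@lebesgue_measure R).
Local Notation nint g := (\int[mu]_(t in `[0%R, T]) (g t)%:E)%E.
Local Notation sq f := (@sqnorm R (L2 T Y) f).

(* Along a subsequence v with |v_(k+1) - v_k|^2 <= 16^-k the weighted sum
   h := sum_k 4^k |v_(k+1)(t) - v_k(t)|^2 is integrable, and it dominates
   4^k |f - v_k|^2 / 4 for the pointwise limit f. *)
Lemma L2_fast_cvg (v : nat -> R -> Y) : (forall k, L2_dom T (v k)) ->
  (forall k, sq (v k.+1 - v k) <= (16 ^+ k)^-1) ->
  exists2 f, L2_dom T f & forall k, sq (f - v k) <= 8 / 4 ^+ k.
Proof.
move=> dv hv.
have dB (f g : R -> Y) : L2_dom T f -> L2_dom T g -> L2_dom T (f - g).
  by move=> df dg; rewrite addrC -scaleN1r; exact: L2_lin.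
pose a k t : R := 4 ^+ k * rnorm (v k.+1 t - v k t) ^+ 2.
have a0 k t : 0 <= a k t by apply: mulr_ge0; [exact: exprn_ge0|exact: sqr_ge0].
have ma k : measurable_fun `[0, T] (a k).
  by apply: measurable_funM => //; apply: measurable_sqnorm; exact: (dB _ _ (dv _) (dv _)).1.
pose h t := (\sum_(0 <= k <oo) (a k t)%:E)%E.
have h0 t : (0 <= h t)%E by apply: nneseries_ge0 => k _ _; rewrite lee_fin.
have mh : measurable_fun `[0, T] h.
  apply: ge0_emeasurable_sum => [k t _ _|k _]; first by rewrite lee_fin.
  exact/measurable_EFinP.
have inth : (\int[mu]_(t in `[0%R, T]) h t <= 2%:E)%E.
  rewrite /h integral_nneseries//; last 2 first.
  - by move=> k; apply/measurable_EFinP; exact: ma.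
  - by move=> k t _; rewrite lee_fin.
  apply: lime_le.
    by apply: is_cvg_nneseries => k _ _; apply: integral_ge0 => t _; rewrite lee_fin.
  apply: nearW => n.
  apply: (@le_trans _ _ (\sum_(0 <= k < n) (2^-1 ^+ k)%:E)%E).
    apply: lee_sum => k _; rewrite nintZ//; last 2 first.
    - by apply: measurable_sqnorm; exact: (dB _ _ (dv _) (dv _)).1.
    - by move=> t _; exact: sqr_ge0.
    have -> : nint (fun t => rnorm (v k.+1 t - v k t) ^+ 2) = (sq (v k.+1 - v k))%:E.
      by rewrite (L2_sqnorm (dB _ _ (dv _) (dv _))).
    rewrite -EFinM lee_fin (le_trans (ler_wpM2l _ (hv k))) ?exprn_ge0//.
    rewrite -exprVn -exprMn; apply: lerXn2r; rewrite ?nnegrE//; lra.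
  rewrite sumEFin lee_fin big_mkord.
  suff -> : \sum_(i < n) 2^-1 ^+ i = 2 - 2 * 2^-1 ^+ n :> R by rewrite gerBl mulr_ge0 ?exprn_ge0.
  by elim: (n) => [|m ih]; rewrite ?big_ord0 ?big_ord_recr/= ?ih ?exprS; lra.
have d_le t k : (h t < +oo)%E ->
    rnorm (v k.+1 t - v k t) <= Num.sqrt (fine (h t)) * 2^-1 ^+ k.
  move=> ht; have hfin : h t \is a fin_num by rewrite ge0_fin_numE.
  have C0 : 0 <= fine (h t) by exact: fine_ge0.
  have ak : a k t <= fine (h t).
    rewrite -lee_fin fineK//.
    have : (\sum_(0 <= i < k.+1) (a i t)%:E <= h t)%E.
      by apply: nneseries_lim_ge => i _ _; rewrite lee_fin.
    rewrite sumEFin; apply: le_trans.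
    rewrite lee_fin big_nat_recr//= lerDr; apply: sumr_ge0 => i _; exact: a0.
  rewrite -(@ler_pXn2r _ 2)// ?nnegrE ?rnorm_ge0 ?mulr_ge0 ?sqrtr_ge0 ?exprn_ge0//.
  rewrite exprMn sqr_sqrtr// -exprM mulnC exprM exprVn -natrX.
  rewrite exprVn -ler_pdivrMr ?invr_gt0 ?exprn_gt0// invrK mulrC.
  exact: ak.
have tail t k m : (h t < +oo)%E ->
    rnorm (v (k + m)%N t - v k t) <= Num.sqrt (fine (h t)) * 2^-1 ^+ k * (2 - 2 * 2^-1 ^+ m).
  move=> ht; elim: m => [|m ih].
    by rewrite addn0 subrr rnorm0 expr0 mulr1 subrr mulr0.
  rewrite (le_trans (rdistD (v (k + m)%N t) _ _))//.
  rewrite addnS (le_trans (lerD (d_le t (k + m)%N ht) ih))//.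
  rewrite exprD exprS; set s := Num.sqrt _; set p := _ ^+ k; set q := _ ^+ m.
  by rewrite le_eqVlt; apply/orP; left; apply/eqP; field.
have tail2 t k m : (h t < +oo)%E ->
    rnorm (v (k + m)%N t - v k t) <= Num.sqrt (fine (h t)) * 2^-1 ^+ k * 2.
  move=> ht; rewrite (le_trans (tail t k m ht))// ler_wpM2l ?mulr_ge0 ?sqrtr_ge0 ?exprn_ge0//.
  by rewrite gerBl mulr_ge0 ?exprn_ge0.
have small (c e : R) : 0 <= c -> 0 < e -> exists N, c * 2^-1 ^+ N <= e.
  move=> c0 e0; exists (Num.truncn (c / e)).
  rewrite exprVn ler_pdivrMr ?exprn_gt0// mulrC -ler_pdivrMr//.
  rewrite (le_trans (ltW (truncnS_gt _)))// -natrX ler_nat.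
  exact: ltn_expl.
have /choice[F hF] t : exists y : Y, (h t < +oo)%E -> v k t @[k --> \oo] --> y.
  have [ht|_] := boolP (h t < +oo)%E; last by exists 0.
  have [e e0|y hy] := @rcomplete _ Y (fun k => v k t); last by exists y.
  have [|N hN] := small (Num.sqrt (fine (h t)) * 4) e _ e0.
    by rewrite mulr_ge0 ?sqrtr_ge0.
  exists N => m n hm hn; rewrite (le_trans (rdistD (v N t) _ _))//.
  rewrite (rdistC (v N t)) -(subnKC hm) -(subnKC hn).
  by rewrite (le_trans (lerD (tail2 t N _ ht) (tail2 t N _ ht)))//; move: hN; lra.
(* Strong measurability demands convergence at every point of [0, T], so the sequence and its limit
   are both set to 0 where [h] is infinite. *)
pose G := `[0, T] `&` [set t | (h t < +oo)%E].
have mG : measurable G by apply: emeasurable_fun_infty_o.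
pose f t := if t \in G then F t else 0.
have mf : strongly_measurable T f.
  apply: (@strongly_measurable_lim _ _ _ (fun k t => if t \in G then v k t else 0)) => //.
    by move=> k; apply: L2_strongly_measurable_if => //; exact: (dv k).1.
  move=> t tT; rewrite /f; case: ifPn => tG; last exact: cvg_cst.
  by apply: hF; move: tG; rewrite inE => -[].
have f_le t k : t \in G -> rnorm (f t - v k t) ^+ 2 <= 4 / 4 ^+ k * fine (h t).
  move=> tG; rewrite /f tG; move: tG; rewrite inE => -[_ ht].
  have C0 : 0 <= fine (h t) by exact: fine_ge0.
  have h1 : rnorm (F t - v k t) <= Num.sqrt (fine (h t)) * 2^-1 ^+ k * 2.
    apply: (@le_mul_eps _ _ _ 1) => // e e0; rewrite mul1r.
    have [N hN] := (rcvg_seqP _ _).1 (hF t ht) _ e0.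
    rewrite (le_trans (rdistD (v (k + N)%N t) _ _))// addrC lerD ?tail2//.
    by rewrite rdistC hN// leq_addl.
  rewrite -(@ler_pXn2r _ 2) ?nnegrE ?rnorm_ge0 ?mulr_ge0 ?sqrtr_ge0 ?exprn_ge0// in h1.
  have e4 : (2^-1 ^+ k) ^+ 2 = (4 ^+ k)^-1 :> R.
    by rewrite -exprM mulnC exprM exprVn (_ : 2 ^+ 2 = 4) ?exprVn//; ring.
  rewrite (le_trans h1)// !exprMn sqr_sqrtr// e4.
  by rewrite le_eqVlt; apply/orP; left; apply/eqP; ring.
have mfv k : strongly_measurable T (f - v k).
  have := strongly_measurable_lin (-1) (dv k).1 mf.
  by rewrite (_ : (fun t => _) = f - v k)//; apply/funext => t; rewrite scaleN1r addrC.
have intfv k : (nint (fun t => rnorm ((f - v k) t) ^+ 2) <= (8 / 4 ^+ k)%:E)%E.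
  have p0 : 0 < 4 / 4 ^+ k :> R by rewrite divr_gt0 ?exprn_gt0.
  apply: (@le_trans _ _ (\int[mu]_(t in `[0%R, T]) ((4 / 4 ^+ k)%:E * h t))%E).
    apply: ge0_le_integral => //.
    - by move=> t _; rewrite lee_fin sqr_ge0.
    - by apply/measurable_EFinP; exact: measurable_sqnorm.
    - exact: measurable_funeM.
    - move=> t tT; have [ht|] := boolP (h t < +oo)%E.
        rewrite -(@fineK _ (h t)) ?ge0_fin_numE// -EFinM lee_fin.
        by apply: f_le; rewrite inE; split.
      by rewrite -leNgt leye_eq => /eqP ->; rewrite gt0_muley ?leey// lte_fin.
  rewrite ge0_integralZl ?lee_fin ?(ltW p0)//.
  have p0' : (0 <= (4 / 4 ^+ k : R)%:E)%E by rewrite lee_fin ltW.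
  rewrite (le_trans (lee_wpmul2l p0' inth))// -EFinM lee_fin.
  by rewrite mulrAC -natrM.
have dfv k : L2_dom T (f - v k).
  by split; [exact: mfv|exact: le_lt_trans (intfv k) (ltry _)].
exists f => [|k]; last by rewrite -lee_fin L2_sqnorm.
by have := L2_lin 1 (dfv 0%N) (dv 0%N); rewrite scale1r subrK.
Qed.

Lemma L2_axioms : hilbert_axioms (L2 T Y).
Proof.
have dB (f g : R -> Y) : L2_dom T f -> L2_dom T g -> L2_dom T (f - g).
  by move=> df dg; rewrite addrC -scaleN1r; exact: L2_lin.
split => /=.
- exact: L2_cst0.
- by move=> a f g; exact: L2_lin.
- by move=> a f g h; exact: L2_dot_lin.
- by move=> f g; exact: L2_dotC.
- by move=> f df; rewrite -lee_fin L2_sqnorm// nint_ge0// => t _; exact: sqr_ge0.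
move=> u du hu.
have tri (f g h : R -> Y) : L2_dom T f -> L2_dom T g -> L2_dom T h ->
    sq (f - h) <= 2 * sq (f - g) + 2 * sq (g - h).
  move=> df dg dh; have d1 := dB _ _ df dg; have d2 := dB _ _ dg dh; have d3 := dB _ _ df dh.
  have m1 := measurable_sqnorm d1.1; have m2 := measurable_sqnorm d2.1.
  have z (k : R -> Y) t : 0 <= rnorm (k t) ^+ 2 by exact: sqr_ge0.
  rewrite -lee_fin L2_sqnorm// EFinD !EFinM !L2_sqnorm// -!nintZ//.
  rewrite -nintD; last 4 first.
  - exact: measurable_funM.
  - exact: measurable_funM.
  - by move=> t _; rewrite mulr_ge0.
  - by move=> t _; rewrite mulr_ge0.
  apply: nint_le.
  - exact: measurable_sqnorm d3.1.
  - by apply: measurable_funD; exact: measurable_funM.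
  - move=> t _; rewrite z/= (le_trans _ (rnorm_sqr_le _ _))//.
    by rewrite /= addrA subrK.
have /choice[N hN] k : exists N, forall m n, (N <= m)%N -> (N <= n)%N ->
    sq (u m - u n) <= (16 ^+ k)^-1.
  by apply: hu; rewrite invr_gt0 exprn_gt0.
(* Partial sums make the indices monotone while keeping [n k] above [N k]. *)
pose n k := (\sum_(i < k.+1) N i)%N.
have Nn k : (N k <= n k)%N by rewrite /n big_ord_recr/= leq_addl.
have nS k : (n k <= n k.+1)%N by rewrite /n [leqRHS]big_ord_recr/= leq_addr.
have [//||f df hf] := @L2_fast_cvg (fun k => u (n k)).
  by move=> k; apply: hN => //; exact: leq_trans (Nn k) (nS k).
exists f => // e e0.
(* With [4 ^ K] at least [32 / e], the distance from [u m] to [u (n K)] and that from there to [f]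
   contribute at most [e / 2] each, after doubling. *)
have [K hK] : exists K, 32 / e <= 4 ^+ K.
  exists (Num.truncn (32 / e)); rewrite (le_trans (ltW (truncnS_gt _)))// -natrX ler_nat.
  exact: ltn_expl.
have hK2 : 16 / 4 ^+ K <= e / 2.
  by rewrite ler_pdivrMr ?exprn_gt0//; move: hK; rewrite ler_pdivrMr// mulrC; lra.
have hK1 : 2 * (16 ^+ K)^-1 <= e / 2.
  apply: le_trans hK2; apply: ler_pM => //; first by rewrite ler_nat.
  by rewrite lef_pV2 ?posrE ?exprn_gt0// lerXn2r ?nnegrE// ler_nat.
exists (n K) => m hm.
have := tri _ _ _ (du m) (du (n K)) df.
have h1 : sq (u m - u (n K)) <= (16 ^+ K)^-1.
  by apply: hN => //; exact: leq_trans (Nn K) hm.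
have h2 := hf K.
have -> : sq (u (n K) - f) = sq (f - u (n K)).
  by rewrite /sqnorm/=; apply: eq_Rintegral => t _; rewrite !dot_rnorm/= rdistC.
lra.
Qed.

End L2Complete.

(** * Fourier series *)

Section Cis.
Context {R : realType}.
Implicit Types x y : R.

Definition cis x : R[i] := cos x +i* sin x.

Lemma cisD x y : cis (x + y) = cis x * cis y.
Proof. by rewrite /cis cosD sinD; simpc; congr Complex; ring. Qed.

Lemma cis0 : cis 0 = 1.
Proof. by rewrite /cis cos0 sin0. Qed.

Lemma conjc_cis x : conjc (cis x) = cis (- x).
Proof. by rewrite /cis cosN sinN. Qed.

Lemma normc_cis x : normc (cis x) = 1.
Proof. by rewrite /cis /normc cos2Dsin2 sqrtr1. Qed.

Lemma cis_2pi (n : int) : cis (2 * pi * n%:~R) = 1.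
Proof.
have c1 : cis (2 * pi) = 1 by rewrite /cis mulrC mulr_natr cos2pi sin2pi.
have cn (m : nat) : cis (2 * pi * m%:R) = 1.
  elim: m => [|m ih]; first by rewrite mulr0 cis0.
  have -> : 2 * pi * m.+1%:R = 2 * pi * m%:R + 2 * pi :> R by rewrite -natr1; ring.
  by rewrite cisD ih c1 mulr1.
case: n => m; first exact: cn.
by rewrite NegzE mulrNz mulrN -conjc_cis cn conjc1.
Qed.

End Cis.

Section Scalars.
Context {R : realType}.
Variable T : R.
Implicit Types h : R -> R[i].

Definition scalar_continuous h :=
  continuous (fun t => complex.Re (h t)) /\ continuous (fun t => complex.Im (h t)).

Lemma normc_le_ReIm (a : R[i]) : normc a <= `|complex.Re a| + `|complex.Im a|.
Proof.
rewrite -(@ler_pXn2r _ 2)// ?nnegrE ?normc_ge0 ?addr_ge0// normc_sqr.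
rewrite sqrrD !real_normK ?num_real// -addrA lerD2l lerDr.
by rewrite mulrn_wge0// mulr_ge0.
Qed.

Lemma scalar_continuous_on {V : normedModType R[i]} h (v : V) :
  scalar_continuous h -> continuous_on T (fun t => h t *: v).
Proof.
move=> [c1 c2] t _ e e0.
pose d := e / (2 * (rnorm v + 1)).
have d0 : 0 < d by rewrite divr_gt0// mulr_gt0// ltr_wpDl ?rnorm_ge0.
have /cvgrPdist_le/(_ _ d0)/nbhs_ballP[r1 r10 h1] := c1 t.
have /cvgrPdist_le/(_ _ d0)/nbhs_ballP[r2 r20 h2] := c2 t.
exists (Num.min r1 r2) => [|s _]; first by rewrite lt_min; apply/andP.
rewrite lt_min => /andP[s1 s2].
have a1 := h1 s; have a2 := h2 s.
rewrite -scalerBl rnormZ (@le_trans _ _ ((d + d) * rnorm v))//.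
  apply: ler_wpM2r; first exact: rnorm_ge0.
  rewrite (le_trans (normc_le_ReIm _))//; apply: lerD.
    rewrite (_ : complex.Re _ = complex.Re (h s) - complex.Re (h t)); last by case: (h s) (h t) => ? ? [].
    by rewrite distrC; apply: a1; rewrite /ball/= distrC.
  rewrite (_ : complex.Im _ = complex.Im (h s) - complex.Im (h t)); last by case: (h s) (h t) => ? ? [].
  by rewrite distrC; apply: a2; rewrite /ball/= distrC.
have v1 : 0 < rnorm v + 1 by rewrite ltr_wpDl ?rnorm_ge0.
have -> : (d + d) * rnorm v = e * (rnorm v / (rnorm v + 1)).
  by rewrite /d; field; rewrite gt_eqF.
by rewrite ger_pMr// ler_pdivrMr// mul1r lerDl.
Qed.

Lemma scalar_op_family {V : normedModType R[i]} h : scalar_continuous h ->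
  op_family T (fun t (v : V) => h t *: v).
Proof.
move=> hc; split=> [t _|v]; last exact: scalar_continuous_on.
split; first by move=> a x y; rewrite scalerDr !scalerA mulrC.
by exists (normc (h t)) => x; rewrite rnormZ.
Qed.

Lemma L2_scalar {Y : hilbertType R} h (M : R) (f : R -> Y) : separable Y ->
  scalar_continuous h -> (forall t, t \in `[0, T] -> normc (h t) <= M) -> L2_dom T f ->
  L2_dom T (fun t => h t *: f t) /\
  @sqnorm R (L2 T Y) (fun t => h t *: f t) <= M ^+ 2 * @sqnorm R (L2 T Y) f.
Proof.
move=> sY hc hM df.
have mf : strongly_measurable T (fun t => h t *: f t).
  by apply: (@strongly_measurable_op _ _ _ T (fun t (v : Y) => h t *: v)) => //; [exact: scalar_op_family|exact: df.1].
have m1 := measurable_sqnorm mf; have m2 := measurable_sqnorm df.1.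
have hle t : t \in `[0, T] -> rnorm (h t *: f t) ^+ 2 <= M ^+ 2 * rnorm (f t) ^+ 2.
  move=> tT; rewrite rnormZ exprMn ler_wpM2r ?sqr_ge0// lerXn2r ?nnegrE ?normc_ge0 ?hM//.
  exact: le_trans (normc_ge0 _) (hM _ tT).
have h2 : (\int[@lebesgue_measure R]_(t in `[0%R, T]) (rnorm (h t *: f t) ^+ 2)%:E <=
   (M ^+ 2)%:E * \int[@lebesgue_measure R]_(t in `[0%R, T]) (rnorm (f t) ^+ 2)%:E)%E.
  rewrite -nintZ ?sqr_ge0//; last by move=> t _; exact: sqr_ge0.
  apply: nint_le => //; first exact: measurable_funM.
  by move=> t tT; rewrite sqr_ge0 hle.
have d : L2_dom T (fun t => h t *: f t).
  split=> //; apply: le_lt_trans h2 _; rewrite -L2_sqnorm// -EFinM; exact: ltry.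
by split=> //; rewrite -lee_fin EFinM !L2_sqnorm.
Qed.

End Scalars.

Lemma complex_integral_scale (R : realType) (T : R) (a : R[i]) (phi : R -> R[i]) :
  (@lebesgue_measure R).-integrable `[0, T] (EFin \o (fun t => complex.Re (phi t))) ->
  (@lebesgue_measure R).-integrable `[0, T] (EFin \o (fun t => complex.Im (phi t))) ->
  (\int[@lebesgue_measure R]_(t in `[0, T]) complex.Re (a * phi t)) +i*
  (\int[@lebesgue_measure R]_(t in `[0, T]) complex.Im (a * phi t)) =
  a * ((\int[@lebesgue_measure R]_(t in `[0, T]) complex.Re (phi t)) +i*
       (\int[@lebesgue_measure R]_(t in `[0, T]) complex.Im (phi t))).
Proof.
case: a => u v i1 i2.
have iz : (@lebesgue_measure R).-integrable `[0, T] (EFin \o (fun=> 0 : R)).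
  exact: integrable0.
have z : \int[@lebesgue_measure R]_(t in `[0, T]) (0 : R) = 0 by rewrite /Rintegral integral0.
have [k1 e1] := Rint_lin (- v) i2 iz; have [k2 e2] := Rint_lin v i1 iz.
rewrite z !addr0 in e1 e2.
simpc; congr Complex.
- rewrite -mulNr -e1 -(Rint_lin u i1 k1).2; apply: eq_Rintegral => t _.
  by case: (phi t) => ? ? /=; rewrite addr0 mulNr.
- rewrite -e2 -(Rint_lin u i2 k2).2; apply: eq_Rintegral => t _.
  by case: (phi t) => ? ? /=; rewrite addr0.
Qed.

Section Fourier.
Context {R : realType}.
Variables (T : R) (T0 : 0 < T).
Local Notation mu := (@lebesgue_measure R).

Definition fourier (n : int) (t : R) : R[i] := cis (2 * pi * n%:~R / T * t).

Lemma fourierD n m t : fourier (n + m) t = fourier n t * fourier m t.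
Proof. by rewrite /fourier -cisD -!mulrDl -mulrDr intrD. Qed.

Lemma conjc_fourier n t : conjc (fourier n t) = fourier (- n) t.
Proof. by rewrite conjc_cis /fourier mulrNz mulrN !mulNr. Qed.

Lemma scalar_continuous_fourier n : scalar_continuous (fourier n).
Proof.
have cm : continuous (fun t : R => 2 * pi * n%:~R / T * t).
  by move=> t; apply: cvgM; [exact: cvg_cst|exact: cvg_id].
split=> t; rewrite /fourier /cis /=.
  by apply: (continuous_comp (cm t)); exact: continuous_cos.
by apply: (continuous_comp (cm t)); exact: continuous_sin.
Qed.

Let Rint_cos_sin (c : R) : c != 0 -> cis (c * T) = 1 ->
  \int[mu]_(t in `[0, T]) cos (c * t) = 0 /\ \int[mu]_(t in `[0, T]) sin (c * t) = 0.
Proof.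
move=> c0 cT; have [cosT sinT] : cos (c * T) = 1 /\ sin (c * T) = 0 by case: cT.
have cm : continuous (fun t : R => c * t).
  by move=> t; apply: cvgM; [exact: cvg_cst|exact: cvg_id].
have cc : continuous (fun t => cos (c * t)).
  by move=> t; apply: (continuous_comp (cm t)); exact: continuous_cos.
have cs : continuous (fun t => sin (c * t)).
  by move=> t; apply: (continuous_comp (cm t)); exact: continuous_sin.
have d1 (t : R) : is_derive t 1 (fun t => c^-1 * sin (c * t)) (cos (c * t)).
  by apply: is_derive_eq; rewrite /GRing.scale/=; field.
have d2 (t : R) : is_derive t 1 (fun t => - c^-1 * cos (c * t)) (sin (c * t)).
  by apply: is_derive_eq; rewrite /GRing.scale/=; field.
have LR (F f : R -> R) : (forall t : R, is_derive t 1 F (f t)) -> derivable_oo_LRcontinuous F 0 T.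
  move=> dF; have cF t : {for t, continuous F}.
    by apply: differentiable_continuous; apply/derivable1_diffP; have := dF t => ?; exact: ex_derive.
  split; first by move=> t _; have := dF t => ?; exact: ex_derive.
    exact: (cvg_at_right_filter (cF 0)).
  exact: (cvg_at_left_filter (cF T)).
split; rewrite /Rintegral.
- rewrite (@continuous_FTC2 _ _ (fun t => c^-1 * sin (c * t)))//.
  + by rewrite sinT !mulr0 sin0 mulr0 -EFinB subrr.
  + by apply: continuous_subspaceT.
  + exact: LR d1.
  + by move=> t _; rewrite derive1E; exact: derive_val.
- rewrite (@continuous_FTC2 _ _ (fun t => - c^-1 * cos (c * t)))//.
  + by rewrite cosT !mulr0 cos0 -EFinB subrr.
  + by apply: continuous_subspaceT.
  + exact: LR d2.
  + by move=> t _; rewrite derive1E; exact: derive_val.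
Qed.

Lemma Rint_fourier n : \int[mu]_(t in `[0, T]) complex.Re (fourier n t) = (if n == 0 then T else 0) /\
  \int[mu]_(t in `[0, T]) complex.Im (fourier n t) = 0.
Proof.
have [->|n0] := eqVneq n 0.
  have e t : fourier 0 t = 1 by rewrite /fourier mulr0 !mul0r cis0.
  split; under eq_Rintegral do rewrite e /=.
    rewrite Rintegral_cst// mul1r.
    by have := nint_cst 1 (ltW T0); rewrite (integral_cst mu (measurable_itv _) 1%:E) mul1e mul1r => ->.
  by rewrite Rintegral_cst// mul0r.
apply: Rint_cos_sin.
  by rewrite !mulf_eq0 !negb_or invr_eq0 intr_eq0 n0 !gt_eqF ?pi_gt0.
by rewrite divfK ?gt_eqF// cis_2pi.
Qed.


(** * Orthonormality and totality of the Fourier modes *)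

Section Basis.
Context {Y : hilbertType R} (sY : separable Y).

Definition mode (n : int) (v : Y) : R -> Y := fun t => fourier n t *: v.

Lemma L2_mode n v : L2_dom T (mode n v).
Proof.
have dv : L2_dom T (fun=> v).
  split; first exact: strongly_measurable_cst.
  by rewrite (nint_cst _ (ltW T0)) ltry.
have := @L2_scalar _ T _ (fourier n) 1 _ sY (scalar_continuous_fourier n) _ dv.
by move=> /(_ _)[] // t _; rewrite normc_cis.
Qed.

Lemma L2_dot_mode n m v w :
  L2_dot T (mode n v) (mode m w) = if n == m then T%:C * dot v w else 0.
Proof.
have e t : dot (mode n v t) (mode m w t) = dot v w * fourier (n - m) t.
  by rewrite dotZl dotZr conjc_fourier mulrA -fourierD mulrC.
have [h1 h2] := Rint_fourier (n - m).
have [i1 i2] : mu.-integrable `[0, T] (EFin \o (fun t => complex.Re (fourier (n - m) t))) /\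
    mu.-integrable `[0, T] (EFin \o (fun t => complex.Im (fourier (n - m) t))).
  have [c1 c2] := scalar_continuous_fourier (n - m).
  by split; apply: continuous_compact_integrable; [exact: segment_compact|exact: continuous_subspaceT|exact: segment_compact|exact: continuous_subspaceT].
have -> : L2_dot T (mode n v) (mode m w) = dot v w *
   ((\int[mu]_(t in `[0, T]) complex.Re (fourier (n - m) t)) +i*
    (\int[mu]_(t in `[0, T]) complex.Im (fourier (n - m) t))).
  by rewrite -(complex_integral_scale _ i1 i2) /L2_dot; congr Complex;
    apply: eq_Rintegral => t _; rewrite e.
rewrite h1 h2 subr_eq0 complexr0 mulrC; case: ifP => // _.
by rewrite mul0r.
Qed.

Lemma L2_sqnorm_mode n v : @sqnorm R (L2 T Y) (mode n v) = T * rnorm v ^+ 2.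
Proof.
have := L2_dot_mode n n v v; rewrite eqxx dot_rnorm -rmorphM => e.
by rewrite -[RHS]/(complex.Re (T * rnorm v ^+ 2)%:C) -e.
Qed.

(** A predicate on functions instead of a type of coefficient lists: closure under products and
    powers is then an induction based on [fourierD]. *)
Inductive trigonometric : (R -> R[i]) -> Prop :=
| trig_zero : trigonometric (fun=> 0)
| trig_lin (a : R[i]) n p : trigonometric p -> trigonometric (fun t => a * fourier n t + p t).

Lemma trigD p q : trigonometric p -> trigonometric q -> trigonometric (fun t => p t + q t).
Proof.
move=> tp tq; elim: tp => [|a n r tr ih]; first by under eq_fun do rewrite add0r.
by under eq_fun do rewrite -addrA; exact: trig_lin.
Qed.

Lemma trigM p q : trigonometric p -> trigonometric q -> trigonometric (fun t => p t * q t).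
Proof.
move=> tp tq; elim: tp => [|a n r tr ih].
  by under eq_fun do rewrite mul0r; exact: trig_zero.
under eq_fun do rewrite mulrDl; apply: trigD => //.
elim: tq => [|b m s ts ihs].
  by under eq_fun do rewrite mulr0; exact: trig_zero.
under eq_fun do rewrite mulrDr mulrACA -fourierD.
exact: trig_lin.
Qed.

Lemma trig_mode (a : R[i]) n : trigonometric (fun t => a * fourier n t).
Proof.
by under eq_fun do rewrite -[_ * _]addr0; apply: trig_lin; exact: trig_zero.
Qed.

Lemma trig_cst (a : R[i]) : trigonometric (fun=> a).
Proof.
have e t : fourier 0 t = 1 by rewrite /fourier mulr0 !mul0r cis0.
by have := trig_mode a 0; under eq_fun do rewrite e mulr1.
Qed.

Lemma trigX p k : trigonometric p -> trigonometric (fun t => p t ^+ k).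
Proof.
move=> tp; elim: k => [|k ih]; first exact: trig_cst.
by under eq_fun do rewrite exprS; exact: trigM.
Qed.

Lemma trig_cos (c m : R) : trigonometric (fun t => (c * cos (2 * pi / T * (t - m)))%:C).
Proof.
pose th := 2 * pi / T * m.
have h := trigD (trig_mode (c%:C / 2 * cis (- th)) 1) (trig_mode (c%:C / 2 * cis th) (-1)).
rewrite (_ : (fun t => _) = (fun t => c%:C / 2 * cis (- th) * fourier 1 t +
  c%:C / 2 * cis th * fourier (-1) t))//.
apply/funext => t; rewrite -!mulrA /fourier -!cisD -mulrDr -mulrDr.
rewrite (_ : 2 * pi * (-1)%:~R / T * t = - (2 * pi / T * t)); last by rewrite mulrN1z; ring.
rewrite mulr1 (_ : - th + _ = 2 * pi / T * (t - m)); last by rewrite /th; ring.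
rewrite (_ : th + _ = - (2 * pi / T * (t - m))); last by rewrite /th; ring.
set x := 2 * pi / T * (t - m); rewrite /cis cosN sinN.
rewrite (_ : cos x +i* sin x + (cos x -i* sin x) = 2 * (cos x)%:C); last first.
  by rewrite mulr_natl mulr2n; simpc; congr Complex; ring.
rewrite rmorphM/= (_ : 2 * (pi * (T^-1 * (t - m))) = x); last by rewrite /x !mulrA.
by field.
Qed.

Lemma trig_orthogonal p f v : trigonometric p -> L2_dom T f ->
  (forall n, L2_dot T f (mode n v) = 0) ->
  L2_dom T (fun t => p t *: v) /\ L2_dot T f (fun t => p t *: v) = 0.
Proof.
move=> tp df h; have hL := L2_axioms T sY.
elim: tp => [|a n r _ [dr hr]].
  have -> : (fun t : R => (0 : R[i]) *: v) = 0 by apply/funext => t; rewrite scale0r.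
  split; first exact: L2_cst0.
  have e : L2_dot T 0 f = 0 := rep_dot0l hL df.
  by rewrite (L2_dotC df (L2_cst0 T)) e conjc0.
have -> : (fun t : R => (a * fourier n t + r t) *: v) = a *: mode n v + (fun t => r t *: v).
  by apply/funext => t; rewrite scalerDl -scalerA.
have dn := L2_mode n v.
have d : L2_dom T (a *: mode n v + (fun t => r t *: v)) by exact: L2_lin.
split=> //; rewrite (L2_dotC df d) L2_dot_lin//.
by rewrite (L2_dotC dn df) (L2_dotC dr df) h hr !conjc0 mulr0 addr0 conjc0.
Qed.

Lemma bernoulli_ge (z : R) (M : nat) : 0 <= z <= 1 -> 1 - M%:R * z <= (1 - z) ^+ M.
Proof.
move=> /andP[z0 z1]; elim: M => [|M ih]; first by rewrite mul0r subr0 expr0.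
have p1 : (1 - z) ^+ M <= 1 by rewrite exprn_ile1 ?subr_ge0// gerBl.
rewrite exprS -natr1; set p := (1 - z) ^+ M in ih p1 *; nra.
Qed.

Lemma bernoulli_le (z : R) (M : nat) : 0 <= z -> 1 + M%:R * z <= (1 + z) ^+ M.
Proof.
move=> z0; elim: M => [|M ih]; first by rewrite mul0r addr0 expr0.
have p1 : 1 <= (1 + z) ^+ M by rewrite exprn_ege1// lerDl.
rewrite exprS -natr1; set p := (1 + z) ^+ M in ih p1 *; nra.
Qed.

(* With y affine in a shifted cosine, this is a sequence of trigonometric
   polynomials tending to the indicator of an arc. *)
Lemma step_cvg (y : R) : 0 <= y <= 1 -> y != 2^-1 ->
  (1 - y ^+ N) ^+ (2 ^ N) @[N --> \oo] --> ((y < 2^-1)%R%:R : R).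
Proof.
move=> /andP[y0 y1] yh; have yN N : 0 <= y ^+ N <= 1 by rewrite exprn_ge0//= exprn_ile1.
case: (ltP y 2^-1) => [yl|yl].
  have h : GRing.exp (2 * y) N @[N --> \oo] --> (0 : R).
    by apply: cvg_expr; rewrite ger0_norm ?mulr_ge0//; lra.
  have h1 : 1 - (2 * y) ^+ N @[N --> \oo] --> (1 : R).
    by rewrite -[X in _ --> X]subr0; apply: cvgB => //; exact: cvg_cst.
  apply: (squeeze_cvgr _ h1 (cvg_cst _)); apply: nearW => N.
  have /andP[a1 a2] := yN N; apply/andP; split.
    by rewrite exprMn -natrX; apply: bernoulli_ge; rewrite a1.
  by rewrite exprn_ile1 ?subr_ge0// gerBl.
have yg : 2^-1 < y by rewrite lt_def yh.
have y2 : 1 < 2 * y by lra.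
have h : GRing.exp (2 * y)^-1 N @[N --> \oo] --> (0 : R).
  apply: cvg_expr; rewrite ger0_norm ?invr_ge0; last by lra.
  by rewrite invf_lt1//; lra.
apply: (squeeze_cvgr _ (cvg_cst _) h); apply: nearW => N.
have /andP[a1 a2] := yN N; have b1 : 0 <= 1 - y ^+ N by rewrite subr_ge0.
rewrite exprn_ge0//=; set z := y ^+ N in a1 a2 b1 *.
have q0 : 0 < (2 * y) ^+ N by rewrite exprn_gt0//; lra.
rewrite exprVn -[leRHS]mul1r ler_pdivlMr//.
(* The product of the two powers is [(1 - z ^ 2) ^ (2 ^ N)], at most 1, while Bernoulli bounds
   [(1 + z) ^ (2 ^ N)] below by [2 ^ N * z], which is [(2 y) ^ N]. *)
apply: (@le_trans _ _ ((1 - z) ^+ (2 ^ N) * (1 + z) ^+ (2 ^ N))).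
  rewrite ler_wpM2l ?exprn_ge0// exprMn -natrX -/z.
  by apply: le_trans _ (bernoulli_le _ a1); rewrite lerDr.
rewrite -exprMn exprn_ile1//; nra.
Qed.

(** The test polynomials [r N] stay in [0, 1] and tend almost everywhere to the indicator of [0, x];
    dominated convergence with majorant [|g|] concludes. *)
Lemma Rint_prefix_zero (g : R -> R) (x : R) : mu.-integrable `[0, T] (EFin \o g) ->
  (forall p : R -> R, trigonometric (fun t => (p t)%:C) ->
     \int[mu]_(t in `[0, T]) (p t * g t) = 0) ->
  0 < x <= T -> \int[mu]_(t in `[0, x]) g t = 0.
Proof.
move=> ig hp /andP[x0 xT].
(* On the circle of length T the arc [0, x] has midpoint [m] and half-angle [al], so [cos (th t)]
   exceeds [k] inside the arc and stays below it outside. Two cosines differ by at most 2, so the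
   factor [4^-1] keeps [y] in [0, 1]. *)
pose m := x / 2; pose al := pi * x / T; pose k := cos al.
pose th t := 2 * pi / T * (t - m).
pose y t := 2^-1 - 4^-1 * (cos (th t) - k).
pose r N t : R := (1 - y t ^+ N) ^+ (2 ^ N).
have tr N : trigonometric (fun t => (r N t)%:C).
  rewrite (_ : (fun t => _) = fun t => ((1 : R)%:C +
      (-1)%:C * ((2^-1 + 4^-1 * k)%:C + (- 4^-1 * cos (th t))%:C) ^+ N) ^+ (2 ^ N)).
    apply: trigX; apply: trigD; first exact: trig_cst.
    apply: trigM; first exact: trig_cst.
    by apply: trigX; apply: trigD; [exact: trig_cst|exact: trig_cos].
  apply/funext => t; rewrite -rmorphD/= -rmorphXn/= -rmorphM/= -rmorphD/= -rmorphXn/=.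
  by congr (_%:C); rewrite /r /y; congr (_ ^+ _); rewrite mulN1r; congr (_ - _ ^+ _); ring.
have y01 t : 0 <= y t <= 1.
  have := cos_le1 (th t); have := cos_geN1 (th t).
  have := cos_le1 al; have := cos_geN1 al; rewrite /y /k; lra.
have r01 N t : 0 <= r N t <= 1.
  have /andP[a1 a2] := y01 t.
  have b0 : 0 <= y t ^+ N by rewrite exprn_ge0.
  have b1 : y t ^+ N <= 1 by rewrite exprn_ile1.
  by rewrite /r exprn_ge0 ?subr_ge0//= exprn_ile1 ?subr_ge0// gerBl.
have al0 : 0 < al by rewrite divr_gt0// mulr_gt0// pi_gt0.
have alpi : al <= pi by rewrite ler_pdivrMr// ler_pM2l ?pi_gt0.
have thE t : th t = (2 * pi / T) * t - al by rewrite /th /al /m mulrBr; field; rewrite gt_eqF.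
(* At the excluded points 0, x and T, the ends of the arc, [y t] equals one half, the value that
   [step_cvg] leaves out. They form a null set. *)
have lim t : t \in `[0, T] -> t != 0 -> t != x -> t != T ->
    r N t @[N --> \oo] --> (\1_(`[0, x]) t : R).
  rewrite in_itv/= => /andP[t0 tT] tn0 tnx tnT.
  have t0' : 0 < t by rewrite lt_def tn0.
  have tT' : t < T by rewrite lt_neqAle tnT.
  have c0 : 0 < 2 * pi / T by rewrite divr_gt0// mulr_gt0// pi_gt0.
  have al2 : al + al = 2 * pi / T * x by rewrite /al; field; rewrite gt_eqF.
  have cT : 2 * pi / T * T = 2 * pi by rewrite divfK// gt_eqF.
  have hc : (t < x -> k < cos (th t)) /\ (x < t -> cos (th t) < k).
    split=> tx.
      have h1 : `|th t| < al.
        rewrite ltr_norml thE; apply/andP; split; first by rewrite ltrBrDr addNr mulr_gt0.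
        by rewrite ltrBlDr al2 ltr_pM2l.
      rewrite -(cos_norm (th t)) /k ltr_cos ?in_itv/= ?(ltW al0) ?normr_ge0//=.
      exact: (le_trans (ltW h1)).
    have h1 : al < th t by rewrite thE ltrBrDr al2 ltr_pM2l.
    have h2 : th t < 2 * pi - al by rewrite thE ltrD2r -[ltRHS]cT ltr_pM2l.
    have [h3|h3] := leP (th t) pi.
      rewrite /k ltr_cos ?in_itv/= ?(ltW al0)//= h3 andbT.
      exact: (le_trans (ltW al0) (ltW h1)).
    have -> : cos (th t) = cos (2 * pi - th t).
      by rewrite cosB mulr_natl cos2pi sin2pi mul1r mul0r addr0.
    rewrite /k ltr_cos ?in_itv/= ?(ltW al0)//=; last by apply/andP; split; lra.
    by lra.
  have [ltx|xlt] := ltP t x.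
    rewrite indicE mem_set; last by rewrite /= in_itv/= t0 ltW.
    have := hc.1 ltx => hk; have yl : y t < 2^-1 by rewrite /y; lra.
    have := @step_cvg (y t) (y01 t); rewrite lt_eqF// yl; exact.
  have xt : x < t by rewrite lt_def tnx.
  rewrite indicE memNset; last by rewrite /= in_itv/= t0/= => /(lt_le_trans xt); rewrite ltxx.
  have := hc.2 xt => hk; have yl : 2^-1 < y t by rewrite /y; lra.
  have := @step_cvg (y t) (y01 t); rewrite gt_eqF// ltNge ltW//; exact.
have mg : measurable_fun `[0, T] g by apply/measurable_EFinP; exact: (measurable_int _ ig).
have mr N : measurable_fun `[0, T] (r N).
  apply: measurable_funX; apply: measurable_funB; first exact: measurable_cst.
  apply: measurable_funX; apply: measurable_funB; first exact: measurable_cst.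
  apply: measurable_funM; first exact: measurable_cst.
  apply: measurable_funB; last exact: measurable_cst.
  apply: measurable_funTS; apply: continuous_measurable_fun => t.
  apply: continuous_comp; last exact: continuous_cos.
  by apply: cvgM; [exact: cvg_cst|apply: cvgB; [exact: cvg_id|exact: cvg_cst]].
have [||||| _ _ h] := @dominated_convergence _ _ R mu `[0, T] (measurable_itv _)
    (fun N t => (r N t * g t)%:E) (fun t => (\1_(`[0, x]) t * g t)%:E) (fun t => `|g t|%:E).
- by move=> N; apply/measurable_EFinP; apply: measurable_funM => //; exact: mr.
- by apply/measurable_EFinP; apply: measurable_funM => //; exact: measurable_funTS.
- exists [set 0; x; T]; split.
  + by apply: measurableU; [apply: measurableU|]; exact: measurable_set1.
  + exact/countable_lebesgue_measure0/finite_set_countable/finite_set3.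
  + move=> t /= ht; apply: contrapT => hn; apply: ht => tT.
    apply: cvg_EFin; first exact: nearW.
    apply: cvgM; last exact: cvg_cst.
    by apply: lim => //; apply/eqP => e; apply: hn; [left; left|left; right|right].
- by have := integrable_abse ig.
- apply/aeW => t N tT /=; rewrite lee_fin normrM ler_piMl//.
  by have /andP[a1 a2] := r01 N t; rewrite ger0_norm.
have z : (fun N => \int[mu]_(t in `[0%R, T]) (r N t * g t)%:E)%E = (fun=> 0%E).
  apply/funext => N; have := hp _ (tr N); rewrite /Rintegral => e.
  rewrite -[LHS]fineK ?e//; apply: integrable_fin_num => //.
  apply: (@integrable_dominated _ T (fun t => r N t * g t) (fun t => `|g t|)).
  - by apply: measurable_funM => //; exact: mr.
  - exact: measurableT_comp.
  - by move=> t _; rewrite normrM ler_piMl//; have /andP[a1 a2] := r01 N t; rewrite ger0_norm.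
  - by have /integrableP[] := ig.
have e0 : (\int[mu]_(t in `[0%R, T]) (\1_(`[0%R, x]) t * g t)%:E = 0)%E.
  by have /cvg_lim <- := h => //; rewrite z lim_cst.
have -> : `[0%R, x]%classic = `[0%R, T] `&` `[0%R, x] :> set R.
  apply/seteqP; split=> [t /=|t []//]; rewrite !in_itv/= => /andP[t0 tx].
  by rewrite t0 tx (le_trans tx).
rewrite Rintegral_mkcondr /Rintegral -[RHS]/(fine 0%E) -e0; congr fine.
apply: eq_integral => t _; rewrite patchE indicE.
by case: ifP => _; rewrite ?mul1r ?mul0r.
Qed.

(** Extended by 0, [g] has an identically vanishing primitive, and Lebesgue differentiation recovers
    [g] almost everywhere. *)
Lemma ae_zero_of_prefix (g : R -> R) : mu.-integrable `[0, T] (EFin \o g) ->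
  (forall x, 0 < x <= T -> \int[mu]_(t in `[0, x]) g t = 0) ->
  {ae mu, forall t, t \in `[0, T] -> g t = 0}.
Proof.
move=> ig hg; pose g0 := g \_ `[0, T].
have iT : mu.-integrable setT (EFin \o g0).
  by rewrite /g0 -restrict_EFin; apply: (integrable_mkcond _ _).1.
have loc : locally_integrable setT g0 by exact: integrable_locally.
have iy y : mu.-integrable `]-oo, y] (EFin \o g0).
  by apply: integrableS iT => //; exact: measurable_itv.
have := FTC1Ny iy loc => /=.
have -> : (fun x => \int[mu]_(t in `]-oo, x]) g0 t) = cst 0.
  apply/funext => x; rewrite /g0 -Rintegral_mkcondr/=.
  have [xn|xp|->] := ltgtP x 0.
  - rewrite (_ : _ `&` _ = set0) ?Rintegral_set0//.
    apply/seteqP; split=> // t /= []; rewrite !in_itv/= => tx /andP[t0 _].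
    by have := le_lt_trans (le_trans t0 tx) xn; rewrite ltxx.
  - have -> : `]-oo, x]%classic `&` `[0%R, T] = `[0%R, Num.min x T]%classic.
      apply/seteqP; split=> t /=; rewrite !in_itv/= le_min.
        by move=> [-> /andP[-> ->]].
      by move=> /and3P[-> -> ->].
    by rewrite hg// lt_min xp T0 ge_min lexx orbT.
  - have -> : `]-oo, 0]%classic `&` `[0%R, T] = [set 0].
      apply/seteqP; split=> [t /= []|t /= ->]; rewrite !in_itv/=.
        by move=> tx /andP[t0 _]; apply/eqP; rewrite eq_le tx.
      by rewrite lexx ltW.
    by rewrite Rintegral_set1.

apply: filterS; first exact: (ae_filter_ringOfSetsType mu).
move=> t [_]; rewrite derive1_cst /g0 patchE => h tT.
by move: h; rewrite mem_set.
Qed.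

(** Separability reduces the vector case to countably many scalar ones: off a common null set [f t]
    has zero real inner product with every member of a dense sequence, hence with itself. *)
Lemma modes_total (f : R -> Y) : L2_dom T f ->
  (forall n v, L2_dot T f (mode n v) = 0) -> @sqnorm R (L2 T Y) f = 0.
Proof.
move=> df hf; have [d dd] := separable_seq sY.
have h1 k : {ae mu, forall t, t \in `[0, T] -> rdot (f t) (d k) = 0}.
  have dc : L2_dom T (fun=> d k).
    split; first exact: strongly_measurable_cst.
    by rewrite (nint_cst _ (ltW T0)) ltry.
  have ig := L2_integrable_rdot df dc.
  apply: ae_zero_of_prefix => // x xT; apply: Rint_prefix_zero => // p tp.
  have [_] := trig_orthogonal tp df (fun n => hf n (d k)).
  move=> /(congr1 (@complex.Re R)); rewrite Re_L2_dot /= => h; rewrite -[RHS]h.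
  by apply: eq_Rintegral => t _; rewrite rdotZr.
have h2 : {ae mu, forall t, t \in `[0, T] -> rnorm (f t) ^+ 2 = 0}.
  have [N [mN N0 sN]] := ae_foralln h1; exists N; split=> // t /= ht0; apply: sN => /= ht.
  apply: ht0 => tT.
  rewrite -rdotxx; apply/eqP; rewrite -normr_le0.
  apply: (@le_mul_eps _ _ _ (rnorm (f t))); first exact: rnorm_ge0.
  move=> e e0; rewrite add0r; have [k hk] := dd (f t) e e0.
  have -> : rdot (f t) (f t) = rdot (f t) (f t - d k) by rewrite rdotDr rdotNr ht// subr0.
  by rewrite (le_trans (rdot_CS _ _))// ler_wpM2l ?rnorm_ge0// ltW.
have := L2_sqnorm df.
rewrite (ae_eq_integral (cst 0%E)).
- by rewrite integral0 => -[].
- exact: measurable_itv.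
- by apply/measurable_EFinP; exact: measurable_sqnorm df.1.
- exact: measurable_cst.
- move: h2; apply: filterS; first exact: (ae_filter_ringOfSetsType mu).
  by move=> t ht /= tT; rewrite ht.
Qed.

Variable F : set (hil Y).
Hypothesis hF : orthonormal_basis F.

(** The squared L^2 norm of a mode is T times that of its vector, whence the factor [1 / sqrt T]. *)
Definition mode_basis (p : int * hil Y) : R -> Y := mode p.1 (((Num.sqrt T)^-1)%:C *: (p.2 : Y)).

Lemma mode_basis_orthonormal :
  @orthonormal_family R (L2 T Y) _ [set p : int * hil Y | F p.2] mode_basis.
Proof.
have [FE F1 F2 F3] := hF.
split=> [p _|[n v] [m w] /= Fv Fw]; first exact: L2_mode.
rewrite /mode_basis L2_dot_mode/= xpair_eqE; case: eqVneq => [_|] //=.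
have sT : ((Num.sqrt T)^-1)%:C * (((Num.sqrt T)^-1)%:C * T%:C) = 1 :> R[i].
  rewrite -!rmorphM/= mulrA -invfM -expr2 sqr_sqrtr ?ltW// mulVf ?gt_eqF//.
rewrite dotZl dotZr conjc_real.
have -> : T%:C * (((Num.sqrt T)^-1)%:C * (((Num.sqrt T)^-1)%:C * dot v w)) = dot v w.
  by rewrite mulrC -!mulrA [dot v w * _]mulrC !mulrA -[X in X * _]mulrA sT mul1r.
by case: eqVneq => [<-|vw]; [exact: F1|exact: F2].
Qed.

(** Vanishing coefficients are given for vectors of the basis [F]; any other [v] is approximated by
    its finite projections on [F], and the modes depend on [v] continuously. *)
Lemma mode_basis_complete (f : L2 T Y) : rep_dom (L2 T Y) f ->
  (forall p, [set p : int * hil Y | F p.2] p -> rep_dot f (mode_basis p : L2 T Y) = 0) ->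
  sqnorm f = 0.
Proof.
move=> df hf; apply: modes_total => // n v.
have [FE F1 F2 F3] := hF.
have [hF1 hF2] := orthonormal_basis_family hF.
have ml (a : R[i]) x y : mode n (a *: x + y) = a *: mode n x + mode n y.
  by apply/funext => t; rewrite /mode scalerDr scalerA mulrC -scalerA.
have m0 : mode n 0 = 0 by apply/funext => t; rewrite /mode scaler0.
have hv w : F w -> L2_dot T f (mode n w) = 0.
  move=> Fw; have := hf (n, w) Fw; rewrite /= /mode_basis/=.
  rewrite -[_ *: w]addr0 ml m0 addr0.
  have e : L2_dot T f (((Num.sqrt T)^-1)%:C *: mode n w) =
      conjc ((Num.sqrt T)^-1)%:C * L2_dot T f (mode n w).
    by have h := rep_dotZr (L2_axioms T sY) ((Num.sqrt T)^-1)%:C df (L2_mode n w); exact: h.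
  rewrite e conjc_real => /eqP; rewrite mulf_eq0 => /orP[|/eqP//].
  by rewrite (inj_eq (@complexI R)) invr_eq0 gt_eqF// sqrtr_gt0.
suff h : normc (L2_dot T f (mode n v)) ^+ 2 <= 0.
  by apply: eq0_normc; apply/eqP; rewrite -sqrf_eq0 eq_le h sqr_ge0.
have f0 := rdot_ge0 (L2_axioms T sY) df.
apply: (@le_mul_eps _ _ _ (sqnorm f * T)); first by rewrite mulr_ge0// ltW.
move=> e e0; rewrite add0r.
have [X [uX XF hX]] := proj_approx (hil_axioms Y) hF1 hF2 (I : rep_dom (hil Y) v) e0.
set p := ortho_proj _ _ _ in hX.
have -> : L2_dot T f (mode n v) = L2_dot T f (mode n (v - p)).
  have -> : mode n v = 1 *: mode n (v - p) + mode n p.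
    by rewrite -ml scale1r subrK.
  have mp : L2_dot T f (mode n p) = 0.
    have -> : mode n p = \sum_(i <- X) dot v (i : Y) *: (mode n i : L2 T Y).
      rewrite /p /ortho_proj; elim: (X) => [|i Z ih]; first by rewrite !big_nil m0.
      by rewrite !big_cons ml ih.
    have /= -> := rep_dot_sumr (L2_axioms T sY) (X := X) (fun i => dot v (i : Y)) (g := mode n) (fun i _ => L2_mode n i) df.
    by rewrite big_seq big1// => i /XF Fi; rewrite hv// mulr0.
  have d1 := L2_mode n (v - p); have d2 := L2_mode n p.
  rewrite (L2_dotC df (L2_lin 1 d1 d2)) L2_dot_lin// mul1r.
  by rewrite (L2_dotC d2 df) mp conjc0 addr0 -L2_dotC.
have /le_trans := rep_CS (L2_axioms T sY) df (L2_mode n (v - p)).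
apply; rewrite -mulrA ler_wpM2l//.
rewrite L2_sqnorm_mode ler_wpM2l ?(ltW T0)//.
by rewrite -sqnorm_hil.
Qed.

End Basis.

End Fourier.

(** * Semigroups and their resolvents *)

Section ComplexExponential.
Context {R : realType}.
Implicit Types (l : R[i]) (s t : R).

Definition cexp l t : R[i] := (expR (complex.Re l * t))%:C * cis (complex.Im l * t).

Lemma cexpD l s t : cexp l (s + t) = cexp l s * cexp l t.
Proof. by rewrite /cexp !mulrDr expRD rmorphM/= cisD mulrACA. Qed.

Lemma cexp0 l : cexp l 0 = 1.
Proof. by rewrite /cexp !mulr0 expR0 cis0 mulr1. Qed.

Lemma normc_cexp l t : normc (cexp l t) = expR (complex.Re l * t).
Proof. by rewrite /cexp normcM normc_real normc_cis mulr1 ger0_norm// expR_ge0. Qed.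

Lemma cexpN l t : cexp (- l) t = cexp l (- t).
Proof. by rewrite /cexp; case: l => a b /=; rewrite !mulNr !mulrN. Qed.

Lemma cexpK l t : cexp l t * cexp (- l) t = 1.
Proof. by rewrite cexpN -cexpD subrr cexp0. Qed.

Let is_derive_cexp l (t : R) :
  is_derive t 1 (fun t => expR (complex.Re l * t) * cos (complex.Im l * t))
    (complex.Re (l * cexp l t)) /\
  is_derive t 1 (fun t => expR (complex.Re l * t) * sin (complex.Im l * t))
    (complex.Im (l * cexp l t)).
Proof.
case: l => a b; rewrite /cexp /cis /=; split.
  by apply: is_derive_eq; rewrite /GRing.scale/=; ring.
by apply: is_derive_eq; rewrite /GRing.scale/=; ring.
Qed.

Lemma scalar_continuous_cexp l : scalar_continuous (cexp l).
Proof.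
have dc (F f : R -> R) : (forall t : R, is_derive t 1 F (f t)) -> continuous F.
  move=> dF t; apply: differentiable_continuous; apply/derivable1_diffP.
  by have := dF t => ?; exact: ex_derive.
split.
  rewrite (_ : (fun t => _) = fun t => expR (complex.Re l * t) * cos (complex.Im l * t)).
    by apply: dc => t; exact: (is_derive_cexp l t).1.
  by apply/funext => t; rewrite /cexp /cis /= mul0r subr0.
rewrite (_ : (fun t => _) = fun t => expR (complex.Re l * t) * sin (complex.Im l * t)).
  by apply: dc => t; exact: (is_derive_cexp l t).2.
by apply/funext => t; rewrite /cexp /cis /= mul0r addr0.
Qed.

Let derive0_small (F : R -> R) (c : R) : is_derive (0 : R) 1 F c ->
  forall e, 0 < e -> exists2 d : R, 0 < d & forall h, 0 <= h < d -> `|F h - F 0 - h * c| <= e * h.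
Proof.
move=> dF e e0; have dv := @derive_val _ _ _ _ _ _ _ dF.
have : h^-1 *: (F (h *: 1 + 0) - F 0) @[h --> (0:R)^'] --> c.
  by rewrite -dv; apply: (@ex_derive _ _ _ _ _ _ _ dF).
move=> /cvgrPdist_le/(_ _ e0)/nbhs_ballP[d d0 hd]; exists d => // h /andP[h0 hh].
have [->|hN0] := eqVneq h 0; first by rewrite subrr mul0r mulr0 subr0 normr0.
have hp : 0 < h by rewrite lt_def hN0.
have := hd h; rewrite /ball/= sub0r normrN ger0_norm// => /(_ hh hN0).
rewrite /GRing.scale/= mulr1 addr0 distrC => h1.
have -> : F h - F 0 - h * c = (h^-1 * (F h - F 0) - c) * h by field.
by rewrite normrM (ger0_norm h0) ler_wpM2r.
Qed.

Lemma cexp_derive0 l e : 0 < e -> exists2 d : R, 0 < d &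
  forall h, 0 <= h < d -> normc (cexp l h - 1 - h%:C * l) <= e * h.
Proof.
move=> e0; have [d1 d2] := is_derive_cexp l 0.
have e20 : 0 < e / 2 by rewrite divr_gt0.
rewrite cexp0 mulr1 in d1 d2.
have [r1 r10 h1] := derive0_small d1 e20; have [r2 r20 h2] := derive0_small d2 e20.
exists (Num.min r1 r2) => [|h]; first by rewrite lt_min r10.
rewrite lt_min => /and3P[h0 k1 k2].
have := h1 h; rewrite h0 k1 => /(_ isT) a1; have := h2 h; rewrite h0 k2 => /(_ isT) a2.
rewrite !mulr0 expR0 cos0 sin0 mulr1 mulr0 subr0 in a1 a2.
rewrite (le_trans (normc_le_ReIm _))// [e in leRHS](splitr e) mulrDl lerD//.
  rewrite (_ : complex.Re _ = expR (complex.Re l * h) * cos (complex.Im l * h) - 1 - h * complex.Re l)//.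
  by case: l {d1 d2 h1 h2 a1 a2} => a b; rewrite /cexp /cis/=; ring.
rewrite (_ : complex.Im _ = expR (complex.Re l * h) * sin (complex.Im l * h) - h * complex.Im l)//.
by case: l {d1 d2 h1 h2 a1 a2} => a b; rewrite /cexp /cis/=; ring.
Qed.

Lemma cexp_near1 l e : 0 < e -> exists2 d : R, 0 < d &
  forall h, 0 <= h < d -> normc (cexp l h - 1) <= e.
Proof.
move=> e0; have [d d0 hd] := cexp_derive0 l ltr01.
have c0 : 0 < 1 + normc l by rewrite ltr_wpDr ?normc_ge0.
exists (Num.min d (e / (1 + normc l))); first by rewrite lt_min d0 divr_gt0.
move=> h; rewrite lt_min => /and3P[h0 h1 h2].
have := hd h; rewrite h0 h1 mul1r => /(_ isT) h3.
have -> : cexp l h - 1 = (cexp l h - 1 - h%:C * l) + h%:C * l by rewrite subrK.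
rewrite (le_trans (le_normcD _ _))// normcM normc_real ger0_norm//.
rewrite (le_trans (lerD h3 (lexx _)))// -{1}[h]mulr1 -mulrDr -ler_pdivlMr//.
exact: ltW.
Qed.

End ComplexExponential.

(** * Integration of semigroup orbits over [0, T] *)

Section BoundedSemigroup.
Context {R : realType} {V : normedModType R[i]}.
Implicit Types (x y z : V).

(** The properties of a rescaled semigroup that integration over [0, T] uses, with a uniform bound
    there; they serve in H and in the extrapolation space. *)
Record bounded_semigroup (T M : R) (P : R -> V -> V) : Prop := {
  sg_linear : forall t, 0 <= t -> linear (P t) ;
  sg_zero : forall x, P 0 x = x ;
  sg_add : forall s t x, 0 <= s -> 0 <= t -> P (s + t) x = P s (P t x) ;
  sg_bound : forall t, 0 <= t <= T -> bounded_by M (P t) ;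
  sg_cvg : forall x e, 0 < e -> exists2 d : R, 0 < d &
    forall h, 0 <= h < d -> rnorm (P h x - x) <= e }.

(** The right derivative of the orbit at time 0, multiplied out so that h = 0 is allowed. *)
Definition orbit_derivative (P : R -> V -> V) x z := forall e, 0 < e ->
  exists2 d : R, 0 < d & forall h, 0 <= h < d -> rnorm (P h x - x - h%:C *: z) <= e * h.

Variables (T M : R) (T0 : 0 < T) (M0 : 0 <= M) (P : R -> V -> V).
Hypothesis hP : bounded_semigroup T M P.

Lemma sg_linearB t x y : 0 <= t -> P t (x - y) = P t x - P t y.
Proof. by move=> t0; rewrite addrC -scaleN1r (sg_linear hP t0) scaleN1r addrC. Qed.

Lemma sg_linearZ t a x : 0 <= t -> P t (a *: x) = a *: P t x.
Proof.
move=> t0; have Pl := sg_linear hP t0.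
by rewrite -[a *: x]addr0 Pl (linear_at0 Pl) addr0.
Qed.

Let split_time s t x : 0 <= s -> s <= t -> P t x = P s (P (t - s) x).
Proof. by move=> s0 st; rewrite -(sg_add hP) ?subr_ge0// addrC subrK. Qed.

Let eps_M e : 0 < e -> 0 < e / (M + 1) /\ M * (e / (M + 1)) <= e.
Proof.
move=> e0; have M1 : 0 < M + 1 by rewrite ltr_wpDl.
split; first by rewrite divr_gt0.
by rewrite mulrCA -[leRHS]mulr1 ler_pM2l// ler_pdivrMr// mul1r lerDl.
Qed.

Lemma sg_uniform x e : 0 < e -> exists2 d : R, 0 < d &
  forall s t, 0 <= s -> s <= t -> t <= T -> t - s < d -> rnorm (P t x - P s x) <= e.
Proof.
move=> e0; have [e1 e2] := eps_M e0; have [d d0 hd] := sg_cvg hP x e1.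
exists d => // s t s0 st tT ts; rewrite (split_time x s0 st) -sg_linearB//.
rewrite (le_trans (sg_bound hP _ _)) ?s0 ?(le_trans st)//.
by rewrite (le_trans _ e2)// ler_wpM2l// hd// ts subr_ge0 st.
Qed.

Lemma sg_continuous_on x : continuous_on T (P ^~ x).
Proof.
move=> t /andP[t0 tT] e e0; have [d d0 hd] := sg_uniform x e0.
exists d => // s /andP[s0 sT] st; have [h|h] := leP s t.
  by rewrite rdistC hd// (le_lt_trans (ler_norm _))// distrC.
by rewrite hd// ?(ltW h)// (le_lt_trans (ler_norm _)).
Qed.

Lemma sg_op_family_reversed : op_family T (fun t => P (T - t)).
Proof.
split=> [t /andP[t0 tT]|x].
  by split; [apply: (sg_linear hP)|exists M; apply: (sg_bound hP)]; rewrite ?subr_ge0 ?gerBl ?t0 ?tT.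
move=> t /andP[t0 tT] e e0; have [d d0 hd] := sg_uniform x e0.
have aux s s' : 0 <= s -> s <= s' -> s' <= T -> s' - s < d ->
    rnorm (P (T - s) x - P (T - s') x) <= e.
  move=> s0 ss' s'T h; apply: hd.
  - by rewrite subr_ge0.
  - by rewrite lerB.
  - by rewrite gerBl.
  - by rewrite opprB addrC addrA subrK.
exists d => // s /andP[s0 sT] st; have [h|h] := leP s t.
  by apply: aux => //; rewrite (le_lt_trans (ler_norm _))// distrC.
rewrite rdistC; apply: aux => //; first exact: ltW.
exact: le_lt_trans (ler_norm _) st.
Qed.

(** The derivative at 0 is carried to time s by [P s], whose norm is at most [M] on [0, T]; this
    gives the uniformity required by [bochner_FTC]. *)
Lemma sg_bochner x z : orbit_derivative P x z ->
  is_bochner_integral T (fun t => P t z) (P T x - x).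
Proof.
move=> xz; rewrite -[X in _ - X](sg_zero hP x).
apply: (@bochner_FTC _ _ T T0 (fun t => P t z) (fun t => P t x)) => e e0.
have [e1 e2] := eps_M e0; have [d1 d10 h1] := xz _ e1; have [d2 d20 h2] := sg_uniform z e0.
exists (Num.min d1 d2) => [|s t s0 st tT]; first by rewrite lt_min d10.
rewrite lt_min => /andP[k1 k2]; split; last exact: h2.
rewrite (split_time x s0 st) -sg_linearB// -sg_linearZ// -sg_linearB//.
rewrite (le_trans (sg_bound hP _ _)) ?s0 ?(le_trans st)//.
have h : 0 <= t - s by rewrite subr_ge0.
have := h1 (t - s); rewrite h k1 => /(_ isT) h3.
by rewrite (le_trans (ler_wpM2l M0 h3))// mulrA ler_wpM2r.
Qed.

(** The kernel of the input map runs backwards in time; treating it directly, with primitive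
    [- P (T - t) x], avoids a change of variables in the Bochner integral. *)
Lemma sg_bochner_reversed x z : orbit_derivative P x z ->
  is_bochner_integral T (fun t => P (T - t) z) (P T x - x).
Proof.
move=> xz; have -> : P T x - x = - P (T - T) x - - P (T - 0) x.
  by rewrite subrr subr0 (sg_zero hP) opprK addrC.
apply: (@bochner_FTC _ _ T T0 (fun t => P (T - t) z) (fun t => - P (T - t) x)) => e e0.
have e20 : 0 < e / 2 by rewrite divr_gt0.
have [e1 e2] := eps_M e20; have [d1 d10 h1] := xz _ e1; have [d2 d20 h2] := sg_uniform z e0.
have [d3 d30 h3] := sg_cvg hP z e1.
exists (Num.min d1 (Num.min d2 d3)) => [|s t s0 st tT]; first by rewrite !lt_min d10 d20.
rewrite !lt_min => /and3P[k1 k2 k3]; have h : 0 <= t - s by rewrite subr_ge0.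
have Tt : 0 <= T - t by rewrite subr_ge0.
have PTs u : P (T - s) u = P (T - t) (P (t - s) u) by rewrite -(sg_add hP)// addrA subrK.
split; last first.
  rewrite rdistC; apply: h2.
  - exact: Tt.
  - by rewrite lerB.
  - by rewrite gerBl.
  - by rewrite opprB addrC addrA subrK.
rewrite !PTs -sg_linearZ//.
(* The increment factors through [P (T - t)] and has leading term [(t - s) z], while the Riemann sum
   has [(t - s) P (t - s) z]; the last term is this discrepancy. *)
have -> : - P (T - t) x - - P (T - t) (P (t - s) x) - P (T - t) ((t - s)%:C *: P (t - s) z) =
    P (T - t) ((P (t - s) x - x - (t - s)%:C *: z) - (t - s)%:C *: (P (t - s) z - z)).
  rewrite !sg_linearB// !sg_linearZ// sg_linearB// scalerBr !opprB !opprK.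
  by rewrite addrA subrK [- _ + _]addrC.
rewrite (le_trans (sg_bound hP _ _)) ?Tt ?gerBl ?(le_trans s0)//.
have := h1 (t - s); rewrite h k1 => /(_ isT) a1; have := h3 (t - s); rewrite h k3 => /(_ isT) a2.
rewrite (@le_trans _ _ (M * (e / 2 / (M + 1) * (t - s) + (t - s) * (e / 2 / (M + 1)))))//.
  rewrite ler_wpM2l// (le_trans (rnormB _ _))// lerD// rnormZ normc_real ger0_norm//.
  by rewrite ler_wpM2l.
rewrite [X in _ + X]mulrC -mulrDl mulrA ler_wpM2r//.
by rewrite mulrDr [leRHS]splitr lerD.
Qed.

End BoundedSemigroup.

Lemma normc_le2 (R : realType) (a : R[i]) : normc (a - 1) <= 1 -> normc a <= 2.
Proof.
move=> h; rewrite -(subrK 1 a) (le_trans (le_normcD _ _))// normc1.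
by rewrite (_ : 2 = 1 + 1) ?lerD2r.
Qed.

(** * Generators, rescaling and resolvents *)

Section Generator.
Context {R : realType} {V : normedModType R[i]}.
Implicit Types (x y z : V) (S : R -> V -> V) (l : R[i]).

Lemma generatorP S x y : generator S (x, y) <-> forall e, 0 < e ->
  exists2 d : R, 0 < d & forall h, 0 < h < d -> rnorm (S h x - x - h%:C *: y) <= e * h.
Proof.
have key h : 0 < h -> rnorm ((h^-1)%:C *: (S h x - x) - y) * h = rnorm (S h x - x - h%:C *: y).
  move=> h0; rewrite -[X in _ * X](ger0_norm (ltW h0)) mulrC -normc_real -rnormZ.
  by rewrite scalerBr scalerA -rmorphM/= divff ?gt_eqF// scale1r.
split=> [/rcvgP/cvgrPdist_le h e e0|h].
  have [d d0 hd] := h _ e0; exists d => // k /andP[k0 kd].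
  have := hd k; rewrite /ball/= sub0r normrN gtr0_norm// => /(_ kd k0).
  by rewrite sub0r normrN ger0_norm ?rnorm_ge0// -key// => k1; rewrite ler_wpM2r// ltW.
apply/rcvgP/cvgrPdist_le => e e0; have [d d0 hd] := h _ e0.
exists d => // k; rewrite /ball/= sub0r normrN => kd k0; rewrite gtr0_norm// in kd.
rewrite sub0r normrN ger0_norm ?rnorm_ge0// -(ler_pM2r k0) key//.
by apply: hd; rewrite k0.
Qed.

Lemma C0_cvg S x : C0_semigroup S -> forall e, 0 < e -> exists2 d : R, 0 < d &
  forall h, 0 <= h < d -> rnorm (S h x - x) <= e.
Proof.
move=> [_ S0 _ Sc] e e0; have /rcvgP/cvgrPdist_le/(_ _ e0)[d d0 hd] := Sc x.
exists d => // h /andP[h0 kd]; have [->|hN0] := eqVneq h 0; first by rewrite S0 subrr rnorm0 ltW.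
have hp : 0 < h by rewrite lt_def hN0.
have := hd h; rewrite /ball/= sub0r normrN gtr0_norm// => /(_ kd hp).
by rewrite sub0r normrN ger0_norm ?rnorm_ge0.
Qed.

Definition rescaled S l t x := cexp (- l) t *: S t x.

Lemma rescaled_semigroup S l T (M : R) : C0_semigroup S -> 0 <= M ->
  (forall t, 0 <= t <= T -> bounded_by M (S t)) ->
  bounded_semigroup T (M * expR (`|complex.Re l| * T)) (rescaled S l).
Proof.
move=> SC M0 SM; have [Sl S0 Sa Sc] := SC; split.
- by move=> t t0 a x y; rewrite /rescaled (Sl t t0).1 scalerDr !scalerA [_ * a]mulrC.
- by move=> x; rewrite /rescaled cexp0 scale1r S0.
- move=> s t x s0 t0; rewrite /rescaled Sa// cexpD.
  have Slz a y : S s (a *: y) = a *: S s y.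
    by rewrite -[a *: y]addr0 (Sl s s0).1 (linear_at0 (Sl s s0).1) addr0.
  by rewrite Slz scalerA.
- move=> t tT x; have /andP[t0 tT'] := tT; rewrite /rescaled rnormZ normc_cexp.
  rewrite (@le_trans _ _ (expR (`|complex.Re l| * T) * (M * rnorm x)))//; last first.
    by rewrite mulrA [_ * M]mulrC.
  apply: ler_pM; rewrite ?expR_ge0 ?rnorm_ge0 ?SM// ler_expR.
  case: (l) => a b /=; rewrite (le_trans (ler_norm _))// normrM normrN (ger0_norm t0).
  by rewrite ler_wpM2l.
- move=> x e e0; have x1 : 0 < rnorm x + 1 by rewrite ltr_wpDl ?rnorm_ge0.
  have e1 : 0 < e / 4 by rewrite divr_gt0.
  have e2 : 0 < e / 2 / (rnorm x + 1) by rewrite !divr_gt0.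
  have [d1 d10 h1] := C0_cvg x SC e1; have [d2 d20 h2] := cexp_near1 (- l) e2.
  have [d3 d30 h3] := cexp_near1 (- l) ltr01.
  exists (Num.min d1 (Num.min d2 d3)); first by rewrite !lt_min d10 d20.
  move=> h; rewrite !lt_min => /andP[h0 /and3P[k1 k2 k3]].
  have := h1 h; rewrite h0 k1 => /(_ isT) b1.
  have := h2 h; rewrite h0 k2 => /(_ isT) b2.
  have := h3 h; rewrite h0 k3 => /(_ isT) b3.
  rewrite (_ : rescaled S l h x - x = cexp (- l) h *: (S h x - x) + (cexp (- l) h - 1) *: x); last first.
    by rewrite /rescaled scalerBr scalerBl scale1r addrA subrK.
  rewrite (le_trans (rnormD _ _))// [leRHS]splitr lerD// rnormZ.
    have -> : e / 2 = 2 * (e / 4) by field.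
    by rewrite ler_pM ?normc_ge0 ?rnorm_ge0// normc_le2.
  rewrite (le_trans (ler_wpM2r (rnorm_ge0 _) b2))// mulrAC ler_pdivrMr//.
  by rewrite ler_wpM2l ?divr_ge0 ?ltW// ltrDl.
Qed.

Lemma rescaled_derivative S l x w : C0_semigroup S -> generator S (x, w) ->
  orbit_derivative (rescaled S l) x (w - l *: x).
Proof.
move=> SC /generatorP gx e e0; have [_ S0 _ _] := SC.
have x1 : 0 < rnorm x + 1 by rewrite ltr_wpDl ?rnorm_ge0.
have w1 : 0 < rnorm w + 1 by rewrite ltr_wpDl ?rnorm_ge0.
have e1 : 0 < e / 6 by rewrite divr_gt0.
have e2 : 0 < e / 3 / (rnorm x + 1) by rewrite !divr_gt0.
have e3 : 0 < e / 3 / (rnorm w + 1) by rewrite !divr_gt0.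
have [d1 d10 h1] := gx _ e1; have [d2 d20 h2] := cexp_derive0 (- l) e2.
have [d3 d30 h3] := cexp_near1 (- l) ltr01; have [d4 d40 h4] := cexp_near1 (- l) e3.
exists (Num.min (Num.min d1 d2) (Num.min d3 d4)); first by rewrite !lt_min d10 d20 d30.
move=> h; rewrite !lt_min => /andP[h0 /andP[/andP[k1 k2] /andP[k3 k4]]].
have [->|hN0] := eqVneq h 0.
  by rewrite /rescaled cexp0 S0 scale1r subrr scale0r subrr rnorm0 mulr0.
have hp : 0 < h by rewrite lt_def hN0.
have := h1 h; rewrite hp k1 => /(_ isT) b1; have := h2 h; rewrite h0 k2 => /(_ isT) b2.
have := h3 h; rewrite h0 k3 => /(_ isT) b3; have := h4 h; rewrite h0 k4 => /(_ isT) b4.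
(* Product rule with its remainders: that of the orbit, that of the exponential, and the cross term.
   The first is at most [e / 6 * h] times a modulus at most 2, so each term takes a third of
   [e * h]. *)
rewrite (_ : _ - _ = cexp (- l) h *: (S h x - x - h%:C *: w) +
  ((cexp (- l) h - 1 - h%:C * - l) *: x + (h%:C * (cexp (- l) h - 1)) *: w)); last first.
  rewrite /rescaled !scalerBr !scalerBl !scalerA mulrBr scalerBl mulr1 scale1r mulrN scaleNr opprK.
  rewrite [cexp _ _ * h%:C]mulrC opprB.
  set a := cexp (- l) h *: S h x; set b := cexp (- l) h *: x; set c := (h%:C * cexp (- l) h) *: w.
  by rewrite [RHS](AC (3*(3*2)) (((1*5)*(6*8))*((2*4)*(3*7)))) /= !addNr !addr0.
have -> : e = e / 3 + (e / 3 + e / 3) by field.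
rewrite !mulrDl (le_trans (rnormD _ _))// lerD//.
  have -> : e / 3 * h = 2 * (e / 6 * h) by field.
  by rewrite rnormZ ler_pM ?normc_ge0 ?rnorm_ge0// normc_le2.
rewrite (le_trans (rnormD _ _))// lerD// rnormZ.
  rewrite (le_trans (ler_wpM2r (rnorm_ge0 _) b2))// mulrAC ler_wpM2r//.
  by rewrite mulrAC ler_pdivrMr// ler_wpM2l ?divr_ge0 ?(ltW e0)// lerDl.
rewrite normcM normc_real ger0_norm// -mulrA mulrC ler_wpM2r//.
rewrite (le_trans (ler_wpM2r (rnorm_ge0 _) b4))// mulrAC ler_pdivrMr//.
by rewrite ler_wpM2l ?divr_ge0 ?(ltW e0)// lerDl.
Qed.

End Generator.

Section GeneratorTheory.
Context {R : realType} {V : normedModType R[i]}.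
Variables (S : R -> V -> V).
Hypothesis SC : C0_semigroup S.
Implicit Types (x y z w : V) (l a : R[i]).
Local Notation A := (generator S).

Let S_lin t : 0 <= t -> linear (S t).
Proof. by move=> t0; case: SC => h _ _ _; exact: (h t t0).1. Qed.

Lemma C0_bounded t : 0 <= t -> exists2 M : R, 0 <= M & bounded_by M (S t).
Proof.
by move=> t0; case: SC => h _ _ _; have [h1 h2] := h t t0; exact: linear_continuous_bounded.
Qed.

Lemma generator_lin a x y x' y' : A (x, y) -> A (x', y') -> A (a *: x + x', a *: y + y').
Proof.
move=> /generatorP g /generatorP g'; apply/generatorP => e e0.
have a1 : 0 < normc a + 1 by rewrite ltr_wpDl ?normc_ge0.
have e1 : 0 < e / 2 / (normc a + 1) by rewrite !divr_gt0.
have e2 : 0 < e / 2 by rewrite divr_gt0.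
have [d d0 hd] := g _ e1; have [d' d'0 hd'] := g' _ e2.
exists (Num.min d d') => [|h]; first by rewrite lt_min d0.
rewrite lt_min => /and3P[h0 h1 h2].
have := hd h; rewrite h0 h1 => /(_ isT) b1; have := hd' h; rewrite h0 h2 => /(_ isT) b2.
rewrite (_ : _ - _ = a *: (S h x - x - h%:C *: y) + (S h x' - x' - h%:C *: y')); last first.
  rewrite (S_lin (ltW h0)) !scalerBr !scalerDr !scalerA [a * _]mulrC !opprD.
  by rewrite [LHS](AC ((2*2)*2) ((1*3*5)*(2*4*6))).
rewrite (le_trans (rnormD _ _))// [e in leRHS]splitr mulrDl lerD// rnormZ.
rewrite (le_trans (ler_wpM2l (normc_ge0 _) b1))// mulrA ler_wpM2r ?(ltW h0)//.
by rewrite mulrCA ger_pMr// ler_pdivrMr// mul1r lerDl.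
Qed.

Lemma generator_fun x y y' : A (x, y) -> A (x, y') -> y = y'.
Proof. by move=> h h'; exact: (cvg_unique _ h h'). Qed.

Lemma generator_semigroup t x y : 0 <= t -> A (x, y) -> A (S t x, S t y).
Proof.
move=> t0 /generatorP g; apply/generatorP => e e0.
have [M M0 hM] := C0_bounded t0; have M1 : 0 < M + 1 by rewrite ltr_wpDl.
have e1 : 0 < e / (M + 1) by rewrite divr_gt0.
have [d d0 hd] := g _ e1; exists d => // h /andP[h0 h1].
have := hd h; rewrite h0 h1 => /(_ isT) b1.
have [_ _ Sa _] := SC.
rewrite (_ : _ - _ = S t (S h x - x - h%:C *: y)); last first.
  have SB u v : S t (u - v) = S t u - S t v.
    by rewrite addrC -scaleN1r (S_lin t0) scaleN1r addrC.
  have SZ b u : S t (b *: u) = b *: S t u.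
    by rewrite -[b *: u]addr0 (S_lin t0) (linear_at0 (S_lin t0)) addr0.
  have e2 : S h (S t x) = S t (S h x) by rewrite -!Sa ?(ltW h0)// addrC.
  by rewrite !SB SZ e2.
rewrite (le_trans (hM _))// (le_trans (ler_wpM2l M0 b1))// mulrA ler_wpM2r ?(ltW h0)//.
by rewrite mulrCA ger_pMr// ler_pdivrMr// mul1r lerDl.
Qed.

Section Resolvent.
Variables (l : R[i]) (hl : resolvent_set A l).

Lemma resolventP y : exists2 w, A (resolvent A l y, w) & l *: resolvent A l y - w = y.
Proof.
have [h _] := hl; have [x [hx _]] := h y.
by rewrite /resolvent; case: xgetP => [z -> //|/(_ x)].
Qed.

Lemma resolventK x w : A (x, w) -> resolvent A l (l *: x - w) = x.
Proof.
move=> xw; have [h _] := hl; have [z [_ hz]] := h (l *: x - w).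
by rewrite -(hz _ (resolventP _)); apply: hz; exists w.
Qed.

Lemma resolvent_linear : linear (resolvent A l).
Proof.
move=> a y y'; have [w h1 h2] := resolventP y; have [w' h1' h2'] := resolventP y'.
have := resolventK (@generator_lin a _ _ _ _ h1 h1').
rewrite (_ : l *: _ - _ = a *: y + y')// -[in RHS]h2 -[in RHS]h2'.
by rewrite scalerDr scalerBr !scalerA [l * a]mulrC opprD addrACA.
Qed.

Lemma resolvent_bounded : exists2 M : R, 0 <= M & bounded_by M (resolvent A l).
Proof.
have [_ [M hM]] := hl; exists `|M| => // y; have [w h1 h2] := resolventP y.
have := hM _ _ h1; rewrite h2 => /le_trans; apply.
by rewrite ler_wpM2r ?rnorm_ge0// ler_norm.
Qed.

Lemma resolvent_semigroup t y : 0 <= t -> S t (resolvent A l y) = resolvent A l (S t y).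
Proof.
move=> t0; have [w h1 h2] := resolventP y.
rewrite -(resolventK (generator_semigroup t0 h1)) -[in RHS]h2.
have SB u v : S t (u - v) = S t u - S t v.
  by rewrite addrC -scaleN1r (S_lin t0) scaleN1r addrC.
have SZ b u : S t (b *: u) = b *: S t u.
  by rewrite -[b *: u]addr0 (S_lin t0) (linear_at0 (S_lin t0)) addr0.
by rewrite SB SZ.
Qed.

End Resolvent.

End GeneratorTheory.

(** * Invertibility of 1 - Q *)

Section SemigroupInverse.
Context {R : realType} {V : completeNormedModType R[i]}.
Variables (S : R -> V -> V) (w0 M omega T : R).
Hypothesis SC : C0_semigroup S.
Hypothesis M0 : 0 <= M.
Hypothesis hS : forall t x, 0 <= t -> rnorm (S t x) <= M * expR (w0 * t) * rnorm x.
Hypothesis T0 : 0 < T.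
Hypothesis w0_lt : w0 < omega.
Implicit Types (x y : V).

Definition decay_step (x : V) : V := (expR (- (omega * T)))%:C *: S T x.
Local Notation Q := decay_step.

Let S_lin t : 0 <= t -> linear (S t).
Proof. by move=> t0; case: SC => h _ _ _; exact: (h t t0).1. Qed.

Let SZ t b u : 0 <= t -> S t (b *: u) = b *: S t u.
Proof.
by move=> t0; rewrite -[b *: u]addr0 (S_lin t0) (linear_at0 (S_lin t0)) addr0.
Qed.

Lemma decay_step_linear : linear Q.
Proof. by move=> a x y; rewrite /Q (S_lin (ltW T0)) scalerDr !scalerA [_ * a]mulrC. Qed.

Let Q_iter k x : iter k Q x = (expR (- (omega * (k%:R * T))))%:C *: S (k%:R * T) x.
Proof.
have [_ S0 Sa _] := SC.
elim: k => [|k ih]; first by rewrite mul0r mulr0 oppr0 expR0 scale1r S0.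
rewrite iterS ih /Q SZ ?(ltW T0)// scalerA -rmorphM/= -expRD -Sa ?mulr_ge0 ?(ltW T0)//.
by congr ((expR _)%:C *: S _ _); rewrite -natr1; ring.
Qed.

Let q := expR ((w0 - omega) * T).
Let q0 : 0 <= q. Proof. exact: expR_ge0. Qed.
Let q1 : q < 1.
Proof. by rewrite expR_lt1 pmulr_llt0// subr_lt0. Qed.

Let Q_iter_bound k x : rnorm (iter k Q x) <= M * q ^+ k * rnorm x.
Proof.
rewrite Q_iter rnormZ normc_real ger0_norm ?expR_ge0//.
have k0 : 0 <= k%:R * T by rewrite mulr_ge0// ltW.
rewrite (le_trans (ler_wpM2l (expR_ge0 _) (hS x k0)))//.
rewrite !mulrA ler_wpM2r ?rnorm_ge0// mulrAC -expRD mulrC /q -expRM_natl.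
by rewrite le_eqVlt; apply/orP; left; apply/eqP; congr (_ * expR _); ring.
Qed.

Let geom_le n : \sum_(k < n) q ^+ k <= (1 - q)^-1.
Proof.
have d0 : 0 < 1 - q by rewrite subr_gt0.
rewrite -[leRHS]mul1r ler_pdivlMr//.
have -> : (\sum_(k < n) q ^+ k) * (1 - q) = 1 - q ^+ n.
  elim: n => [|n ih]; first by rewrite big_ord0 mul0r expr0 subrr.
  by rewrite big_ord_recr/= mulrDl ih exprS; ring.
by rewrite gerBl exprn_ge0.
Qed.

Let q_small e : 0 < e -> exists n, q ^+ n <= e.
Proof.
move=> e0; have /cvgrPdist_le/(_ _ e0)[N _ hN] : GRing.exp q n @[n --> \oo] --> (0 : R).
  by apply: cvg_expr; rewrite ger0_norm.
exists N; have := hN N (leqnn _); rewrite sub0r normrN ger0_norm//; exact: exprn_ge0.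
Qed.

(** A Neumann series: [Q] itself need not be a contraction, but its k-th power has norm at most
    [M * q ^ k] with [q < 1]. Preimages under 1 - Q are selected by choice, and injectivity of 1 - Q
    makes the selection linear. *)
Lemma decay_inverse_exists : exists2 N : V -> V, linear N &
  exists2 C : R, 0 <= C &
    [/\ bounded_by C N, forall y, N y - Q (N y) = y & forall y, N (y - Q y) = y].
Proof.
have d0 : 0 < 1 - q by rewrite subr_gt0.
pose C := M / (1 - q); have C0 : 0 <= C by rewrite divr_ge0// ltW.
have QB x y : Q (x - y) = Q x - Q y.
  by rewrite addrC -scaleN1r decay_step_linear scaleN1r addrC.
have inj x : x - Q x = 0 -> x = 0.
  move=> /eqP; rewrite subr_eq0 => /eqP xQ.
  have it k : x = iter k Q x by elim: k => // k ih; rewrite iterS -ih.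
  apply: rnorm_eq0; apply/eqP; rewrite eq_le rnorm_ge0 andbT.
  apply: (@le_mul_eps _ _ _ (M * rnorm x)); first by rewrite mulr_ge0 ?rnorm_ge0.
  move=> e e0; rewrite add0r; have [n hn] := q_small e0.
  rewrite {1}(it n) (le_trans (Q_iter_bound n x))// mulrAC ler_wpM2l//.
  by rewrite mulr_ge0 ?rnorm_ge0.
have sur y : exists x, x - Q x = y /\ rnorm x <= C * rnorm y.
  pose s n := \sum_(k < n) iter k Q y.
  have sC m n : rnorm (s (n + m)%N - s n) <= C * rnorm y * q ^+ n.
    rewrite /s big_split_ord/= [X in rnorm (X - _)]addrC addrK (le_trans (rnorm_sum _ _ _))//.
    rewrite (@le_trans _ _ (\sum_(k < m) (M * rnorm y * q ^+ n) * q ^+ k))//.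
      apply: ler_sum => k _; rewrite (le_trans (Q_iter_bound _ _))// exprD.
      by rewrite le_eqVlt; apply/orP; left; apply/eqP; ring.
    rewrite -mulr_sumr (le_trans (ler_wpM2l _ (geom_le m)))//.
      by rewrite !mulr_ge0 ?rnorm_ge0 ?exprn_ge0.
    by rewrite /C le_eqVlt; apply/orP; left; apply/eqP; ring.
  have [|x hx] := @rcomplete _ V s.
    move=> e e0; pose K := 2 * (C * rnorm y) + 1.
    have K0 : 0 < K by rewrite ltr_wpDl// mulr_ge0// mulr_ge0 ?rnorm_ge0.
    have [|N hN] := @q_small (e / K); first by rewrite divr_gt0.
    exists N => m n hm hn; rewrite (le_trans (rdistD (s N) _ _))//.
    rewrite (rdistC (s N)) -(subnKC hm) -(subnKC hn).
    rewrite (le_trans (lerD (sC _ _) (sC _ _)))//.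
    rewrite ler_pdivlMr// in hN; apply: le_trans hN.
    rewrite -mulrDl mulrC ler_wpM2l ?exprn_ge0// /K.
    by rewrite mulr_natl mulr2n lerDl.
  exists x; split; last first.
    apply: (@le_mul_eps _ _ _ 1) => // e e0; rewrite mul1r.
    have [N hN] := (rcvg_seqP _ _).1 hx _ e0.
    rewrite -(subrK (s N) x) (le_trans (rnormD _ _))// addrC lerD//.
      have := sC N 0%N; rewrite add0n expr0 mulr1 {2}/s big_ord0 subr0.
      exact.
    by rewrite rdistC hN.
  apply/eqP; rewrite -subr_eq0 -rnorm_eq0E eq_le rnorm_ge0 andbT.
  apply: (@le_mul_eps _ _ _ (1 + M * q ^+ 1 + M * rnorm y)).
    by rewrite !addr_ge0 ?mulr_ge0 ?rnorm_ge0 ?exprn_ge0.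
  move=> e e0; rewrite add0r; have [N1 hN1] := (rcvg_seqP _ _).1 hx _ e0.
  have [N2 hN2] := q_small e0; pose n := maxn N1 N2.
  have hq : q ^+ n <= e.
    apply: le_trans hN2; apply: ler_wiXn2l; rewrite ?leq_maxr ?(ltW q1)//.
  have h1 : rnorm (s n - x) <= e by rewrite hN1 ?leq_maxl.
  have sQ : s n - Q (s n) = y - iter n Q y.
    rewrite /s; elim: (n) => [|m ih]; first by rewrite big_ord0 (linear_at0 decay_step_linear) !subrr.
    rewrite big_ord_recr/=; have -> u v : Q (u + v) = Q u + Q v.
      by have := decay_step_linear 1 u v; rewrite !scale1r.
    by rewrite opprD addrACA ih addrA subrK.
  rewrite (_ : x - Q x - y = (x - s n) - Q (x - s n) - iter n Q y); last first.
    have ey : y = (s n - Q (s n)) + iter n Q y by rewrite sQ subrK.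
    rewrite [X in _ - X = _]ey.
    by rewrite QB !opprD !opprK !addrA; rewrite [LHS](ACl (1*3*2*4*5)%AC).
  rewrite (le_trans (rnormB _ _))// !mulrDl lerD//; last first.
    rewrite (le_trans (Q_iter_bound n y))// mulrAC ler_wpM2l//.
    by rewrite mulr_ge0 ?rnorm_ge0.
  rewrite mul1r (le_trans (rnormB _ _))// lerD//; first by rewrite rdistC.
  rewrite (le_trans (Q_iter_bound 1 _))// ler_wpM2l ?mulr_ge0 ?exprn_ge0//.
  by rewrite rdistC.
have /choice[N hN] := sur.
have dinj x y : x - Q x = y - Q y -> x = y.
  move=> e; apply/eqP; rewrite -subr_eq0; apply/eqP/inj.
  by rewrite QB opprD opprK addrACA e [- y + _]addrC addrA subrK subrr.
exists N; last first.
  by exists C => //; split=> y; [exact: (hN y).2|exact: (hN y).1|apply: dinj; exact: (hN _).1].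
move=> a x y; apply: dinj; rewrite (hN _).1 decay_step_linear opprD addrACA -scalerBr.
by rewrite !(hN _).1.
Qed.

End SemigroupInverse.

Lemma nint_bounded_lty (R : realType) (V : normedModType R[i]) T (f : R -> V) (c : R) :
  0 <= T -> strongly_measurable T f -> (forall t, t \in `[0, T] -> rnorm (f t) <= c) ->
  (\int[@lebesgue_measure R]_(t in `[0%R, T]) (rnorm (f t))%:E < +oo)%E.
Proof.
move=> T0 mf hc; apply: (@le_lt_trans _ _ (c * T)%:E); last by rewrite ltry.
rewrite -(nint_cst c T0); apply: nint_le => [| |t ht]; last by rewrite rnorm_ge0 hc.
  exact: strongly_measurable_norm.
exact: measurable_cst.
Qed.

(** * Resolvents as integrals over one period *)

Section Laplace.
Context {R : realType} {V : completeNormedModType R[i]}.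
Hypothesis sV : separable V.
Implicit Types (x y z v w : V) (l a : R[i]) (T M : R).

Lemma bochner_exists_bounded T (f : R -> V) (c : R) : 0 <= T -> strongly_measurable T f ->
  (forall t, t \in `[0, T] -> rnorm (f t) <= c) -> exists v, is_bochner_integral T f v.
Proof.
by move=> T0 mf hc; apply: bochner_exists => //; exact: (nint_bounded_lty T0 mf hc).
Qed.

Lemma bochner_cst T v : 0 < T -> is_bochner_integral T (fun=> v) (T%:C *: v).
Proof.
move=> T0; have := @bochner_FTC R V T T0 (fun=> v) (fun t => t%:C *: v).
rewrite scale0r subr0; apply=> e e0; exists 1 => // s t s0 st tT _; split; last first.
  by rewrite subrr rnorm0 ltW.
by rewrite -scalerBl rmorphB/= subrr rnorm0 mulr_ge0 ?subr_ge0// ltW.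
Qed.

Lemma bochner_norm_bounded T (f : R -> V) v (c : R) : 0 <= T -> strongly_measurable T f ->
  (forall t, t \in `[0, T] -> rnorm (f t) <= c) -> is_bochner_integral T f v ->
  rnorm v <= c * T.
Proof.
move=> T0 mf hc hv; rewrite -lee_fin (le_trans (bochner_norm hv))// -(nint_cst c T0).
apply: nint_le => [| |t ht]; last by rewrite rnorm_ge0 hc.
  exact: strongly_measurable_norm.
exact: measurable_cst.
Qed.

Lemma sg_bochner_exists T M P y : 0 < T -> 0 <= M -> bounded_semigroup T M P ->
  exists2 v, is_bochner_integral T (P ^~ y) v & rnorm v <= M * rnorm y * T.
Proof.
move=> T0 M0 hP.
have mP : strongly_measurable T (P ^~ y).
  exact: continuous_on_strongly_measurable (sg_continuous_on M0 hP y).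
have bP t : t \in `[0, T] -> rnorm (P t y) <= M * rnorm y.
  by rewrite in_itv/= => ht; exact: (sg_bound hP).
have [v hv] := bochner_exists_bounded (ltW T0) mP bP.
by exists v => //; exact: bochner_norm_bounded (ltW T0) mP bP hv.
Qed.

Variables (S : R -> V -> V) (SC : C0_semigroup S).
Local Notation A := (generator S).

Variables (w0 M : R).
Hypothesis M0 : 0 <= M.
Hypothesis hS : forall t x, 0 <= t -> rnorm (S t x) <= M * expR (w0 * t) * rnorm x.

Let bnd T := M * expR (`|w0| * T).
Let rbnd l T := bnd T * expR (`|complex.Re l| * T).

Lemma rescaled_bounded_semigroup l T : 0 <= T -> exists2 c : R, 0 <= c &
  bounded_semigroup T c (rescaled S l).
Proof.
move=> T0; exists (rbnd l T); first by rewrite !mulr_ge0 ?expR_ge0.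
apply: rescaled_semigroup => //; first by rewrite mulr_ge0 ?expR_ge0.
move=> t /andP[t0 tT] x; rewrite (le_trans (hS _ t0))// ler_wpM2r ?rnorm_ge0// ler_wpM2l//.
by rewrite ler_expR (le_trans (ler_norm _))// normrM (ger0_norm t0) ler_wpM2l.
Qed.

Variables (beta : R[i]) (hbeta : resolvent_set A beta).

(* Conjugating by the resolvent at [beta] moves the integral into the domain of
   the generator, which avoids using that the generator is closed. *)
Lemma laplace_generator l T y v : 0 < T ->
  is_bochner_integral T (rescaled S l ^~ y) v ->
  A (v, l *: v - (y - rescaled S l T y)).
Proof.
move=> T0 hv; have [c c0 hP] := rescaled_bounded_semigroup l (ltW T0).
set P := rescaled S l in hv hP *.
have [w xw bxw] := resolventP hbeta y; set x := resolvent A beta y in xw bxw.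
have Rlin := resolvent_linear SC hbeta.
have [K K0 hK] := resolvent_bounded hbeta.
have RP t z : 0 <= t -> resolvent A beta (P t z) = P t (resolvent A beta z).
  move=> t0; rewrite /P /rescaled (resolvent_semigroup SC hbeta _ t0).
  rewrite -[X in resolvent A beta X]addr0 Rlin (linear_at0 Rlin) addr0 //.
have h1 := sg_bochner T0 c0 hP (rescaled_derivative l SC xw).
have h2 := bochner_map Rlin K0 hK hv.
(* With [y = beta x - w], split [P t y] as [(beta - l) P t x + P t (l x - w)]. The first summand is
   a multiple of the resolvent at [beta] of [P t y]; the second is minus the derivative of the orbit
   of [x]. So [v] itself becomes a value of that resolvent. *)
have h3 : is_bochner_integral T (P ^~ y)
    ((beta - l) *: resolvent A beta v + (-1) *: (P T x - x)).
  have h2' := bochner_lin (beta - l) h2 (bochnerZ (-1) h1).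
  apply: bochner_ext h2' => t; rewrite in_itv/= => /andP[t0 _].
  rewrite RP// -/x -[X in _ + X](sg_linearZ hP)// -(sg_linear hP t0).
  by rewrite scaleN1r opprB scalerBl addrA subrK bxw.
have ev := bochner_unique hv h3.
pose z := (beta - l) *: v + (y - P T y).
have ez : resolvent A beta z = v.
  rewrite [RHS]ev /z Rlin; congr (_ + _).
  have RB (a b : V) : resolvent A beta (a - b) = resolvent A beta a - resolvent A beta b.
    by rewrite addrC -scaleN1r Rlin scaleN1r addrC.
  by rewrite RB (RP _ _ (ltW T0)) -/x scaleN1r opprB.
have [w' vw' bvw'] := resolventP hbeta z; rewrite ez in vw' bvw'.
suff -> : l *: v - (y - P T y) = w' by [].
rewrite -[w'](subKr (beta *: v)) bvw' /z scalerBl.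
by rewrite [in RHS]opprD [RHS]addrA subKr.
Qed.

(** Averages of the orbit of [x] over short intervals [0, h] lie in the domain by
    [laplace_generator] with [l = 0], and tend to [x]. *)
Lemma generator_dense x e : 0 < e -> exists2 y, op_dom A y & rnorm (x - y) <= e.
Proof.
move=> e0; have [d d0 hd] := C0_cvg x SC e0.
pose h := d / 2; have h0 : 0 < h by rewrite divr_gt0.
have [c c0 hP] := rescaled_bounded_semigroup 0 (ltW h0).
have [v hv _] := sg_bochner_exists x h0 c0 hP.
have P0 t : rescaled S 0 t x = S t x.
  by rewrite /rescaled oppr0 /cexp/= !mul0r expR0 cis0 mulr1 scale1r.
have hA := laplace_generator h0 hv.
have hh : h%:C != 0 :> R[i] by rewrite (inj_eq (@complexI _)) gt_eqF.
exists (h^-1%:C *: v).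
  have := @generator_lin _ _ _ SC (h^-1%:C - 1) _ _ _ _ hA hA.
  by rewrite scalerBl scale1r subrK => hA'; eexists; exact: hA'.
have hB := bochnerB hv (bochner_cst x h0).
have : rnorm (v - h%:C *: x) <= e * h.
  apply: bochner_norm_bounded hB => //; first exact: ltW.
    have cP := continuous_onD (sg_continuous_on c0 hP x) (continuous_on_cst (- x)).
    exact: continuous_on_strongly_measurable cP.
  move=> t; rewrite in_itv/= P0 => /andP[t0 th]; apply: hd; rewrite t0/=.
  by rewrite (le_lt_trans th)// /h ltr_pdivrMr// ltr_pMr// ltr1n.
rewrite (_ : v - _ = h%:C *: ((h^-1)%:C *: v - x)); last first.
  by rewrite scalerBr scalerA -rmorphM/= divff ?gt_eqF// scale1r.
by rewrite rnormZ normc_real gtr0_norm// mulrC ler_pM2r// rdistC.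
Qed.

Variables (omega T : R) (T0 : 0 < T) (w0_lt : w0 < omega).
Local Notation Q := (decay_step S omega T).

Section Frequency.
Variables (l : R[i]).
Hypothesis hQ : rescaled S l T = Q.

Lemma generator_laplace x w : A (x, w) ->
  is_bochner_integral T (rescaled S l ^~ (l *: x - w)) (x - Q x).
Proof.
move=> xw; have [c c0 hP] := rescaled_bounded_semigroup l (ltW T0).
have h := bochnerZ (-1) (sg_bochner T0 c0 hP (rescaled_derivative l SC xw)).
rewrite hQ scaleN1r opprB in h; apply: bochner_ext h => t.
rewrite in_itv/= => /andP[t0 _].
by rewrite -(sg_linearZ hP)// scaleN1r opprB.
Qed.

(** The equation with right-hand side [y] is solved by integrating the rescaled orbit of [N y],
    where [N] inverts 1 - Q, over the single interval [0, T]. Uniqueness comes from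
    [generator_laplace], which determines [x - Q x] from [l x - w]. *)
Lemma laplace_resolvent_set : resolvent_set A l.
Proof.
have [c c0 hP] := rescaled_bounded_semigroup l (ltW T0).
have [N Nlin [C C0 [NC NK KN]]] := decay_inverse_exists SC M0 hS T0 w0_lt.
split=> [y|].
  have [v hv _] := sg_bochner_exists (N y) T0 c0 hP.
  have := laplace_generator T0 hv; rewrite hQ NK => vA.
  exists v; split; first by exists (l *: v - y) => //; rewrite subKr.
  move=> x [w xw exw]; have := laplace_generator T0 hv; rewrite hQ NK => /generator_laplace.
  rewrite subKr => h1; have := generator_laplace xw; rewrite exw => h2.
  by rewrite -(KN v) -(KN x) (bochner_unique h1 h2).
exists (C * (c * T)) => x w xw.
have [v hv bv] := sg_bochner_exists (l *: x - w) T0 c0 hP.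
rewrite -{1}(KN x) (bochner_unique (generator_laplace xw) hv).
rewrite (le_trans (NC _))// -mulrA ler_wpM2l// (le_trans bv)//.
by rewrite mulrAC.
Qed.

Lemma laplace_resolvent x :
  is_bochner_integral T (rescaled S l ^~ x) (resolvent A l (x - Q x)).
Proof.
have [c c0 hP] := rescaled_bounded_semigroup l (ltW T0).
have [v hv _] := sg_bochner_exists x T0 c0 hP.
have := laplace_generator T0 hv; rewrite hQ => /(resolventK laplace_resolvent_set).
by rewrite subKr => ->.
Qed.

End Frequency.
End Laplace.

Lemma growth_bound_lt (R : realType) (V : normedModType R[i]) (S : R -> V -> V) (omega : R) :
  (growth_bound S < omega%:E)%E -> exists w0 : R, w0 < omega /\ exists2 M : R, 0 <= M &
  forall t x, 0 <= t -> rnorm (S t x) <= M * expR (w0 * t) * rnorm x.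
Proof.
move=> /ereal_inf_lt[_ [w [M hM] <-]]; rewrite lte_fin => h; exists w; split => //.
exists `|M| => // t x t0; rewrite (le_trans (hM t x t0))//.
by rewrite -!mulrA ler_wpM2r ?ler_norm// mulr_ge0 ?expR_ge0 ?rnorm_ge0.
Qed.

(** * Observation *)

Section Weights.
Context {R : realType} {Y : hilbertType R}.
Hypothesis sY : separable Y.
Variables (T : R) (T0 : 0 < T).

Lemma L2_dom_bounded (f : R -> Y) (c : R) : strongly_measurable T f ->
  (forall t, t \in `[0, T] -> rnorm (f t) <= c) -> L2_dom T f.
Proof.
move=> mf hc; apply: (@L2_dominated _ _ _ _ (fun=> c ^+ 2)) => //.
- move=> t /hc h; rewrite !expr2 ler_pM ?rnorm_ge0//.
- by rewrite nint_cst ?ltW// ltry.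
Qed.

(** Used with both signs of [a]: the exponential weight is an isomorphism of L^2, inverted through
    [cexp_weightK]. *)
Lemma L2_weight (a : R) (f : R -> Y) : L2_dom T f ->
  L2_dom T (fun t => cexp a%:C t *: f t) /\
  @sqnorm R (L2 T Y) (fun t => cexp a%:C t *: f t) <=
  expR (`|a| * T) ^+ 2 * @sqnorm R (L2 T Y) f.
Proof.
move=> df; apply: L2_scalar => //; first exact: scalar_continuous_cexp.
move=> t; rewrite in_itv => /andP[t0 tT]; rewrite normc_cexp ler_expR.
by rewrite (le_trans (ler_norm _))// normrM (ger0_norm t0) ler_wpM2l.
Qed.

Lemma cexp_weightK (a : R) t (v : Y) : cexp a%:C t *: (cexp (- a)%:C t *: v) = v.
Proof. by rewrite scalerA rmorphN/= cexpK scale1r. Qed.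

(** Identifies a Fourier coefficient: once the scalar factors of the mode [g] are moved to the other
    argument, the integrand is [f t] against a fixed vector. *)
Lemma L2_dot_bochner (f g F : R -> Y) (u v : Y) :
  (forall t, t \in `[0, T] -> dot (F t) (g t) = dot (f t) u) ->
  is_bochner_integral T f v ->
  (\int[@lebesgue_measure R]_(t in `[0%R, T]) (rnorm (f t))%:E < +oo)%E ->
  L2_dot T F g = dot v u.
Proof.
move=> e hv fin.
have -> : dot v u = rdot v u +i* rdot v ('i *: u) by rewrite -Im_dot /rdot; case: (dot v u).
rewrite -(bochner_rdot u (ltW T0) hv fin) -(bochner_rdot ('i *: u) (ltW T0) hv fin).
rewrite /L2_dot; congr (_ +i* _); apply: eq_Rintegral => t /set_mem/= ht.
  by rewrite e.
by rewrite e// Im_dot.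
Qed.

Lemma L2_sqnorm_eq0 (f : R -> Y) : L2_dom T f -> @sqnorm R (L2 T Y) f = 0 ->
  {ae @lebesgue_measure R, forall t, t \in `[0, T] -> f t = 0}.
Proof.
move=> df f0.
have m : measurable_fun `[0, T] (fun t => (rnorm (f t) ^+ 2)%:E).
  by apply/measurable_EFinP; exact: measurable_sqnorm df.1.
have := L2_sqnorm df; rewrite f0 => /esym h.
have : {ae @lebesgue_measure R, forall t, `[0%R, T]%classic t -> (rnorm (f t) ^+ 2)%:E = 0%E}.
  apply/(ae_eq_integral_abs (@lebesgue_measure R) (measurable_itv _) m).
  by apply: (etrans _ h); apply: eq_integral => t _; rewrite abse_EFin ger0_norm// sqr_ge0.
apply: filterS; first exact: (ae_filter_ringOfSetsType (@lebesgue_measure R)).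
move=> t h2 ht; have := h2; rewrite /= => /(_ ht) [/eqP]; rewrite expf_eq0/= rnorm_eq0E.
by move=> /eqP.
Qed.

Lemma ae_eq_L2_sqnorm (f : R -> Y) : L2_dom T f ->
  {ae @lebesgue_measure R, forall t, t \in `[0, T] -> f t = 0} ->
  @sqnorm R (L2 T Y) f = 0.
Proof.
move=> df f0.
have m : measurable_fun `[0, T] (fun t => (rnorm (f t) ^+ 2)%:E).
  by apply/measurable_EFinP; exact: measurable_sqnorm df.1.
apply: EFin_inj; rewrite (L2_sqnorm df).
have [_ h] := ae_eq_integral_abs (@lebesgue_measure R) (measurable_itv `[0, T]) m.
apply: (etrans _ (h _)).
  by apply: eq_integral => t _; rewrite abse_EFin ger0_norm// sqr_ge0.
apply: filterS f0; first exact: (ae_filter_ringOfSetsType (@lebesgue_measure R)).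
by move=> t h2 ht; have := h2 ht => ->; rewrite rnorm0 expr0n.
Qed.

End Weights.

Section Frequencies.
Context {R : realType}.
Variables (T omega : R) (T0 : 0 < T).

Definition frequency (n : int) : R[i] := omega +i* (2 * pi * n%:~R / T).

Lemma cexp_frequency n t :
  conjc (fourier T n t) * cexp (- omega)%:C t = cexp (- frequency n) t.
Proof.
rewrite /cexp /fourier conjc_cis/= mul0r cis0 mulr1 mulrC; congr (_ * cis _).
by rewrite mulNr.
Qed.

Lemma cexp_frequencyN n t : cexp omega%:C t * fourier T n t = cexp (frequency n) t.
Proof. by rewrite /cexp /fourier/= mul0r cis0 mulr1. Qed.

Lemma cexp_frequency_period n : cexp (- frequency n) T = (expR (- (omega * T)))%:C.
Proof.
rewrite -cexp_frequency conjc_fourier /fourier -mulrA mulVf ?gt_eqF// mulr1 cis_2pi mul1r.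
by rewrite /cexp/= mul0r cis0 mulr1 mulNr.
Qed.

Lemma rescaled_frequency (V : completeNormedModType R[i]) (S : R -> V -> V) n :
  rescaled S (frequency n) T = decay_step S omega T.
Proof. by apply/funext => x; rewrite /rescaled cexp_frequency_period. Qed.

End Frequencies.

Lemma sqr_le_scale (R : realType) (x c e : R) : 0 <= x -> 0 <= c -> 0 <= e ->
  x ^+ 2 <= c * e ^+ 2 -> x <= Num.sqrt c * e.
Proof.
move=> x0 c0 e0 h; rewrite -(@ler_pXn2r _ 2) ?nnegrE ?mulr_ge0 ?sqrtr_ge0//.
by rewrite exprMn sqr_sqrtr.
Qed.

(** With [N] the identity this compares two bases, with [K] fixed. The 1 added to [C ^ 2] keeps the
    constant of the transfer positive when [C] is 0. *)
Lemma hil_transfer (R : realType) (H F : hilbertType R) (K : H -> F) (M : R)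
    (N : H -> H) (C : R) (B B' : set (hil H)) :
  linear K -> 0 <= M -> bounded_by M K -> linear N -> 0 <= C -> bounded_by C N ->
  orthonormal_basis B -> orthonormal_basis B' ->
  (\esum_(e in B') (rnorm (K (N e)) ^+ 2)%:E <=
   (C ^+ 2 + 1)%:E * \esum_(e in B) (rnorm (K e) ^+ 2)%:E)%E.
Proof.
move=> Klin M0 KM Nlin C0 NC hB hB'.
have [B1 B2] := orthonormal_basis_family hB; have [B1' _] := orthonormal_basis_family hB'.
apply: (@hilbert_schmidt_transfer R (hil H) (hil_axioms H) F K (M ^+ 2) _ _ _ _ _ B id B' N) => //.
- by move=> a x y _ _; exact: Klin.
- exact: sqr_ge0.
- by move=> x _; rewrite sqnorm_hil -exprMn ler_pXn2r ?nnegrE ?mulr_ge0 ?rnorm_ge0.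
- by rewrite ltr_wpDl ?sqr_ge0.
- apply: (orthonormal_bessel (hil_axioms H) B1') => // x _; rewrite !sqnorm_hil.
  rewrite (@le_trans _ _ (C ^+ 2 * rnorm x ^+ 2))//.
    by rewrite -exprMn ler_pXn2r ?nnegrE ?mulr_ge0 ?rnorm_ge0.
  by rewrite ler_wpM2r ?sqr_ge0// lerDl.
Qed.

(** Makes the infimum usable on a prescribed basis. The factor 2 is [1 ^ 2 + 1], from the transfer
    along the identity. *)
Lemma HS_norm2_ge_basis (R : realType) (H F : hilbertType R) (K : H -> F) (M : R) (B : set (hil H)) :
  linear K -> 0 <= M -> bounded_by M K -> orthonormal_basis B ->
  (\esum_(e in B) (rnorm (K e) ^+ 2)%:E <= 2%:E * @HS_norm2 R (hil H) (hil F) K)%E.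
Proof.
move=> Klin M0 KM hB; rewrite -lee_pdivrMl//; apply: le_ereal_inf_tmp => _ [B' hB' <-].
rewrite (_ : \esum_(e in B') _ = \esum_(e in B') (rnorm (K e) ^+ 2)%:E)%E; last first.
  by apply: eq_esum => e _; rewrite sqnorm_hil.
rewrite lee_pdivrMl// (le_trans (@hil_transfer _ _ _ K M id 1 B' B _ _ _ _ _ _ _ _))//.
  by move=> x; rewrite mul1r.
by rewrite expr1n.
Qed.

Lemma HS_norm2_le_basis (R : realType) (E : hilbertRep R) (F : hilbertType R) (K : E -> F) B :
  orthonormal_basis B ->
  (@HS_norm2 R E (hil F) K <= \esum_(e in B) (rnorm (K e) ^+ 2)%:E)%E.
Proof.
move=> hB; apply: ereal_inf_lbound; exists B => //.
by apply: eq_esum => e _; rewrite sqnorm_hil.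
Qed.

Section Observation.
Context {R : realType} {H Y : hilbertType R}.
Hypotheses (sH : separable H) (sY : separable Y).
Variables (S : R -> H -> H) (w0 M omega T : R).
Hypothesis SC : C0_semigroup S.
Hypothesis M0 : 0 <= M.
Hypothesis hS : forall t x, 0 <= t -> rnorm (S t x) <= M * expR (w0 * t) * rnorm x.
Hypothesis T0 : 0 < T.
Hypothesis w0_lt : w0 < omega.
Local Notation A := (generator S).
Variables (beta : R[i]) (hbeta : resolvent_set A beta).
Variables (C : H -> Y) (hC : bounded_on_H1 A beta C).
Local Notation Q := (decay_step S omega T).
Local Notation lam n := (frequency T omega n).
Local Notation K n := (fun z => C (resolvent A (lam n) z)).
Implicit Types (x y z w : H) (n : int) (v : Y).

Lemma frequency_resolvent_set n : resolvent_set A (lam n).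
Proof.
exact: (laplace_resolvent_set sH SC M0 hS hbeta T0 w0_lt (rescaled_frequency _ T0 S n)).
Qed.

(** If [l x - w = z], then [beta x - w = (beta - l) x + z]; so the norm at [beta] in which [C] is
    bounded is controlled on [R(l, A) z] by the norm of [z]. *)
Lemma observation_resolvent l : resolvent_set A l ->
  linear (fun z => C (resolvent A l z)) /\
  exists2 c : R, 0 <= c & bounded_by c (fun z => C (resolvent A l z)).
Proof.
move=> hl; have [Clin [c hc]] := hC; have Rlin := resolvent_linear SC hl; split.
  move=> a x y; rewrite Rlin Clin//.
    by have [w] := resolventP hl x; exists w.
  by have [w] := resolventP hl y; exists w.
have [c' c'0 hc'] := resolvent_bounded hl.
exists (`|c| * (normc (beta - l) * c' + 1)).
  by rewrite !mulr_ge0 ?addr_ge0 ?mulr_ge0 ?normc_ge0.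
move=> z; have [w h1 h2] := resolventP hl z.
rewrite (le_trans (hc _ _ h1))// (le_trans (ler_wpM2r _ (ler_norm c))) ?rnorm_ge0//.
rewrite -mulrA ler_wpM2l// (_ : beta *: _ - w = (beta - l) *: resolvent A l z + z); last first.
  by rewrite -[X in _ = _ + X]h2 scalerBl addrA subrK.
rewrite (le_trans (rnormD _ _))// rnormZ mulrDl mul1r lerD2r -mulrA ler_wpM2l ?normc_ge0//.
Qed.

Let Clin a x y : op_dom A x -> op_dom A y -> C (a *: x + y) = a *: C x + C y.
Proof. by case: hC => h _; exact: h. Qed.

Let CZ a x : op_dom A x -> C (a *: x) = a *: C x.
Proof.
by move=> h; have := Clin (a - 1) h h; rewrite !scalerBl !scale1r !subrK.
Qed.

Lemma op_dom_lin a x y : op_dom A x -> op_dom A y -> op_dom A (a *: x + y).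
Proof.
by move=> [w h] [w' h']; exists (a *: w + w'); exact: (@generator_lin _ _ _ SC a _ _ _ _ h h').
Qed.

(** Replaces the unbounded [C] by the bounded C R(beta, A), at the price of following the orbit of
    (beta - A) x. *)
Lemma orbit_observation x w t : A (x, w) -> 0 <= t ->
  C (S t x) = C (resolvent A beta (S t (beta *: x - w))).
Proof.
move=> xw t0; rewrite -(resolvent_semigroup SC hbeta _ t0).
by rewrite (resolventK hbeta xw).
Qed.

Let obs x t := C (S t x).

Lemma op_dom_orbit x t : op_dom A x -> 0 <= t -> op_dom A (S t x).
Proof. by move=> [w h] t0; exists (S t w); exact: generator_semigroup. Qed.

(** For [x] in the domain the output is a bounded operator applied to a continuous orbit, hence
    continuous and bounded on [0, T]. *)
Lemma L2_orbit x : op_dom A x -> L2_dom T (obs x).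
Proof.
move=> [w xw]; have [Klin [c c0 hc]] := observation_resolvent hbeta.
have [d d0 hP] := rescaled_bounded_semigroup SC M0 hS 0 (ltW T0).
have P0 t z : rescaled S 0 t z = S t z.
  by rewrite /rescaled oppr0 /cexp/= !mul0r expR0 cis0 mulr1 scale1r.
have e t : t \in `[0, T] -> obs x t = C (resolvent A beta (rescaled S 0 t (beta *: x - w))).
  by rewrite in_itv/= => /andP[t0 _]; rewrite P0 /obs (orbit_observation xw).
apply: (@L2_dom_bounded _ _ _ T0 _ (c * (d * rnorm (beta *: x - w)))).
  apply: continuous_on_strongly_measurable => // t t0 eps eps0.
  have c1 : 0 < c + 1 by rewrite ltr_wpDl.
  have eps1 : 0 < eps / (c + 1) by rewrite divr_gt0.
  have [d' d'0 hd'] := sg_continuous_on d0 hP (beta *: x - w) t0 eps1.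
  exists d' => // s s0 hs; have h := hd' s s0 hs.
  rewrite !e ?in_itv//=.
  have -> : forall a b : H, C (resolvent A beta a) - C (resolvent A beta b) =
    C (resolvent A beta (a - b)).
    by move=> a b; rewrite [in RHS]addrC -[in RHS]scaleN1r Klin scaleN1r addrC.
  rewrite (le_trans (hc _))// (le_trans (ler_wpM2l c0 h))// mulrCA ger_pMr//.
  by rewrite ler_pdivrMr// mul1r lerDl.
move=> t ht; rewrite e// (le_trans (hc _))// ler_wpM2l//.
by apply: (sg_bound hP); move: ht; rewrite in_itv.
Qed.

(** The integral of the rescaled orbit of [y = (beta - A) x] passes through C R(beta, A). The
    equality [RR] returns from [y] to [x]: both of its sides are integrals of the rescaled orbit of
    [x]. *)
Lemma orbit_coefficient n v x : op_dom A x ->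
  L2_dot T (fun t => cexp (- omega)%:C t *: C (S t x)) (mode_basis T (n, v : hil Y)) =
  dot (((Num.sqrt T)^-1)%:C *: C (resolvent A (lam n) (x - Q x))) v.
Proof.
move=> [w xw]; have [Klin [c c0 hc]] := observation_resolvent hbeta.
pose P := rescaled S (lam n); pose y := beta *: x - w.
have [d d0 hP] := rescaled_bounded_semigroup SC M0 hS (lam n) (ltW T0).
have hl := frequency_resolvent_set n.
have lapl z : is_bochner_integral T (P ^~ z) (resolvent A (lam n) (z - Q z)).
  exact: (laplace_resolvent sH SC M0 hS hbeta T0 w0_lt (rescaled_frequency _ T0 S n)).
have Rlin := resolvent_linear SC hbeta; have [k k0 hk] := resolvent_bounded hbeta.
have PR t : 0 <= t -> resolvent A beta (P t y) = P t x.
  move=> t0; rewrite /P /rescaled -[X in resolvent A beta X]addr0 Rlin (linear_at0 Rlin) addr0.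
  by rewrite -(resolvent_semigroup SC hbeta _ t0) (resolventK hbeta xw).
have RR : resolvent A beta (resolvent A (lam n) (y - Q y)) = resolvent A (lam n) (x - Q x).
  apply: bochner_unique (lapl x); apply: bochner_ext (bochner_map Rlin k0 hk (lapl y)).
  by move=> t; rewrite in_itv/= => /andP[t0 _]; exact: PR.
rewrite -[RHS]/(dot (_ *: C _) v) -RR.
have -> : dot (((Num.sqrt T)^-1)%:C *: C (resolvent A beta (resolvent A (lam n) (y - Q y)))) v =
  dot (C (resolvent A beta (resolvent A (lam n) (y - Q y)))) (((Num.sqrt T)^-1)%:C *: v).
  by rewrite dotZl dotZr conjc_real.
apply: (L2_dot_bochner T0 _ (bochner_map Klin c0 hc (lapl y))) => [t|].
  rewrite in_itv/= => /andP[t0 _]; rewrite /mode_basis /mode/= PR// /P /rescaled.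
  rewrite CZ; last exact: (op_dom_orbit (ex_intro _ w xw) t0).
  by rewrite -cexp_frequency !dotZl !dotZr; ring.
apply: (nint_bounded_lty (c := c * (d * rnorm y)) (ltW T0)).
  exact: bochner_measurable (bochner_map Klin c0 hc (lapl y)).
move=> t ht; rewrite (le_trans (hc _))// ler_wpM2l//.
by apply: (sg_bound hP); move: ht; rewrite in_itv.
Qed.

End Observation.

Section HilbertRepMore.
Context {R : realType}.

Lemma sqnormD_le (E : hilbertRep R) (hE : hilbert_axioms E) (x y : E) :
  rep_dom E x -> rep_dom E y -> sqnorm (x + y) <= 2 * sqnorm x + 2 * sqnorm y.
Proof.
move=> dx dy; have dy' : rep_dom E (-1 *: y) by exact: domZ.
have := sqnormB_le hE dx dy'; rewrite (sqnormZ hE (-1) dy).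
by rewrite scaleN1r opprK normcN normc1 expr1n mul1r.
Qed.

Lemma HS_norm2_ge0 (E : hilbertRep R) (F : hilbertRep R) (hF : hilbert_axioms F) (K : E -> F) :
  (forall x, rep_dom E x -> rep_dom F (K x)) -> (0 <= @HS_norm2 R E F K)%E.
Proof.
move=> hK; apply: le_ereal_inf_tmp => _ [B [hB _ _ _] <-]; apply: esum_ge0 => e he.
by rewrite lee_fin (rdot_ge0 hF)//; apply: hK; exact: hB.
Qed.

(** The operator norm is at most the Hilbert-Schmidt norm: the transfer is applied to the family
    with the single member [z]. *)
Lemma hilbert_schmidt_bound (H F : hilbertType R) (K : H -> F) (M : R) (B : set (hil H)) z :
  linear K -> 0 <= M -> bounded_by M K -> orthonormal_basis B ->
  ((rnorm (K z) ^+ 2)%:E <= (rnorm z ^+ 2)%:E * \esum_(e in B) (rnorm (K e) ^+ 2)%:E)%E.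
Proof.
move=> Klin M0 KM hB; have [->|z0] := eqVneq z 0.
  by rewrite (linear_at0 Klin) !rnorm0 expr0n/= mul0e.
have [B1 B2] := orthonormal_basis_family hB.
have := @hilbert_schmidt_transfer R (hil H) (hil_axioms H) F K (M ^+ 2) _ _ _ _ unit B id
  [set tt] (fun=> z) (rnorm z ^+ 2).
rewrite esum_set1 ?lee_fin ?sqr_ge0//; apply=> //.
- by move=> a x y _ _; exact: Klin.
- by move=> x _; rewrite sqnorm_hil -exprMn ler_pXn2r ?nnegrE ?mulr_ge0 ?rnorm_ge0.
- by rewrite exprn_gt0// lt_def rnorm_eq0E z0 rnorm_ge0.
case=> [|[] [|[] X]]//= a _ _; first by rewrite !big_nil mulr0 sqnorm_hil rnorm0 expr0n.
by rewrite !big_seq1 sqnorm_hil rnormZ exprMn mulrC.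
Qed.

Lemma L2_sqnorm_ext (Y : hilbertType R) (T : R) (f g : R -> Y) :
  (forall t, t \in `[0, T] -> f t = g t) -> @sqnorm R (L2 T Y) f = @sqnorm R (L2 T Y) g.
Proof.
by move=> e; rewrite /sqnorm !Re_L2_dot; apply: eq_Rintegral => t /set_mem/= ht; rewrite e.
Qed.

End HilbertRepMore.

Section ModeParseval.
Context {R : realType} {Y : hilbertType R} (sY : separable Y) (T : R) (T0 : 0 < T).

(** Parseval for the modes in L^2, followed, at each frequency, by Parseval in [Y]. *)
Lemma coefficients_parseval (f : R -> Y) (z : int -> Y) : L2_dom T f ->
  (forall n v, L2_dot T f (mode_basis T (n, v : hil Y)) = dot (z n) v) ->
  ((@sqnorm R (L2 T Y) f)%:E = \esum_(n in [set: int]) (rnorm (z n) ^+ 2)%:E)%E.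
Proof.
move=> df hz; have [F hF] := orthonormal_basis_exists Y.
have [F1 F2] := orthonormal_basis_family hF.
rewrite -(parseval (L2_axioms T sY) (mode_basis_orthonormal T0 sY hF)
  (mode_basis_complete T0 sY hF))//.
rewrite (_ : [set p | F p.2] = [set: int] `*`` (fun=> F)); last first.
  by apply/seteqP; split=> -[n v]/=; [|case].
transitivity (\esum_(n in [set: int]) \esum_(v in F) (normc (dot (z n) v) ^+ 2)%:E)%E.
  rewrite esum_esum; last by move=> *; rewrite lee_fin sqr_ge0.
  by apply: eq_esum => -[n v] _; rewrite /= -(hz n v).
apply: eq_esum => n _; have := @parseval R (hil Y) (hil_axioms Y) _ F id F1 F2 (z n) I.
by rewrite sqnorm_hil.
Qed.

End ModeParseval.

(** * Extension of the output map and its Hilbert-Schmidt norm *)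

Section ObservationExtension.
Context {R : realType} {H Y : hilbertType R}.
Hypotheses (sH : separable H) (sY : separable Y).
Variables (S : R -> H -> H) (w0 M omega T : R).
Hypothesis SC : C0_semigroup S.
Hypothesis M0 : 0 <= M.
Hypothesis hS : forall t x, 0 <= t -> rnorm (S t x) <= M * expR (w0 * t) * rnorm x.
Hypothesis T0 : 0 < T.
Hypothesis w0_lt : w0 < omega.
Local Notation A := (generator S).
Variables (beta : R[i]) (hbeta : resolvent_set A beta).
Variables (C : H -> Y) (hC : bounded_on_H1 A beta C).
Local Notation Q := (decay_step S omega T).
Local Notation lam n := (frequency T omega n).
Local Notation K n := (fun z => C (resolvent A (lam n) z)).
Local Notation obs x := (fun t => C (S t x)).
Local Notation k := (((Num.sqrt T)^-1)%:C).
Local Notation sq f := (@sqnorm R (L2 T Y) f).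
Local Notation W f := (fun t => cexp (- omega)%:C t *: f t).
Implicit Types (x y z w : H) (n : int) (v : Y).

Let L2A : hilbert_axioms (L2 T Y) := L2_axioms T sY.

Let K_lin n : linear (K n).
Proof. exact: (observation_resolvent SC hC (frequency_resolvent_set sH SC M0 hS T0 w0_lt hbeta n)).1. Qed.

Let K_bounded n : exists2 c : R, 0 <= c & bounded_by c (K n).
Proof. exact: (observation_resolvent SC hC (frequency_resolvent_set sH SC M0 hS T0 w0_lt hbeta n)).2. Qed.

Let Q_lin : linear (fun x => x - Q x).
Proof.
by move=> a x y; rewrite (@decay_step_linear _ _ _ omega _ SC T0) opprD addrACA -scalerBr.
Qed.

Let Q_bounded : exists2 c : R, 0 <= c & bounded_by c (fun x => x - Q x).
Proof.
exists (1 + normc (expR (- (omega * T)))%:C * (M * expR (w0 * T))).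
  by rewrite addr_ge0 ?mulr_ge0 ?normc_ge0 ?expR_ge0.
move=> x; rewrite (le_trans (rnormB _ _))// mulrDl mul1r lerD2l rnormZ -mulrA.
by rewrite ler_wpM2l ?normc_ge0// hS// ltW.
Qed.

Section Coefficients.
Variables (Psi : H -> R -> Y) (c : R).
Hypothesis c0 : 0 <= c.
Hypothesis Psi_dom : forall x, L2_dom T (Psi x).
Hypothesis Psi_near : forall x x', op_dom A x' ->
  sq (Psi x - obs x') <= c * rnorm (x - x') ^+ 2.

(** Known for domain vectors by [orbit_coefficient]; both sides vary continuously with [x], the left
    one by [Psi_near]. That hypothesis fits the extension given by admissibility as well as the one
    constructed below, so both directions share the formula. *)
Lemma extension_coefficient n v x :
  L2_dot T (W (Psi x)) (mode_basis T (n, v : hil Y)) = dot (k *: K n (x - Q x)) v.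
Proof.
have [cK cK0 hK] := K_bounded n; have [cQ cQ0 hQ] := Q_bounded.
set b := mode_basis _ _; have db : L2_dom T b by exact: L2_mode.
have b0 : 0 <= sq b by exact: (rdot_ge0 L2A).
pose k0 := expR (`|- omega| * T) ^+ 2; have k00 : 0 <= k0 by exact: sqr_ge0.
apply/eqP; rewrite -subr_eq0; apply/negP => /negP; rewrite -normc_gt0 ltNge => /negP; apply.
apply: (@le_mul_eps _ _ _ (Num.sqrt (k0 * c * sq b) + normc k * (cK * cQ) * rnorm v)).
  by rewrite addr_ge0 ?sqrtr_ge0 ?mulr_ge0 ?normc_ge0 ?rnorm_ge0.
move=> e e0; rewrite add0r.
have [x' dx' hx'] := generator_dense sH SC M0 hS hbeta x e0.
have dd : L2_dom T (Psi x - obs x') := domB L2A (Psi_dom x) (L2_orbit sY SC M0 hS T0 hbeta hC dx').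
have [dWd hWd] := L2_weight sY (- omega) dd.
have [dWx _] := L2_weight sY (- omega) (Psi_dom x).
have [dWx' _] := L2_weight sY (- omega) (L2_orbit sY SC M0 hS T0 hbeta hC dx').
have -> : L2_dot T (W (Psi x)) b = L2_dot T (W (Psi x - obs x')) b +
    dot (k *: K n (x' - Q x')) v.
  rewrite -(orbit_coefficient sH SC M0 hS T0 w0_lt hbeta hC n v dx').
  rewrite -(rep_dotDl L2A dWd dWx' db); congr (L2_dot _ _ _).
  by apply/funext => t /=; rewrite -[RHS]scalerDr subrK.
have -> : x - Q x = (x - x') - Q (x - x') + (x' - Q x').
  by have := Q_lin 1 (x - x') x'; rewrite !scale1r subrK.
have KD a y : K n (a + y) = K n a + K n y by have := K_lin n 1 a y; rewrite !scale1r.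
rewrite KD scalerDr dotDl opprD addrACA subrr addr0.
rewrite (le_trans (le_normcD _ _))// mulrDl lerD//.
  apply: sqr_le_scale; rewrite ?normc_ge0 ?mulr_ge0 ?(ltW e0)//.
  rewrite (le_trans (rep_CS L2A dWd db))// [leRHS]mulrAC ler_wpM2r//.
  rewrite (le_trans hWd)// -[leRHS]mulrA ler_wpM2l// (le_trans (Psi_near _ dx'))// ler_wpM2l//.
  by rewrite ler_pXn2r ?nnegrE ?rnorm_ge0// ltW.
rewrite normcN (le_trans (dot_CS _ _))// [leRHS]mulrAC ler_wpM2r ?rnorm_ge0//.
rewrite rnormZ -mulrA ler_wpM2l ?normc_ge0// (le_trans (hK _))// -mulrA ler_wpM2l//.
by rewrite (le_trans (hQ _))// ler_wpM2l.
Qed.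

Lemma extension_parseval x :
  ((sq (W (Psi x)))%:E = \esum_(n in [set: int]) (rnorm (k *: K n (x - Q x)) ^+ 2)%:E)%E.
Proof.
apply: (coefficients_parseval sY T0) => [|n v]; first exact: (L2_weight sY (- omega) (Psi_dom x)).1.
exact: extension_coefficient.
Qed.

End Coefficients.

Lemma admissible_observation_sum : S_admissible_observation T A S C ->
  (\esum_(n in [set: int]) @HS_norm2 R (hil H) (hil Y) (K n) < +oo)%E.
Proof.
move=> [Psi [Pdom Plin [m Pm] PHS] Pae].
have [_ [B hB <-] sB] := ereal_inf_lt PHS.
have Pd x : L2_dom T (Psi x) by exact: Pdom.
(* One factor 2 separates [Psi x - obs x'] into [Psi x - Psi x'] and a null function; the other pays
   for [Psi] being linear up to null functions. *)
have near x x' : op_dom A x' -> sq (Psi x - obs x') <= (4 * `|m|) * rnorm (x - x') ^+ 2.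
  move=> dx'; have dobs := L2_orbit sY SC M0 hS T0 hbeta hC dx'.
  rewrite (le_trans (sqnorm_dist L2A (Pd x) dobs (Pd x')))//.
  have -> : sq (Psi x' - obs x') = 0.
    apply: (ae_eq_L2_sqnorm (domB L2A (Pd x') dobs)).
    have := Pae _ dx'; apply: filterS; first exact: (ae_filter_ringOfSetsType (@lebesgue_measure R)).
    by move=> t ht tT; have e := ht tT; rewrite -[LHS]/(Psi x' t - C (S t x')) e subrr.
  have e4 : 4 = 2 * 2 :> R by rewrite -natrM.
  rewrite mulr0 addr0 e4 -!mulrA ler_wpM2l//.
  have := Plin (-1) x' x I I; set u := _ - _ => hu.
  have du : rep_dom (L2 T Y) u.
    exact: (domB L2A (Pd _) (dom_lin L2A (-1) (Pd x') (Pd x))).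
  have -> : Psi x - Psi x' = Psi (x - x') - u.
    by rewrite /u scaleN1r [- x' + x]addrC subKr scaleN1r addrC.
  rewrite (le_trans (sqnormB_le L2A (Pd _) du))// hu mulr0 addr0 ler_wpM2l//.
  by rewrite (le_trans (Pm _ I))// sqnorm_hil ler_wpM2r ?sqr_ge0// ler_norm.
have c0 : 0 <= 4 * `|m| by rewrite mulr_ge0.
have [N Nlin [cN cN0 [hN NK KN]]] := decay_inverse_exists SC M0 hS T0 w0_lt.
have [cQ cQ0 hQ] := Q_bounded.
pose g := Num.sqrt T; have g0 : 0 < g by rewrite sqrtr_gt0.
pose c1 := (g * cN) ^+ 2 + 1; have c10 : 0 <= c1 by rewrite addr_ge0 ?sqr_ge0.
pose c2 := expR (`|- omega| * T) ^+ 2; have c20 : 0 <= c2 by exact: sqr_ge0.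
have kg : g%:C * k = 1 :> R[i] by rewrite -rmorphM/= divff ?gt_eqF.
have le1 n : (@HS_norm2 R (hil H) (hil Y) (K n) <=
    c1%:E * \esum_(e in B) (rnorm (k *: K n (e - Q e)) ^+ 2)%:E)%E.
  apply: (le_trans (HS_norm2_le_basis _ hB)).
  have [cK cK0 hK] := K_bounded n.
  (* [N] inverts 1 - Q and [g] cancels [k], so the coefficient operator followed backwards by [g N]
     is [K n] itself. *)
  have := @hil_transfer R H Y (fun z => k *: K n (z - Q z)) (normc k * (cK * cQ))
    (fun e => g%:C *: N e) (g * cN) B B.
  rewrite (_ : \esum_(e in B) (rnorm (k *: K n (g%:C *: N e - Q (g%:C *: N e))) ^+ 2)%:E
     = \esum_(e in B) (rnorm (K n e) ^+ 2)%:E)%E; last first.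
    apply: eq_esum => e _.
    have -> : g%:C *: N e - Q (g%:C *: N e) = g%:C *: e.
      by rewrite -[g%:C *: N e]addr0 Q_lin (linear_at0 Q_lin) addr0 NK.
    have -> : K n (g%:C *: e) = g%:C *: K n e.
      by rewrite -[g%:C *: e]addr0 K_lin (linear_at0 (K_lin n)) addr0.
    by rewrite scalerA [k * _]mulrC kg scale1r.
  apply=> //.
  - by move=> a x y; rewrite Q_lin K_lin scalerDr !scalerA [k * a]mulrC.
  - by rewrite !mulr_ge0 ?normc_ge0.
  - move=> x; rewrite rnormZ -mulrA ler_wpM2l ?normc_ge0// (le_trans (hK _))// -mulrA.
    by rewrite ler_wpM2l.
  - by move=> a x y; rewrite Nlin scalerDr !scalerA [_ * a]mulrC.
  - by rewrite mulr_ge0 // ltW.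
  - by move=> x; rewrite rnormZ normc_real gtr0_norm// -mulrA ler_wpM2l // ltW.
apply: (@le_lt_trans _ _ (c1%:E * (c2%:E * \esum_(e in B) (sq (Psi e))%:E))%E); last first.
  by rewrite !lte_mul_pinfty ?lee_fin// mule_ge0 ?lee_fin// esum_ge0// => e _; rewrite lee_fin (rdot_ge0 L2A).
pose a n e := ((rnorm (k *: K n (e - Q e)) ^+ 2)%:E : \bar R).
have a0 n e : (0 <= a n e)%E by rewrite lee_fin sqr_ge0.
apply: (@le_trans _ _ (\esum_(n in [set: int]) (c1%:E * \esum_(e in B) a n e)))%E.
  by apply: le_esum => n _; exact: le1.
apply: (le_trans (esum_scale c10 (fun n _ => esum_ge0 (fun e _ => a0 n e)))).
rewrite lee_wpmul2l ?lee_fin//.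
apply: (le_trans (esum_swap (fun n e _ _ => a0 n e))).
apply: (@le_trans _ _ (\esum_(e in B) (c2%:E * (sq (Psi e))%:E)))%E; last first.
  by apply: (esum_scale c20) => e _; rewrite lee_fin (rdot_ge0 L2A (Pd e)).
apply: le_esum => e _; rewrite -(extension_parseval c0 Pd near) -EFinM lee_fin.
exact: (L2_weight sY (- omega) (Pd e)).2.
Qed.

Let obs_ext a x y t : op_dom A x -> op_dom A y -> t \in `[0, T] ->
  C (S t (a *: x + y)) = a *: C (S t x) + C (S t y).
Proof.
move=> dx dy; rewrite in_itv/= => /andP[t0 _].
have [Sl _ _ _] := SC; have [Slin _] := Sl t t0.
by have [Clin _] := hC; rewrite Slin Clin//; exact: op_dom_orbit.
Qed.

(** Extension by density without quotients: [Psi x] is an L^2 limit of outputs of domain vectors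
    tending to [x], selected by choice, so linearity holds in seminorm. The factor 4 stems from two
    uses of the squared triangle inequality. *)
Lemma observation_extension (c : R) : 0 <= c ->
  (forall x, op_dom A x -> sq (obs x) <= c * rnorm x ^+ 2) ->
  exists Psi : H -> R -> Y, [/\ forall x, L2_dom T (Psi x),
    forall x x', op_dom A x' -> sq (Psi x - obs x') <= 4 * c * rnorm (x - x') ^+ 2,
    forall a x y, sq (Psi (a *: x + y) - (a *: Psi x + Psi y)) = 0 &
    forall x, sq (Psi x) <= 4 * c * rnorm x ^+ 2].
Proof.
move=> c0 hc.
have dobs x : op_dom A x -> L2_dom T (obs x) := L2_orbit sY SC M0 hS T0 hbeta hC (x := x).
have dist x y : op_dom A x -> op_dom A y -> sq (obs x - obs y) <= c * rnorm (x - y) ^+ 2.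
  move=> dx dy; have := hc _ (op_dom_lin SC (-1) dy dx).
  rewrite [-1 *: y + x]addrC scaleN1r => h; apply: le_trans h.
  rewrite le_eqVlt; apply/orP; left; apply/eqP/L2_sqnorm_ext => t ht.
  rewrite addrC -scaleN1r -[LHS]/(C (S t x) - C (S t y)) obs_ext// scaleN1r addrC//.
have near x (e : R) : 0 < e -> exists2 x', op_dom A x' & rnorm (x - x') ^+ 2 <= e.
  move=> e0; have e1 : 0 < Num.min e 1 by rewrite lt_min e0 ltr01.
  have [x' dx' hx'] := generator_dense sH SC M0 hS hbeta x e1.
  exists x' => //; rewrite le_min in hx'; have /andP[h1 h2] := hx'.
  by rewrite expr2 (le_trans _ h1)// ler_piMr ?rnorm_ge0.
have sq2 x y : rnorm (x - y) ^+ 2 <= 2 * rnorm x ^+ 2 + 2 * rnorm y ^+ 2.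
  by have := rnorm_sqr_le x (- y); rewrite rnormN.
have ex x : exists f : R -> Y, L2_dom T f /\
    forall x', op_dom A x' -> sq (f - obs x') <= 4 * c * rnorm (x - x') ^+ 2.
  have /choice[u hu] : forall i : nat, exists x', op_dom A x' /\ rnorm (x - x') ^+ 2 <= i.+1%:R^-1.
    by move=> i; have [|x' h1 h2] := near x (i.+1%:R^-1); [rewrite invr_gt0|exists x'].
  have small e : 0 < e -> exists N : nat, forall i, (N <= i)%N -> rnorm (x - u i) ^+ 2 <= e.
    move=> e0; have [N _ hN] := near_infty_natSinv_lt (PosNum e0).
    by exists N => i hi; rewrite (le_trans (hu i).2)// ltW//; exact: hN.
  have du i : rep_dom (L2 T Y) (obs (u i)) := dobs _ (hu i).1.
  have [|f df hf] := rep_complete L2A du.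
    move=> e e0; have c1 : 0 < 4 * c + 1 by rewrite ltr_wpDl ?mulr_ge0.
    have [|N hN] := small (e / (4 * c + 1)); first by rewrite divr_gt0.
    exists N => i k hi hk; rewrite (le_trans (dist _ _ (hu i).1 (hu k).1))//.
    rewrite (_ : u i - u k = (x - u k) - (x - u i)); last by rewrite opprB [RHS]addrC addrA subrK.
    rewrite (@le_trans _ _ (c * (4 * (e / (4 * c + 1)))))//.
      rewrite ler_wpM2l// (le_trans (sq2 _ _))// -mulrDr.
      by have h1 := hN _ hi; have h2 := hN _ hk; lra.
    rewrite mulrCA !mulrA ler_pdivrMr// mulrDr mulr1 ler_wpDr ?(ltW e0)//.
    by rewrite mulrC.
  exists f; split=> // x' dx'.
  apply: (@le_mul_eps _ _ _ (2 + 4 * c)); first by rewrite addr_ge0 ?mulr_ge0.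
  move=> e e0; have [N1 h1] := hf e e0; have [N2 h2] := small e e0.
  pose N := maxn N1 N2; have dN := dobs _ (hu N).1.
  rewrite (le_trans (sqnorm_dist L2A df (dobs _ dx') dN))// (sqnormC L2A df dN).
  have a1 : sq (obs (u N) - f) <= e by apply: h1; rewrite leq_maxl.
  have a2 : rnorm (x - u N) ^+ 2 <= e by apply: h2; rewrite leq_maxr.
  have a3 := dist _ _ (hu N).1 dx'.
  have a4 : rnorm (u N - x') ^+ 2 <= 2 * e + 2 * rnorm (x - x') ^+ 2.
    rewrite (_ : u N - x' = (x - x') - (x - u N)); last by rewrite opprB [RHS]addrC addrA subrK.
    by rewrite (le_trans (sq2 _ _))// addrC lerD2r ler_wpM2l.
  have a5 := ler_wpM2l c0 a4; nra.
have /choice[Psi hPsi] := ex; exists Psi.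
have Pd x : L2_dom T (Psi x) := (hPsi x).1.
split => //.
- by move=> x; exact: (hPsi x).2.
- move=> a x y; apply/eqP; rewrite eq_le (rdot_ge0 L2A) ?andbT; last first.
    exact: (domB L2A (Pd _) (dom_lin L2A a (Pd x) (Pd y))).
  pose al := normc a ^+ 2; have al0 : 0 <= al by exact: sqr_ge0.
  (* The defect of linearity is compared with that of nearby domain vectors, which is zero on
     [0, T]. The constant collects the errors at [a *: x + y], at [x] and at [y]. *)
  apply: (@le_mul_eps _ _ _ (2 * (4 * c * (2 * al + 2)) + 4 * al * (4 * c) + 4 * (4 * c))).
    by have h := mulr_ge0 al0 c0; lra.
  move=> e e0; rewrite add0r; have [x' dx' hx] := near x _ e0; have [y' dy' hy] := near y _ e0.
  have dxy := op_dom_lin SC a dx' dy'.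
  pose u : L2 T Y := Psi (a *: x + y) - obs (a *: x' + y').
  pose u1 : L2 T Y := Psi x - obs x'; pose u2 : L2 T Y := Psi y - obs y'.
  have du : rep_dom (L2 T Y) u := domB L2A (Pd _) (dobs _ dxy).
  have du1 : rep_dom (L2 T Y) u1 := domB L2A (Pd _) (dobs _ dx').
  have du2 : rep_dom (L2 T Y) u2 := domB L2A (Pd _) (dobs _ dy').
  have -> : sq (Psi (a *: x + y) - (a *: Psi x + Psi y)) = sq (u - (a *: u1 + u2)).
    apply: L2_sqnorm_ext => t ht.
    rewrite -[RHS]/((Psi (a *: x + y) t - C (S t (a *: x' + y'))) -
      (a *: (Psi x t - C (S t x')) + (Psi y t - C (S t y')))).
    rewrite (obs_ext _ dx' dy' ht) scalerBr addrACA -opprD opprB addrA subrK.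
    by [].
  have b1 := sqnormB_le L2A du (dom_lin L2A a du1 du2).
  have b2 := sqnormD_le L2A (domZ L2A a du1) du2; rewrite (sqnormZ L2A) // in b2.
  have b3 := (hPsi (a *: x + y)).2 _ dxy; have b4 := (hPsi x).2 _ dx'.
  have b5 := (hPsi y).2 _ dy'.
  have b6 : rnorm (a *: x + y - (a *: x' + y')) ^+ 2 <= (2 * al + 2) * e.
    rewrite opprD addrACA -scalerBr (le_trans (rnorm_sqr_le _ _))// rnormZ exprMn [leRHS]mulrDl lerD//.
      by rewrite -mulrA ler_wpM2l// ler_wpM2l.
    by rewrite ler_wpM2l.
  have b3' : sq u <= 4 * c * ((2 * al + 2) * e) by rewrite (le_trans b3)// ler_wpM2l// mulr_ge0.
  have b4' : al * sq u1 <= al * (4 * c * e).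
    by rewrite ler_wpM2l// (le_trans b4)// ler_wpM2l// mulr_ge0.
  have b5' : sq u2 <= 4 * c * e by rewrite (le_trans b5)// ler_wpM2l// mulr_ge0.
  rewrite -/al in b2; lra.
- move=> x; have d0 : op_dom A 0.
    have [x' dx' _] := near x 1 ltr01; have := op_dom_lin SC (-1) dx' dx'.
    by rewrite scaleN1r addNr.
  have := (hPsi x).2 _ d0; rewrite subr0; apply: le_trans.
  rewrite le_eqVlt; apply/orP; left; apply/eqP/L2_sqnorm_ext => t ht.
  rewrite -[RHS]/(Psi x t - C (S t 0)).
  have := obs_ext (-1) d0 d0 ht; rewrite scaler0 addr0 scaleN1r addNr => ->.
  by rewrite subr0.
Qed.

(** The sum is used twice. Bounding each [K n] by its Hilbert-Schmidt norm gives, through Parseval,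
    an L^2 bound for the outputs of domain vectors, hence an extension; then the same sum bounds the
    Hilbert-Schmidt norm of that extension. *)
Lemma sum_admissible_observation :
  (\esum_(n in [set: int]) @HS_norm2 R (hil H) (hil Y) (K n) < +oo)%E ->
  S_admissible_observation T A S C.
Proof.
move=> hsum; have [B hB] := orthonormal_basis_exists H.
have [cQ cQ0 hQ] := Q_bounded.
pose s n := (\esum_(e in B) (rnorm (K n e) ^+ 2)%:E)%E.
have s0 n : (0 <= s n)%E by apply: esum_ge0 => e _; rewrite lee_fin sqr_ge0.
have sfin : (\esum_(n in [set: int]) s n < +oo)%E.
  apply: (@le_lt_trans _ _ (2%:E * \esum_(n in [set: int]) @HS_norm2 R (hil H) (hil Y) (K n))%E).
    apply: (@le_trans _ _ (\esum_(n in [set: int]) (2%:E * @HS_norm2 R (hil H) (hil Y) (K n))))%E.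
      apply: le_esum => n _; have [cK cK0 hK] := K_bounded n.
      exact: (HS_norm2_ge_basis (K_lin n) cK0 hK hB).
    by apply: esum_scale => // n _; apply: HS_norm2_ge0 => //; exact: hil_axioms.
  by rewrite lte_mul_pinfty// esum_ge0// => n _; apply: HS_norm2_ge0 => //; exact: hil_axioms.
have sE : (\esum_(n in [set: int]) s n = (fine (\esum_(n in [set: int]) s n))%:E)%E.
  by rewrite fineK// ge0_fin_numE// esum_ge0.
set m := fine _ in sE; have m0 : 0 <= m by rewrite -lee_fin -sE esum_ge0.
pose c2 := expR (`|omega| * T) ^+ 2; have c20 : 0 <= c2 by exact: sqr_ge0.
have WK (f : R -> Y) : (fun t => cexp omega%:C t *: W f t) = f.
  by apply/funext => t; rewrite cexp_weightK.
pose k2 := normc k ^+ 2; have k20 : 0 <= k2 by exact: sqr_ge0.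
have dobs x : op_dom A x -> L2_dom T (obs x) := L2_orbit sY SC M0 hS T0 hbeta hC (x := x).
have Kb z : (\esum_(n in [set: int]) (rnorm (k *: K n z) ^+ 2)%:E <= (k2 * (rnorm z ^+ 2 * m))%:E)%E.
  rewrite EFinM; apply: (@le_trans _ _ (\esum_(n in [set: int]) (k2%:E * (rnorm (K n z) ^+ 2)%:E)))%E.
    by apply: le_esum => n _; rewrite -EFinM lee_fin rnormZ exprMn.
  have r0 n : (0 <= (rnorm (K n z) ^+ 2)%:E)%E by rewrite lee_fin sqr_ge0.
  apply: (le_trans (esum_scale k20 (fun n _ => r0 n))).
  rewrite lee_wpmul2l ?lee_fin// EFinM -sE.
  apply: (@le_trans _ _ (\esum_(n in [set: int]) ((rnorm z ^+ 2)%:E * s n)))%E.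
    apply: le_esum => n _; have [cK cK0 hK] := K_bounded n.
    exact: (hilbert_schmidt_bound z (K_lin n) cK0 hK hB).
  by apply: esum_scale => //; exact: sqr_ge0.
pose c := c2 * (k2 * (cQ ^+ 2 * m)).
have c0 : 0 <= c by do 3!apply: mulr_ge0 => //; exact: sqr_ge0.
have obs_bound x : op_dom A x -> sq (obs x) <= c * rnorm x ^+ 2.
  move=> dx; have [dW _] := L2_weight sY (- omega) (dobs _ dx).
  have [_] := L2_weight sY omega dW; rewrite WK => /le_trans; apply.
  rewrite /c -[leRHS]mulrA ler_wpM2l// -lee_fin.
  rewrite (coefficients_parseval sY T0 dW
    (fun n v => orbit_coefficient sH SC M0 hS T0 w0_lt hbeta hC n v dx)).
  rewrite (le_trans (Kb _))// lee_fin -[leRHS]mulrA ler_wpM2l// [leRHS]mulrAC ler_wpM2r//.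
  by rewrite -exprMn ler_pXn2r ?nnegrE ?mulr_ge0 ?rnorm_ge0.
have [Psi [Pd Pnear Plin Pbound]] := observation_extension c0 obs_bound.
have c40 : 0 <= 4 * c by rewrite mulr_ge0.
exists Psi; last first.
  move=> x dx; have h : sq (Psi x - obs x) = 0.
    apply/eqP; rewrite eq_le (rdot_ge0 L2A (domB L2A (Pd x) (dobs _ dx))) andbT.
    by rewrite (le_trans (Pnear x x dx))// subrr rnorm0 expr0n mulr0.
  have := L2_sqnorm_eq0 (domB L2A (Pd x) (dobs _ dx)) h.
  apply: filterS; first exact: (ae_filter_ringOfSetsType (@lebesgue_measure R)).
  by move=> t ht tT; apply/eqP; rewrite -subr_eq0; apply/eqP/ht.
split=> [x _|a x y _ _||]; [exact: Pd|exact: Plin| |].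
  by exists (4 * c) => x _; rewrite sqnorm_hil.
apply: (@le_lt_trans _ _ (\esum_(e in B) (sq (Psi e))%:E)%E).
  by apply: ereal_inf_lbound; exists B.
pose N x := k *: (x - Q x).
have [Nlin [cN cN0 hN]] : linear N /\ exists2 cN : R, 0 <= cN & bounded_by cN N.
  split; first by move=> a x y; rewrite /N Q_lin scalerDr !scalerA [k * a]mulrC.
  exists (normc k * cQ) => [|x]; first by rewrite mulr_ge0 ?normc_ge0.
  by rewrite rnormZ -mulrA ler_wpM2l ?normc_ge0.
pose c3 := cN ^+ 2 + 1; have c30 : 0 <= c3 by rewrite addr_ge0 ?sqr_ge0.
pose a e n := ((rnorm (K n (N e)) ^+ 2)%:E : \bar R).
have a0 n e : (0 <= a e n)%E by rewrite lee_fin sqr_ge0.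
apply: (@le_lt_trans _ _ (c2%:E * (c3%:E * m%:E))%E); last by rewrite -!EFinM ltry.
apply: (@le_trans _ _ (\esum_(e in B) (c2%:E * \esum_(n in [set: int]) a e n)))%E.
  apply: le_esum => e _; have [dW _] := L2_weight sY (- omega) (Pd e).
  have [_] := L2_weight sY omega dW; rewrite WK -lee_fin EFinM => /le_trans; apply.
  rewrite lee_wpmul2l ?lee_fin// (extension_parseval c40 Pd Pnear).
  apply: le_esum => n _; rewrite lee_fin /N.
  by rewrite -[k *: (e - _)]addr0 K_lin (linear_at0 (K_lin n)) addr0.
apply: (le_trans (esum_scale c20 (fun e _ => esum_ge0 (fun n _ => a0 n e)))).
rewrite lee_wpmul2l ?lee_fin//.
apply: (le_trans (esum_swap (fun e n _ _ => a0 n e))).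
apply: (@le_trans _ _ (\esum_(n in [set: int]) (c3%:E * s n)))%E; last first.
  by rewrite -sE; apply: esum_scale.
apply: le_esum => n _; have [cK cK0 hK] := K_bounded n.
exact: (hil_transfer (K_lin n) cK0 hK Nlin cN0 hN hB hB).
Qed.

End ObservationExtension.

(** * Control *)

Lemma rdense_separable (R : realType) (V : normedModType R[i]) (d : nat -> V) :
  (forall x e, 0 < e -> exists n, rnorm (x - d n) <= e) -> separable V.
Proof.
move=> hd; exists (range d); first exact: card_image_le.
move=> O [x Ox] oO; have /nbhs_ballP[_/posnumP[eps] heps] : nbhs x O by exact: open_nbhs_nbhs.
have [r r0 er] := gtc0P [gt0 of eps%:num].
have [|n hn] := hd x (r / 2); first by rewrite divr_gt0.
exists (d n); split; last by exists n.
apply: heps; rewrite -ball_normE/= -rnormE er ltcR (le_lt_trans hn)//.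
by rewrite ltr_pdivrMr// ltr_pMr// ltr1n.
Qed.

(** * The extrapolation space and the input map *)

Section Extrapolation.
Context {R : realType} {H U : hilbertType R} {Hm1 : completeNormedModType R[i]}.
Hypotheses (sH : separable H) (sU : separable U).
Variables (S : R -> H -> H) (w0 M omega T : R).
Hypothesis SC : C0_semigroup S.
Hypothesis M0 : 0 <= M.
Hypothesis hS : forall t x, 0 <= t -> rnorm (S t x) <= M * expR (w0 * t) * rnorm x.
Hypothesis T0 : 0 < T.
Hypothesis w0_lt : w0 < omega.
Local Notation A := (generator S).
Variables (beta : R[i]) (hbeta : resolvent_set A beta).
Variables (j : {linear H -> Hm1}) (hj : extrapolation_space A beta j).
Variables (Sm1 : R -> Hm1 -> Hm1) (Sm1_C0 : C0_semigroup Sm1).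
Hypothesis Sm1_ext : forall t x, 0 <= t -> Sm1 t (j x) = j (S t x).
Variables (B : {linear U -> Hm1}) (B_cont : continuous B).
Variables (D : R[i] -> U -> H).
Hypothesis defB : forall l u, resolvent_set A l ->
  exists2 w, generator Sm1 (j (D l u), w) & B u = l *: j (D l u) - w.
Local Notation Q := (decay_step S omega T).
Local Notation lam n := (frequency T omega n).
Implicit Types (x y : H) (n : int) (v : U).

Lemma extrapolation_bounded : exists2 c : R, 0 <= c & bounded_by c j.
Proof.
have [c c0 hc] := resolvent_bounded hbeta; exists c => // x.
by rewrite hj.1; exact: hc.
Qed.

(** A vector killed by the resolvent at [beta] is, up to sign, the value of the generator at 0,
    which is 0 by single-valuedness. Injectivity of [j] later identifies vectors of H through their
    images. *)
Lemma extrapolation_inj x y : j x = j y -> x = y.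
Proof.
move=> e; apply/eqP; rewrite -subr_eq0; apply/eqP.
have : rnorm (j (x - y)) = 0 by rewrite linearB/= e subrr rnorm0.
rewrite hj.1 => /rnorm_eq0 e0; have [w] := resolventP hbeta (x - y).
rewrite e0 scaler0 sub0r => h <-; have := @generator_lin _ _ _ SC (-1) _ _ _ _ h h.
by rewrite !scaleN1r oppr0 addr0 addNr => h'; rewrite (generator_fun h h') oppr0.
Qed.

Lemma extrapolation_dense (y : Hm1) e : 0 < e -> exists x, rnorm (y - j x) <= e.
Proof. by move=> e0; have [_ [x _ <-] h] := rdenseP hj.2 y e0; exists x; exact: ltW. Qed.

(** Makes the measurability criterion and the existence theorem for integrals applicable in
    [Hm1]. *)
Lemma extrapolation_separable : separable Hm1.
Proof.
have [d hd] := separable_seq sH; have [c c0 hc] := extrapolation_bounded.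
apply: (@rdense_separable _ _ (j \o d)) => y e e0.
have [|x hx] := @extrapolation_dense y (e / 2); first by rewrite divr_gt0.
have c1 : 0 < c + 1 by rewrite ltr_wpDl.
have [|n hn] := hd x (e / 2 / (c + 1)); first by rewrite !divr_gt0.
exists n; rewrite (le_trans (rdistD (j x) _ _))// [leRHS]splitr lerD//= -linearB.
rewrite (le_trans (hc _))// (le_trans (ler_wpM2l c0 (ltW hn)))// mulrCA ger_pMr ?divr_gt0//.
by rewrite ler_pdivrMr// mul1r lerDl.
Qed.

(** On the range of [j] the bound is inherited from H, as the resolvent defining the norm commutes
    with the semigroup. Density extends it; the crude bound [c] serves for the error term. *)
Lemma extrapolation_growth t (y : Hm1) : 0 <= t -> rnorm (Sm1 t y) <= M * expR (w0 * t) * rnorm y.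
Proof.
move=> t0; have [c c0 hc] := C0_bounded Sm1_C0 t0.
pose q := M * expR (w0 * t); have q0 : 0 <= q by rewrite mulr_ge0 ?expR_ge0.
apply: (@le_mul_eps _ _ _ (c + q)); first by rewrite addr_ge0.
move=> e e0; have [x hx] := extrapolation_dense y e0.
have Slin : linear (Sm1 t) by case: Sm1_C0 => h _ _ _; exact: (h t t0).1.
have -> : Sm1 t y = Sm1 t (y - j x) + Sm1 t (j x).
  by have := Slin 1 (y - j x) (j x); rewrite !scale1r subrK.
rewrite (le_trans (rnormD _ _))// mulrDl addrCA lerD//.
  by rewrite (le_trans (hc _))// ler_wpM2l.
rewrite Sm1_ext// hj.1 -(resolvent_semigroup SC hbeta _ t0) (le_trans (hS _ t0))//.
rewrite -/q -hj.1 -mulrDr ler_wpM2l// -lerBlDl (le_trans _ hx)// rdistC.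
exact: le_trans (ler_norm _) (rdist_dist _ _).
Qed.

(** Since [B v] is [lam n - A_{-1}] applied to [j (D (lam n) v)], the integrand is, up to sign and
    the factor [exp (omega T)], a rescaled orbit run backwards over an orbit derivative, and
    [sg_bochner_reversed] applies. *)
Lemma input_mode n v : is_bochner_integral T
  (fun s => Sm1 (T - s) (B (cexp omega%:C s *: (fourier T n s *: v))))
  (j ((expR (omega * T))%:C *: (D (lam n) v - Q (D (lam n) v)))).
Proof.
have hl := frequency_resolvent_set sH SC M0 hS T0 w0_lt hbeta n.
have [w gw Bw] := defB v hl; set x := D (lam n) v in gw Bw *.
have [c c0 hP] := rescaled_bounded_semigroup Sm1_C0 M0 extrapolation_growth (lam n) (ltW T0).
have := bochnerZ (- (expR (omega * T))%:C)
  (sg_bochner_reversed T0 c0 hP (rescaled_derivative (lam n) Sm1_C0 gw)).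
have -> : rescaled Sm1 (lam n) T (j x) = j (Q x).
  by rewrite -(rescaled_frequency omega T0 S n) /rescaled Sm1_ext ?(ltW T0)// linearZ.
have -> : - (expR (omega * T))%:C *: (j (Q x) - j x) =
    j ((expR (omega * T))%:C *: (x - Q x)).
  by rewrite scaleNr -scalerN opprB -linearB -linearZ.
apply: bochner_ext => t; rewrite in_itv/= => /andP[t0 tT].
have s0 : 0 <= T - t by rewrite subr_ge0.
rewrite -(opprB (lam n *: j x) w) -Bw.
rewrite -(sg_linearZ hP)// scaleNr scalerN opprK.
have Slin : linear (Sm1 (T - t)) by case: Sm1_C0 => h _ _ _; exact: (h _ s0).1.
have SZ (a : R[i]) (z : Hm1) : Sm1 (T - t) (a *: z) = a *: Sm1 (T - t) z.
  by rewrite -[a *: z]addr0 Slin (linear_at0 Slin) addr0.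
(* By periodicity [cexp (- lam n) (T - t)] is [exp (- omega T)] times [cexp (lam n) t], that is,
   times the weighted mode. *)
rewrite /rescaled !linearZ !SZ !scalerA cexp_frequencyN cexpD cexp_frequency_period//.
have e : (expR (omega * T))%:C * (expR (- (omega * T)))%:C = 1 :> R[i].
  by rewrite -rmorphM/= -expRD subrr expR0.
by rewrite mulrAC [X in X * _]mulrC e mul1r cexpN opprK.
Qed.

Hypothesis D_bounded : forall l, resolvent_set A l -> linear (D l) /\ continuous (D l).
Local Notation k := (((Num.sqrt T)^-1)%:C).
Local Notation up f := (fun t => cexp omega%:C t *: f t).
Local Notation input u := (fun s => Sm1 (T - s) (B (u s))).

Let L2A : hilbert_axioms (L2 T U) := L2_axioms T sU.

Let hl n : resolvent_set A (lam n) := frequency_resolvent_set sH SC M0 hS T0 w0_lt hbeta n.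

Let D_lin n : linear (D (lam n)) := (D_bounded (hl n)).1.

Let D_bdd n : exists2 c : R, 0 <= c & bounded_by c (D (lam n)).
Proof. exact: (linear_continuous_bounded (D_bounded (hl n)).1 (D_bounded (hl n)).2). Qed.

(** The vector of H whose image under [j] is the input integral of the weighted basis mode [p]. *)
Definition input_vector (p : int * hil U) : H :=
  let x := D (lam p.1) (p.2 : U) in (expR (omega * T))%:C *: (k *: (x - Q x)).

Lemma input_basis p : is_bochner_integral T (input (up (mode_basis T p))) (j (input_vector p)).
Proof.
case: p => n v; have := input_mode n (k *: (v : U)).
have DZ a w : D (lam n) (a *: w) = a *: D (lam n) w.
  by rewrite -[a *: w]addr0 D_lin (linear_at0 (@D_lin n)) addr0.
have QZ a x : Q (a *: x) = a *: Q x.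
  have Ql := @decay_step_linear _ _ _ omega _ SC T0.
  by rewrite -[a *: x]addr0 Ql (linear_at0 Ql) addr0.
by rewrite DZ QZ -scalerBr.
Qed.

(** Admissibility provides a finite sum over some basis [BB] of L^2. The transfer carries it to the
    weighted modes, where [Phi] is explicit: uniqueness of the integral and injectivity of [j]
    identify its values with [input_vector]. *)
Lemma admissible_control_sum : S_admissible_control T j Sm1 B ->
  (\esum_(n in [set: int]) @HS_norm2 R (hil U) (hil H) (D (lam n)) < +oo)%E.
Proof.
move=> [Phi [Pdom Plin [m Pm] PHS] Pint].
have [_ [BB hBB <-] sBB] := ereal_inf_lt PHS.
have [BB1 BB2] := orthonormal_basis_family hBB.
have [F hF] := orthonormal_basis_exists U.
pose J := [set p : int * hil U | F p.2].
have hb := mode_basis_orthonormal T0 sU hF.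
pose g p : L2 T U := up (mode_basis T p).
pose c2 := expR (`|omega| * T) ^+ 2; have c20 : 0 < c2 by rewrite exprn_gt0 ?expR_gt0.
have sum1 : (\esum_(p in J) (rnorm (Phi (g p)) ^+ 2)%:E <=
    c2%:E * \esum_(b in BB) (rnorm (Phi b) ^+ 2)%:E)%E.
  apply: (@hilbert_schmidt_transfer R (L2 T U) L2A H Phi `|m| _ _ _ _ _ BB id J g c2) => //.
  - move=> a x y dx dy; apply/eqP; rewrite -subr_eq0 -rnorm_eq0E -sqrf_eq0.
    by have := Plin a x y dx dy; rewrite sqnorm_hil => ->.
  - move=> x dx; have := Pm x dx; rewrite sqnorm_hil => /le_trans; apply.
    by rewrite ler_wpM2r ?(rdot_ge0 L2A)// ler_norm.
  - by move=> p Jp; exact: (L2_weight sU omega (hb.1 p Jp)).1.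
  - apply: (orthonormal_bessel L2A hb (N := fun f => up f)) => [a x y|x dx].
      by apply/funext => t; rewrite -[LHS]/(_ *: (a *: x t + y t)) scalerDr scalerA mulrC -scalerA.
    exact: (L2_weight sU omega dx).2.
have PhiE p : J p -> Phi (g p) = input_vector p.
  move=> Jp; apply: extrapolation_inj.
  exact: (bochner_unique (Pint _ (L2_weight sU omega (hb.1 p Jp)).1) (input_basis p)).
have [N Nlin [cN cN0 [hN NK KN]]] := decay_inverse_exists SC M0 hS T0 w0_lt.
pose kap := expR (omega * T) * (Num.sqrt T)^-1.
have kap0 : 0 < kap by rewrite mulr_gt0 ?expR_gt0 ?invr_gt0 ?sqrtr_gt0.
pose c1 := (cN / kap) ^+ 2; have c10 : 0 <= c1 by exact: sqr_ge0.
have Dle n v : rnorm (D (lam n) v) ^+ 2 <= c1 * rnorm (input_vector (n, v)) ^+ 2.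
  rewrite -exprMn ler_pXn2r ?nnegrE ?mulr_ge0 ?rnorm_ge0 ?invr_ge0 ?(ltW kap0)//.
  rewrite /input_vector/= 2!rnormZ !normc_real !gtr0_norm ?expR_gt0 ?invr_gt0 ?sqrtr_gt0//.
  rewrite [X in _ * X]mulrA -/kap mulrA divfK ?gt_eqF// -{1}(KN (D (lam n) v)).
  exact: hN.
apply: (@le_lt_trans _ _ (c1%:E * (c2%:E * \esum_(b in BB) (rnorm (Phi b) ^+ 2)%:E))%E); last first.
  have p0 : (0 <= \esum_(b in BB) (rnorm (Phi b) ^+ 2)%:E)%E.
    by apply: esum_ge0 => b _; rewrite lee_fin sqr_ge0.
  apply: lte_mul_pinfty; rewrite ?lee_fin//; apply: lte_mul_pinfty; rewrite ?lee_fin ?(ltW c20)//.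
  by apply: le_lt_trans sBB; apply: le_esum => b _; rewrite sqnorm_hil.
apply: (@le_trans _ _ (c1%:E * \esum_(p in J) (rnorm (input_vector p) ^+ 2)%:E)%E); last first.
  rewrite lee_wpmul2l ?lee_fin// (le_trans _ sum1)//.
  by apply: le_esum => p Jp; rewrite PhiE.
have r0 p : (0 <= (rnorm (input_vector p) ^+ 2)%:E)%E by rewrite lee_fin sqr_ge0.
apply: (le_trans _ (esum_scale c10 (fun p _ => r0 p))).
rewrite (_ : J = [set: int] `*`` (fun=> F)); last first.
  by apply/seteqP; split=> -[n v]/=; [|case].
have -> : (\esum_(p in [set: int] `*`` (fun=> F)) (c1%:E * (rnorm (input_vector p) ^+ 2)%:E) =
    \esum_(n in [set: int]) \esum_(v in F) (c1%:E * (rnorm (input_vector (n, v)) ^+ 2)%:E))%E.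
  rewrite esum_esum; last by move=> n v _ _; rewrite mule_ge0 ?lee_fin ?sqr_ge0.
  by apply: eq_esum => -[].
apply: le_esum => n _; apply: (le_trans (HS_norm2_le_basis _ hF)).
by apply: le_esum => v _; rewrite -EFinM lee_fin.
Qed.

(** Pointwise [2 r d] is at most [r ^ 2 + d ^ 2]. The free parameter [d] replaces Cauchy-Schwarz:
    taken of the size of the L^2 norm, it makes the L^1 norm small along with it. *)
Lemma nint_norm_L2 (u : R -> U) (d : R) : L2_dom T u -> 0 < d ->
  (\int[@lebesgue_measure R]_(t in `[0%R, T]) (rnorm (u t))%:E <=
   ((d * T + d^-1 * @sqnorm R (L2 T U) u) / 2)%:E)%E.
Proof.
move=> du d0; have mu := measurable_sqnorm du.1.
have p2 t : t \in `[0, T] -> 0 <= rnorm (u t) ^+ 2 by move=> _; exact: sqr_ge0.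
have c0 : 0 <= (2 * d)^-1 by rewrite invr_ge0 mulr_ge0// ltW.
have mZ : measurable_fun `[0, T] (fun t => (2 * d)^-1 * rnorm (u t) ^+ 2).
  exact: (measurable_funM (measurable_cst _) mu).
apply: (@le_trans _ _ (\int[@lebesgue_measure R]_(t in `[0%R, T])
    (d / 2 + (2 * d)^-1 * rnorm (u t) ^+ 2)%:E)%E).
  apply: nint_le; first exact: (strongly_measurable_norm du.1).
    exact: (measurable_funD (measurable_cst _) mZ).
  move=> t _; rewrite rnorm_ge0/=; set r := rnorm (u t).
  rewrite -subr_ge0 [X in 0 <= X](_ : _ = (r - d) ^+ 2 * (2 * d)^-1).
    by rewrite mulr_ge0 ?sqr_ge0.
  by field; rewrite gt_eqF.
rewrite (nintD (measurable_cst _) mZ); last 2 first.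
- by move=> t _; rewrite divr_ge0// ltW.
- by move=> t ht; rewrite mulr_ge0// p2.
rewrite nint_cst ?(ltW T0)// nintZ// -L2_sqnorm// -EFinM -EFinD lee_fin invfM.
have e (s : R) : d / 2 * T + 2^-1 / d * s = (d * T + d^-1 * s) / 2 by field; rewrite gt_eqF.
by rewrite -(e (@sqnorm R (L2 T U) u)).
Qed.

Let Slin t : 0 <= t -> linear (Sm1 t).
Proof. by move=> t0; case: Sm1_C0 => h _ _ _; exact: (h t t0).1. Qed.

Let input_lin t : t \in `[0, T] -> linear (fun v : U => Sm1 (T - t) (B v)).
Proof.
rewrite in_itv/= => /andP[_ tT] a v w; rewrite linearP Slin ?subr_ge0//.
Qed.

Let input_bounded : exists2 c : R, 0 <= c &
  forall t v, t \in `[0, T] -> rnorm (Sm1 (T - t) (B v)) <= c * rnorm v.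
Proof.
have Bl : linear B by move=> a v w; rewrite linearP.
have [c c0 hc] := linear_continuous_bounded Bl B_cont.
exists (M * expR (`|w0| * T) * c); first by rewrite !mulr_ge0 ?expR_ge0.
move=> t v; rewrite in_itv/= => /andP[t0 tT]; have s0 : 0 <= T - t by rewrite subr_ge0.
rewrite (le_trans (extrapolation_growth _ s0))//.
rewrite -[leRHS]mulrA ler_pM ?mulr_ge0 ?expR_ge0 ?rnorm_ge0// ler_wpM2l// ler_expR.
rewrite (le_trans (ler_norm _))// normrM (ger0_norm s0) ler_wpM2l// lerBlDr lerDl//.
Qed.

Lemma input_measurable (u : R -> U) : strongly_measurable T u -> strongly_measurable T (input u).
Proof.
have sHm1 := extrapolation_separable.
apply: (strongly_measurable_op (F := fun s v => Sm1 (T - s) (B v)) sHm1); split.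
  move=> t t0; split; first by apply: input_lin; rewrite in_itv.
  have [c c0 hc] := input_bounded; exists c => v; apply: hc; by rewrite in_itv.
move=> v; have growth := extrapolation_growth.
have [c c0 hP] := rescaled_bounded_semigroup Sm1_C0 M0 growth 0 (ltW T0).
have := (sg_op_family_reversed c0 hP).2 (B v).
have P0 t : rescaled Sm1 0 t (B v) = Sm1 t (B v).
  by rewrite /rescaled oppr0 /cexp/= !mul0r expR0 cis0 mulr1 scale1r.
by under eq_fun do rewrite P0.
Qed.

Let input_estimate : exists2 c : R, 0 <= c & forall u V d, L2_dom T u -> 0 < d ->
  is_bochner_integral T (input u) V ->
  rnorm V <= c * (d * T + d^-1 * @sqnorm R (L2 T U) u).
Proof.
have [c c0 hc] := input_bounded; exists (c / 2) => [|u V d du d0 hV].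
  by rewrite divr_ge0.
rewrite -lee_fin (le_trans (bochner_norm hV))//.
apply: (@le_trans _ _ (\int[@lebesgue_measure R]_(t in `[0%R, T]) (c * rnorm (u t))%:E)%E).
  apply: nint_le => [| |t ht]; last by rewrite rnorm_ge0 hc.
    exact: strongly_measurable_norm (input_measurable du.1).
  exact: (measurable_funM (measurable_cst _) (strongly_measurable_norm du.1)).
rewrite nintZ//; last exact: strongly_measurable_norm du.1.
rewrite [c / 2 * _]mulrAC -mulrA EFinM lee_wpmul2l ?lee_fin//.
exact: nint_norm_L2.
Qed.

Lemma input_integrable (u : R -> U) : L2_dom T u ->
  exists V, is_bochner_integral T (input u) V.
Proof.
move=> du; have sHm1 := extrapolation_separable.
have [c c0 hc] := input_bounded.
apply: (bochner_exists sHm1 (input_measurable du.1)).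
apply: (@le_lt_trans _ _ (\int[@lebesgue_measure R]_(t in `[0%R, T]) (c * rnorm (u t))%:E)%E).
  apply: nint_le => [| |t ht]; last by rewrite rnorm_ge0 hc.
    exact: strongly_measurable_norm (input_measurable du.1).
  exact: (measurable_funM (measurable_cst _) (strongly_measurable_norm du.1)).
rewrite nintZ//; last exact: strongly_measurable_norm du.1.
rewrite lte_mul_pinfty ?lee_fin//.
by rewrite (le_lt_trans (nint_norm_L2 du ltr01))// ltry.
Qed.

(** * Input integrals that lie in H *)

Section InputConvergence.
Variables (F : set (hil U)) (hF : orthonormal_basis F) (m : R).
Let J := [set p : int * hil U | F p.2].
Hypothesis hm : (\esum_(p in J) (rnorm (input_vector p) ^+ 2)%:E <= m%:E)%E.
Local Notation b p := (mode_basis T p : L2 T U).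
Local Notation sq f := (@sqnorm R (L2 T U) f).

Let hb := mode_basis_orthonormal T0 sU hF.
Let cb := mode_basis_complete T0 sU hF.

(** Cauchy-Schwarz against the square-summable input vectors: square-summable coefficients are
    enough for convergence in H. *)
Let vectors_bound (Z : seq (int * hil U)) (c : int * hil U -> R[i]) :
  uniq Z -> (forall p, p \in Z -> J p) ->
  rnorm (\sum_(p <- Z) c p *: input_vector p) ^+ 2 <= (\sum_(p <- Z) normc (c p) ^+ 2) * m.
Proof.
move=> uZ ZJ; have r0 : 0 <= rnorm (\sum_(p <- Z) c p *: input_vector p) by [].
apply: (@le_trans _ _ ((\sum_(p <- Z) normc (c p) * rnorm (input_vector p)) ^+ 2)).
  have h := rnorm_sum Z xpredT (fun p => c p *: input_vector p).
  have e : \sum_(p <- Z) rnorm (c p *: input_vector p) =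
      \sum_(p <- Z) normc (c p) * rnorm (input_vector p) by apply: eq_bigr => p _; rewrite rnormZ.
  by rewrite ler_pXn2r ?nnegrE// -e// (le_trans r0).
rewrite (le_trans (sum_CS _ _ _))// ler_wpM2l//; first by rewrite sumr_ge0// => p _; exact: sqr_ge0.
rewrite -lee_fin -sumEFin; apply: le_trans hm.
exact: (esum_ge_seq (fun p => (rnorm (input_vector p) ^+ 2)%:E) uZ ZJ).
Qed.

Let input_proj (X : seq (int * hil U)) (f : L2 T U) :
  is_bochner_integral T (input (up (ortho_proj (fun p => b p) X f)))
    (j (\sum_(p <- X) rep_dot f (b p) *: input_vector p)).
Proof.
have := bochner_sum X (fun p => bochnerZ (rep_dot f (b p)) (input_basis p)).
rewrite linear_sum; under [in X in is_bochner_integral _ _ X -> _]eq_bigr do rewrite -linearZ.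
apply: bochner_ext => t ht; have lin := input_lin ht.
rewrite /ortho_proj; elim: X => [|p X ih].
  by rewrite !big_nil scaler0 (linear_at0 lin).
rewrite !big_cons ih.
rewrite -[RHS]/(Sm1 _ (B (_ *: (rep_dot f (b p) *: b p t + _)))).
have e (a c : R[i]) (v : U) : c *: (a *: v) = a *: (c *: v) by rewrite !scalerA mulrC.
by rewrite scalerDr (e (rep_dot f (b p)) (cexp omega%:C t) (mode_basis T p t)) lin.
Qed.

(** The integral [V] exists in [Hm1] and has to be found in the range of [j]. For finite projections
    of the unweighted input it is [j (y i)]; the [y i] are Cauchy in H by [cut_bound] and
    [vectors_bound], and [j (y i)] tends to [V] by [input_estimate]. *)
Lemma input_exists (u : R -> U) : L2_dom T u ->
  exists2 y, is_bochner_integral T (input u) (j y) &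
    rnorm y ^+ 2 <= 2 * m * (expR (`|- omega| * T) ^+ 2 * sq u).
Proof.
move=> du; pose f : L2 T U := fun t => cexp (- omega)%:C t *: u t.
have [df sf] := L2_weight sU (- omega) du.
have uf : up f = u by apply/funext => t; rewrite /f cexp_weightK.
have m0 : 0 <= m.
  by rewrite -lee_fin (le_trans _ hm)// esum_ge0// => p _; rewrite lee_fin sqr_ge0.
have pars := parseval L2A hb cb df.
have /choice[X hX] : forall i : nat, exists X : seq (int * hil U),
    [/\ uniq X, forall p, p \in X -> J p &
      sq f - i.+1%:R^-1 <= \sum_(p <- X) normc (rep_dot f (b p)) ^+ 2].
  by move=> i; apply: (esum_approx pars); rewrite invr_gt0.
pose y i := \sum_(p <- X i) rep_dot f (b p) *: input_vector p.
have yC i l : rnorm (y i - y l) ^+ 2 <= (i.+1%:R^-1 + l.+1%:R^-1) * m.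
  have [u1 J1 h1] := hX i; have [u2 J2 h2] := hX l.
  have [Z [c [uZ JZ cZ ->]]] := cut_bound u1 u2 J1 J2 pars h1 h2.
  by rewrite (le_trans (vectors_bound _ uZ JZ))// ler_wpM2r.
have small (e : R) : 0 < e -> exists N : nat, forall i, (N <= i)%N -> i.+1%:R^-1 <= e.
  move=> e0; have [N _ hN] := near_infty_natSinv_lt (PosNum e0).
  by exists N => i hi; rewrite ltW//; exact: hN.
have [|z hz] := @rcomplete _ _ y.
  move=> e e0; have m1 : 0 < 2 * m + 1 by rewrite ltr_wpDl ?mulr_ge0.
  have [|N hN] := small (e ^+ 2 / (2 * m + 1)); first by rewrite divr_gt0 ?exprn_gt0.
  exists N => i l hi hl'; rewrite -(@ler_pXn2r _ 2) ?nnegrE ?rnorm_ge0 ?(ltW e0)//.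
  rewrite (le_trans (yC i l))//.
  rewrite (@le_trans _ _ ((2 * (e ^+ 2 / (2 * m + 1))) * m))//.
    by rewrite ler_wpM2r// mulr_natl mulr2n lerD ?hN.
  rewrite mulrAC [2 * m * _]mulrC mulrAC ler_pdivrMr// ler_wpM2l ?sqr_ge0//.
  by rewrite lerDl.
have hz' := (rcvg_seqP _ _).1 hz.
have sqp i : sq (f - ortho_proj (fun p => b p) (X i) f) <= i.+1%:R^-1.
  have [u1 J1 h1] := hX i; rewrite (sqnorm_proj L2A hb u1 J1 df).
  by rewrite lerBlDl -lerBlDr.
have [V hV] := input_integrable du; have [c c0 hc] := input_estimate.
have [cj cj0 hcj] := extrapolation_bounded.
pose c2 := expR (`|omega| * T) ^+ 2; have c20 : 0 <= c2 by exact: sqr_ge0.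
(* With [d ^ 2] above the squared L^2 error of the projection, both terms of [input_estimate] are of
   order [d]. *)
have Vi i d : 0 < d -> i.+1%:R^-1 <= d ^+ 2 -> rnorm (V - j (y i)) <= c * (T + c2) * d.
  move=> d0 hi; pose r : L2 T U := f - ortho_proj (fun p => b p) (X i) f.
  have [u1 J1 h1] := hX i.
  have dr : L2_dom T r by apply: (domB L2A df); exact: (dom_proj L2A hb).
  have [dup sup] := L2_weight sU omega dr.
  have h : is_bochner_integral T (input (up r)) (V - j (y i)).
    apply: bochner_ext (bochnerB hV (input_proj (X i) f)) => t ht.
    have lin := input_lin ht; rewrite -[u in LHS]uf.
    rewrite -[RHS]/(Sm1 _ (B (_ *: (f t - ortho_proj (fun p => b p) (X i) f t)))).
    have sub (x y' : U) : Sm1 (T - t) (B (x - y')) = Sm1 (T - t) (B x) - Sm1 (T - t) (B y').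
      by have := lin (-1) y' x; rewrite !scaleN1r [- y' + x]addrC [RHS]addrC.
    by rewrite scalerBr sub.
  rewrite (le_trans (hc _ _ _ dup d0 h))// -mulrA ler_wpM2l// [leRHS]mulrDl [T * d]mulrC lerD2l.
  rewrite ler_pdivrMl// (le_trans sup)// mulrCA mulrA -/c2 -[leRHS]mulrA ler_wpM2l// -expr2.
  exact: le_trans (sqp i) hi.
have Vz : V = j z.
  apply/eqP; rewrite -subr_eq0 -rnorm_eq0E eq_le rnorm_ge0 andbT.
  apply: (@le_mul_eps _ _ _ (c * (T + c2) + cj)).
    by rewrite !addr_ge0 ?mulr_ge0 ?addr_ge0// ltW.
  move=> e e0; rewrite add0r; have [N1 h1] := hz' e e0.
  have [|N2 h2] := small (e ^+ 2); first by rewrite exprn_gt0.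
  pose N := maxn N1 N2; rewrite (le_trans (rdistD (j (y N)) _ _))// mulrDl lerD//.
    by apply: Vi => //; rewrite h2 ?leq_maxr.
  by rewrite -linearB (le_trans (hcj _))// ler_wpM2l// h1 ?leq_maxl.
exists z; first by rewrite -Vz.
rewrite (@le_trans _ _ (2 * m * sq f))//; last by rewrite ler_wpM2l ?mulr_ge0.
apply: (@le_mul_eps _ _ _ 2) => // e e0.
have e1 : 0 < Num.min e 1 by rewrite lt_min e0 ltr01.
have [N hN] := hz' _ e1; have := hN N (leqnn _); rewrite le_min => /andP[a1 a2].
have [u1 J1 h1] := hX N.
have -> : z = y N - (y N - z) by rewrite subKr.
rewrite (le_trans (rnorm_sqr_le _ _))// rnormN lerD//.
  rewrite -mulrA ler_wpM2l// (le_trans (vectors_bound _ u1 J1))// mulrC ler_wpM2l//.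
  rewrite -lee_fin -pars -sumEFin.
  exact: (esum_ge_seq (fun p => (normc (rep_dot f (b p)) ^+ 2)%:E) u1 J1).
by rewrite ler_wpM2l// expr2 (le_trans _ a1)// ler_piMr ?rnorm_ge0.
Qed.

End InputConvergence.

(** [input_exists] yields a bounded [Phi] by choice, linear because integrals are unique and [j] is
    injective. Its Hilbert-Schmidt norm is then estimated on the basis of modes. *)
Lemma sum_admissible_control :
  (\esum_(n in [set: int]) @HS_norm2 R (hil U) (hil H) (D (lam n)) < +oo)%E ->
  S_admissible_control T j Sm1 B.
Proof.
move=> hsum; have [F hF] := orthonormal_basis_exists U.
pose J := [set p : int * hil U | F p.2].
have hb := mode_basis_orthonormal T0 sU hF.
have cb := mode_basis_complete T0 sU hF.
have HS0 n : (0 <= @HS_norm2 R (hil U) (hil H) (D (lam n)))%E.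
  by apply: HS_norm2_ge0 => //; exact: hil_axioms.
have Ql := @decay_step_linear _ _ _ omega _ SC T0.
pose q := 1 + expR (- (omega * T)) * (M * expR (w0 * T)).
have q0 : 0 <= q by rewrite addr_ge0 ?mulr_ge0 ?expR_ge0.
have hq x : rnorm (x - Q x) <= q * rnorm x.
  rewrite (le_trans (rnormB _ _))// mulrDl mul1r lerD2l /decay_step rnormZ normc_real.
  by rewrite ger0_norm ?expR_ge0// -mulrA ler_wpM2l ?expR_ge0// hS// ltW.
pose kap := expR (omega * T) * (Num.sqrt T)^-1 * q.
have kap0 : 0 <= kap by rewrite !mulr_ge0 ?expR_ge0 ?invr_ge0 ?sqrtr_ge0.
pose c1 := kap ^+ 2; have c10 : 0 <= c1 by exact: sqr_ge0.
have le_input n v : rnorm (input_vector (n, v)) ^+ 2 <= c1 * rnorm (D (lam n) v) ^+ 2.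
  rewrite -exprMn ler_pXn2r ?nnegrE ?mulr_ge0 ?rnorm_ge0//.
  rewrite /input_vector/= 2!rnormZ !normc_real !ger0_norm ?expR_ge0 ?invr_ge0 ?sqrtr_ge0//.
  rewrite mulrA /kap -[leRHS]mulrA ler_wpM2l ?hq// mulr_ge0 ?expR_ge0 ?invr_ge0 ?sqrtr_ge0//.
have sfin : (\esum_(p in J) (rnorm (input_vector p) ^+ 2)%:E < +oo)%E.
  rewrite (_ : J = [set: int] `*`` (fun=> F)); last first.
    by apply/seteqP; split=> -[n v]/=; [|case].
  have -> : (\esum_(p in [set: int] `*`` (fun=> F)) (rnorm (input_vector p) ^+ 2)%:E =
      \esum_(n in [set: int]) \esum_(v in F) (rnorm (input_vector (n, v)) ^+ 2)%:E)%E.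
    rewrite esum_esum; last by move=> n v _ _; rewrite lee_fin sqr_ge0.
    by apply: eq_esum => -[].
  apply: (@le_lt_trans _ _ (\esum_(n in [set: int])
      ((c1 * 2)%:E * @HS_norm2 R (hil U) (hil H) (D (lam n))))%E).
    apply: le_esum => n _; rewrite EFinM -muleA.
    have [cD cD0 hD] := D_bdd n.
    apply: (le_trans _ (lee_wpmul2l _ (HS_norm2_ge_basis (@D_lin n) cD0 hD hF))); rewrite ?lee_fin//.
    apply: (le_trans _ (esum_scale c10 _)); last by move=> v _; rewrite lee_fin sqr_ge0.
    by apply: le_esum => v _; rewrite -EFinM lee_fin.
  apply: le_lt_trans; first exact: (esum_scale (mulr_ge0 c10 (ler0n R 2)) (fun n _ => HS0 n)).
  by rewrite lte_mul_pinfty ?lee_fin ?mulr_ge0.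
set s := \esum_(p in J) _ in sfin.
have s0 : (0 <= s)%E by apply: esum_ge0 => p _; rewrite lee_fin sqr_ge0.
have hm : (s <= (fine s)%:E)%E by rewrite fineK// ge0_fin_numE.
set m := fine s in hm; have m0 : 0 <= m by exact: fine_ge0.
pose c2 := 2 * m * expR (`|- omega| * T) ^+ 2.
(* The premise stands inside the existential so that choice applies to every function; outside
   [L2_dom] the value is 0. *)
have /choice[Phi hPhi] : forall u : L2 T U, exists y : H, L2_dom T u ->
    is_bochner_integral T (input u) (j y) /\ rnorm y ^+ 2 <= c2 * @sqnorm R (L2 T U) u.
  move=> u; have [du|] := pselect (L2_dom T u); last by exists 0.
  by have [y h1 h2] := input_exists hF hm du; exists y => _; rewrite /c2 -mulrA.
have Plin a (u u' : L2 T U) : rep_dom (L2 T U) u -> rep_dom (L2 T U) u' ->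
    Phi (a *: u + u') = a *: Phi u + Phi u'.
  move=> du du'; apply: extrapolation_inj.
  apply: bochner_unique (hPhi _ (dom_lin L2A a du du')).1 _.
  rewrite linearP; apply: bochner_ext (bochner_lin a (hPhi _ du).1 (hPhi _ du').1) => t ht.
  by have lin := input_lin ht; rewrite -lin.
exists Phi; last by move=> u du; exact: (hPhi u du).1.
split=> //.
- by move=> a u u' du du'; rewrite Plin// subrr sqnorm_hil rnorm0 expr0n.
- by exists c2 => u du; rewrite sqnorm_hil; exact: (hPhi u du).2.
pose BB : set (L2 T U) := mode_basis T @` J.
have hBB : orthonormal_basis BB.
  split=> [_ [p Jp <-]|_ [p Jp <-]|_ _ [p Jp <-] [p' Jp' <-] ne|f df h].
  - exact: hb.1.
  - by rewrite hb.2// eqxx.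
  - by rewrite hb.2//; case: eqP => // e; rewrite e eqxx in ne.
  - by apply: cb => // p Jp; apply: h; exists p.
(* A basis is a set of functions: to sum over index pairs instead, distinct pairs must give distinct
   modes, which orthonormality ensures. *)
have binj : set_inj J (fun p => mode_basis T p : L2 T U).
  move=> p p'; rewrite !inE => Jp Jp' e; apply/eqP/negPn/negP => ne.
  have := hb.2 p p' Jp Jp'; rewrite (negbTE ne) e hb.2// eqxx => /eqP.
  by rewrite oner_eq0.
apply: (le_lt_trans (HS_norm2_le_basis _ hBB)).
rewrite esum_image//.
pose c3 := expR (`|- omega| * T) ^+ 2; have c30 : 0 < c3 by rewrite exprn_gt0 ?expR_gt0.
pose c4 := expR (`|omega| * T) ^+ 2; have c40 : 0 <= c4 by exact: sqr_ge0.
pose down (f : L2 T U) : L2 T U := fun t => cexp (- omega)%:C t *: f t.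
(* [Phi] is known on weighted modes, whereas the basis consists of bare ones. Since [up] undoes
   [down], the transfer is applied to [Phi] after [up], with the modes as basis and their images
   under [down] as the Bessel family. *)
have := @hilbert_schmidt_transfer R (L2 T U) L2A H (fun f => Phi (up f)) (c2 * c4) _ _ _ _ _ J
  (fun p => mode_basis T p) J (fun p => down (mode_basis T p)) c3 hb cb.
have upl a (f f' : L2 T U) : up (a *: f + f') = a *: (up f : L2 T U) + up f'.
  apply/funext => t; rewrite -[LHS]/(_ *: (a *: f t + f' t)) scalerDr scalerA mulrC -scalerA//.
have dup f : L2_dom T f -> L2_dom T (up f) := fun df => (L2_weight sU omega df).1.
rewrite (_ : \esum_(p in J) (rnorm (Phi (up (down (mode_basis T p)))) ^+ 2)%:E =
  \esum_(p in J) (rnorm (Phi (mode_basis T p)) ^+ 2)%:E)%E; last first.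
  apply: eq_esum => p _; congr ((rnorm (Phi _) ^+ 2)%:E); apply/funext => t.
  exact: cexp_weightK.
rewrite (_ : \esum_(p in J) (rnorm (Phi (up (mode_basis T p))) ^+ 2)%:E = s)%E; last first.
  apply: eq_esum => p Jp; congr ((rnorm _ ^+ 2)%:E); apply: extrapolation_inj.
  have h := (hPhi _ (dup _ (hb.1 p Jp))).1.
  exact: (bochner_unique h (input_basis p)).
move=> h; apply: (@le_lt_trans _ _ (c3%:E * s)%E); last by rewrite lte_mul_pinfty ?lee_fin ?ltW.
apply: h => //.
- by move=> a f f' df df'; rewrite upl Plin//; exact: dup.
- by rewrite mulr_ge0// !mulr_ge0 ?sqr_ge0.
- move=> f df; rewrite (le_trans (hPhi _ (dup _ df)).2)// -[leRHS]mulrA ler_wpM2l//.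
    by rewrite mulr_ge0 ?sqr_ge0// mulr_ge0.
  exact: (L2_weight sU omega df).2.
- by move=> p Jp; exact: (L2_weight sU (- omega) (hb.1 p Jp)).1.
- apply: (orthonormal_bessel L2A hb (N := down)) => [a f f'|f df].
    by apply/funext => t; rewrite -[LHS]/(_ *: (a *: f t + f' t)) scalerDr scalerA mulrC -scalerA.
  exact: (L2_weight sU (- omega) df).2.
Qed.

End Extrapolation.

Theorem proposition3p8 (R : realType) (H U Y Z : hilbertType R)
  (hH : separable H) (hU : separable U) (hY : separable Y) (hZ : separable Z)
  (* Z is continuously and densely embedded in H *)
  (iota : {linear Z -> H}) (iota_cont : continuous iota)
  (iota_inj : injective iota) (iota_dense : dense (range iota))
  (T : R) (T_gt0 : 0 < T)
  (Am : {linear Z -> H}) (Am_closed : closed (range (fun z => (iota z, Am z))))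
  (G : {linear Z -> U}) (G_surj : range G = [set: U])
  (S : R -> H -> H) (S_C0 : C0_semigroup S)
  (A : set (H * H)) (defA : A = boundary_op iota Am G)
  (A_gen : A = generator S)
  (D : R[i] -> U -> H) (defD : D = dirichlet iota Am G)
  (D_bounded : forall l, resolvent_set A l -> linear (D l) /\ continuous (D l))
  (beta : R[i]) (hbeta : resolvent_set A beta)
  (Hm1 : completeNormedModType R[i]) (j : {linear H -> Hm1})
  (hj : extrapolation_space A beta j)
  (Sm1 : R -> Hm1 -> Hm1) (Sm1_C0 : C0_semigroup Sm1)
  (Sm1_ext : forall t x, 0 <= t -> Sm1 t (j x) = j (S t x))
  (B : {linear U -> Hm1}) (B_cont : continuous B)
  (* B = (l - A_{-1}) D_l, where A_{-1} is the generator of Sm1 *)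
  (defB : forall l u, resolvent_set A l ->
     exists2 w, generator Sm1 (j (D l u), w) & B u = l *: j (D l u) - w)
  (C : H -> Y) (C_bounded : bounded_on_H1 A beta C)
  (omega : R) (h_omega : (growth_bound S < omega%:E)%E) :
  let lambda (n : int) : R[i] := omega +i* (2 * pi * n%:~R / T) in
  (S_admissible_observation T A S C <->
   (\esum_(n in [set: int])
      @HS_norm2 R (hil H) (hil Y) (fun x => C (resolvent A (lambda n) x))
      < +oo)%E) /\
  (S_admissible_control T j Sm1 B <->
   (\esum_(n in [set: int])
      @HS_norm2 R (hil U) (hil H) (D (lambda n)) < +oo)%E).
Proof.
move=> lambda; have [w0 [w0_lt [M M0 hS]]] := growth_bound_lt h_omega.
clear defA; subst A; split; split.
- exact: (admissible_observation_sum hH hY S_C0 M0 hS T_gt0 w0_lt hbeta C_bounded).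
- exact: (sum_admissible_observation hH hY S_C0 M0 hS T_gt0 w0_lt hbeta C_bounded).
- exact: (admissible_control_sum hH hU S_C0 M0 hS T_gt0 w0_lt hbeta hj Sm1_C0 Sm1_ext
    defB D_bounded).
- exact: (sum_admissible_control hH hU S_C0 M0 hS T_gt0 w0_lt hbeta hj Sm1_C0 Sm1_ext B_cont
    defB D_bounded).
Qed.
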